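(* Let $P$ be a finite set with a symmetric reflexive relation $\mathcal{C}$, and let $\Gamma$ be the concurrency graph of $H(P,\mathcal{C})$. Then $H(P,\mathcal{C})$ is a regular class of heaps if and only if each connected component of $\Gamma$ is a complete graph $K_n$, or a graph of type $A_n$ ($n\ge1$), $D_n$ ($n\ge4$), $E_n$ ($n\ge6$), $\widetilde{A}_{n-1}$ ($n\ge3$, $n$ odd), or $\widetilde{E}_6$.
   Context: Heaps: a labelled heap with pieces in $P$ is $(E,\le,\varepsilon)$ with $(E,\le)$ a finite poset, $\varepsilon:E\to P$, such that elements with $\varepsilon(a)\,\mathcal{C}\,\varepsilon(b)$ are comparable and $\le$ is the transitive closure of ''$a\le b$ and $\varepsilon(a)\,\mathcal{C}\,\varepsilon(b)$''; heaps are label-preserving isomorphism classes, forming $H(P,\mathcal{C})$. Subheaps on $F\subseteq E$ carry the transitive closure of the same relation restricted to $F$; $E(v)$ is the subheap on $E\setminus\{v\}$. A heap is trivial if its order is trivial; $\mathcal{L}(E)$, $\mathcal{R}(E)$ denote minimal, maximal elements. A convex chain is a chain $x_1<\dots<x_t$ containing every $y$ with $x_i<y<x_j$; length $t$; balanced if $\varepsilon(x_1)=\varepsilon(x_t)$. Property P2: no balanced convex chain of length 2 or 3. $E(a)\prec^+E$ if $a\in\mathcal{R}(E)$ and some $b\in\mathcal{R}(E(a))\setminus\mathcal{R}(E)$ has $\varepsilon(b)\ne\varepsilon(a)$; $\prec^-$ likewise with minimal elements; $\prec$ means either. Property P1: there is a (possibly trivial) sequence $E_1\prec E_2\prec\cdots\prec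 E$ with $E_1$ trivial. $H(P,\mathcal{C})$ is regular if every heap with P2 has P1. The concurrency graph has vertex set $P$ and an edge between $v\ne w$ iff $v\,\mathcal{C}\,w$. For nonnegative $p\le q\le r$, $\Gamma(p,q,r)$ is the tree consisting of a vertex $c$ joined to an end of each of three disjoint paths with $p$, $q$, $r$ vertices. Type $A_n$: path on $n$ vertices ($=\Gamma(0,0,n-1)$); type $D_n$: $\Gamma(1,1,n-3)$; type $E_n$: $\Gamma(1,2,n-4)$; type $\widetilde{A}_{n-1}$: cycle on $n$ vertices; type $\widetilde{E}_6$: $\Gamma(2,2,2)$ (7 vertices). *)

(* Defs.v *)
From mathcomp Require Import all_boot.
From Stdlib Require Relation_Operators.

Set Implicit Arguments.
Unset Strict Implicit.
Unset Printing Implicit Defensive.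

(* [connect] is the reflexive transitive closure. For reflexive [C] the relation
   "a <= b and lab a C lab b" is reflexive, so that [connect] of it is its
   transitive closure. *)
Record heap (P : finType) (C : rel P) : Type := Heap {
  carrier :> finType;
  lab : carrier -> P;
  le : rel carrier;
  le_refl : reflexive le;
  le_anti : antisymmetric le;
  le_trans : transitive le;
  le_comparable : forall a b, C (lab a) (lab b) -> le a b || le b a;
  le_closure : forall a b,
    le a b = connect (fun x y => le x y && C (lab x) (lab y)) a b
}.

Section Heaps.

Variables (P : finType) (C : rel P) (Csym : symmetric C).

Section OneHeap.

Variable E : heap C.

Definition lt (x y : E) : bool := (x != y) && le x y.

Definition trivial_heap : Prop := forall x y : E, le x y -> x = y.

Definition minimals : {set E} := [set x | [forall y, ~~ lt y x]].
Definition maximals : {set E} := [set x | [forall y, ~~ lt x y]].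

Definition convex_chain (s : seq E) : Prop :=
  sorted lt s /\
  forall x y z : E, x \in s -> z \in s -> lt x y -> lt y z -> y \in s.

Definition balanced (s : seq E) : Prop :=
  if s is x :: s' then lab x = lab (last x s') else False.

Definition P2 : Prop :=
  forall s : seq E, convex_chain s -> balanced s ->
    size s <> 2 /\ size s <> 3.

End OneHeap.

Section Subheap.

Variables (E : heap C) (F : {set E}).

Definition sub_lab (x : {x : E | x \in F}) : P := lab (val x).

Definition sub_step : rel {x : E | x \in F} :=
  fun x y => le (val x) (val y) && C (sub_lab x) (sub_lab y).

Definition sub_le : rel {x : E | x \in F} := connect sub_step.

Lemma sub_le_le x y : sub_le x y -> le (val x) (val y).
Proof.
case/connectP=> s; elim: s x => [|z s IHs] x /=.
  by move=> _ ->; exact: le_refl.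
case/andP=> /andP[lexz _] zs ylast.
by apply: le_trans lexz _; apply: IHs.
Qed.

Lemma sub_le_refl : reflexive sub_le.
Proof. exact: connect0. Qed.

Lemma sub_le_anti : antisymmetric sub_le.
Proof.
move=> x y /andP[/sub_le_le xy /sub_le_le yx].
by apply: val_inj; apply: le_anti; rewrite xy yx.
Qed.

Lemma sub_le_trans : transitive sub_le.
Proof. by move=> y x z; apply: connect_trans. Qed.

Lemma sub_le_comparable a b :
  C (sub_lab a) (sub_lab b) -> sub_le a b || sub_le b a.
Proof.
move=> Cab; case/orP: (le_comparable Cab) => le_ab; apply/orP.
  by left; apply: connect1; rewrite /sub_step le_ab.
by right; apply: connect1; rewrite /sub_step le_ab Csym.
Qed.

Lemma sub_le_closure a b :
  sub_le a b = connect (fun x y => sub_le x y && C (sub_lab x) (sub_lab y)) a b.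
Proof.
apply/idP/idP; apply: connect_sub => x y.
  move=> xy; apply: connect1; case/andP: (xy) => _ ->.
  by rewrite andbT; apply: connect1.
by case/andP.
Qed.

Definition subheap : heap C :=
  Heap sub_le_refl sub_le_anti sub_le_trans sub_le_comparable sub_le_closure.

End Subheap.

(* E(v) *)
Definition del (E : heap C) (v : E) : heap C := subheap [set~ v].

Definition prec_plus (F E : heap C) : Prop :=
  exists a : E, [/\ F = del a, a \in maximals E &
    exists b : del a, [/\ b \in maximals (del a), val b \notin maximals E &
      lab (val b) != lab a]].

Definition prec_minus (F E : heap C) : Prop :=
  exists a : E, [/\ F = del a, a \in minimals E &
    exists b : del a, [/\ b \in minimals (del a), val b \notin minimals E &
      lab (val b) != lab a]].

Definition prec (F E : heap C) : Prop := prec_plus F E \/ prec_minus F E.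

Definition P1 (E : heap C) : Prop :=
  exists2 E1 : heap C, trivial_heap E1 &
    Relation_Operators.clos_refl_trans (heap C) prec E1 E.

(* [P2] and [P1] are invariant under label-preserving isomorphism, so that
   quantifying over labelled heaps amounts to quantifying over the isomorphism
   classes in H(P, C). *)
Definition regular : Prop := forall E : heap C, P2 E -> P1 E.

End Heaps.

Record graph : Type := Graph { vertex :> finType; adj : rel vertex }.

Definition graph_iso (G H : graph) : Prop :=
  exists2 f : G -> H, bijective f & forall x y, adj (f x) (f y) = adj x y.

Definition concurrency_graph (P : finType) (C : rel P) : graph :=
  @Graph P (fun v w => (v != w) && C v w).

(* The subgraph induced on the connected component of v. *)
Definition component (G : graph) (v : G) : graph :=
  @Graph {w : G | connect (@adj G) v w} (fun x y => adj (val x) (val y)).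

Definition path_adj : rel nat := fun i j => (i.+1 == j) || (j.+1 == i).

Definition complete_graph (n : nat) : graph :=
  @Graph 'I_n (fun i j => i != j).

Definition path_graph (n : nat) : graph :=
  @Graph 'I_n (fun i j => path_adj i j).

(* The cycle on n vertices; a simple graph only for n >= 2, a cycle for n >= 3. *)
Definition cycle_graph (n : nat) : graph :=
  @Graph 'I_n (fun i j => (i.+1 %% n == j) || (j.+1 %% n == i)).

(* [None] is the central vertex c; vertex 0 of each of the three paths is the
   end joined to c. *)
Definition star_adj (p q r : nat) : rel (option ('I_p + 'I_q + 'I_r)) :=
  fun x y => match x, y with
  | None, None => false
  | None, Some z | Some z, None =>
      match z with
      | inl (inl i) => i == 0 :> nat
      | inl (inr i) => i == 0 :> nat
      | inr i => i == 0 :> nat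
      end
  | Some (inl (inl i)), Some (inl (inl j)) => path_adj i j
  | Some (inl (inr i)), Some (inl (inr j)) => path_adj i j
  | Some (inr i), Some (inr j) => path_adj i j
  | _, _ => false
  end.

Definition star_graph (p q r : nat) : graph := Graph (@star_adj p q r).

Definition type_A (n : nat) : graph := path_graph n.
Definition type_D (n : nat) : graph := star_graph 1 1 (n - 3).
Definition type_E (n : nat) : graph := star_graph 1 2 (n - 4).
(* [type_affA n] is affine type A of rank n - 1, which has n vertices. *)
Definition type_affA (n : nat) : graph := cycle_graph n.
Definition type_affE6 : graph := star_graph 2 2 2.

Definition regular_type (G : graph) : Prop :=
  (exists n, graph_iso G (complete_graph n)) \/
  (exists2 n, 1 <= n & graph_iso G (type_A n)) \/
  (exists2 n, 4 <= n & graph_iso G (type_D n)) \/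
  (exists2 n, 6 <= n & graph_iso G (type_E n)) \/
  (exists2 n, (3 <= n) && odd n & graph_iso G (type_affA n)) \/
  graph_iso G type_affE6.

(* Main.v *)
Require Import Defs.
From mathcomp Require Import all_boot.
From mathcomp Require Import zify.
From Stdlib Require Import Relation_Operators Operators_Properties.

Set Implicit Arguments.
Unset Strict Implicit.
Unset Printing Implicit Defensive.

(** A step of property P1 removes an extremal element [a] exposing [b], which means
    that [a] is the only element above (or below) [b]. Since P2 is inherited by the
    smaller heap, [H(P, C)] is regular iff a heap with P2 in which no element has
    exactly one element above it or exactly one below it is trivial. Read along a
    linear extension, P2 says that two occurrences of a letter have at least two
    neighbouring letters between them.

    For the graphs of the list there is no nontrivial such word. On an arm of a
    spider, two occurrences of a vertex enclose one of the next vertex towards the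
    centre [c], so each gap between consecutive occurrences of [c] meets at least
    two arms, and meets each at most once; a short arm cannot meet many consecutive
    gaps. For arms of length at most 1 and 2, this forces the third arm to meet all
    gaps, and following it outwards leads to a contradiction at its leaf. On an odd
    cycle, the first occurrences orient the edges so that sources and sinks
    alternate.

    Conversely, even cycles, cycles with one pendant vertex, the graph K4 minus an
    edge, the graphs affine D, and the spiders Γ(1,3,3) and Γ(2,2,3) carry
    nontrivial such words, and a connected graph outside the list contains one of
    them as an induced subgraph: if it has a triangle, look at a maximal clique;
    otherwise look at the neighbours of a longest induced path. *)

(** * Heaps without elements having a single element above or below *)

(* Boolean hypotheses foreign to the order on [nat] make [lia] very slow. *)
Ltac order_lia :=
  let arith b := lazymatch b with
    | leq _ _ => idtac | andb _ _ => idtac | orb _ _ => idtac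
    | eq_op _ _ => idtac | odd _ => idtac | negb (eq_op _ _) => idtac
    | negb (odd _) => idtac end in
  repeat match goal with
  | H : is_true ?b |- _ => tryif arith b then fail else clear H
  | H : ?b = ?c :> bool |- _ => tryif first [arith b | arith c] then fail else clear H
  end; lia.

(** Words suffice because the exclusions are local. A sole element [a] above [b] is a neighbour of
    [b] and is maximal, so ruling it out asks only for a second neighbour after [b] or for some
    neighbour after [a].

    The contradiction at the leaf of the long arm comes from an alternation of levels. If every gap
    of level k meets level k + 1, the same holds one level further out. If the word begins with k +
    1 before k, then k + 1 comes before k + 2 as well; if it begins with k before k + 1, then k + 2
    comes before k + 1. Used at both ends of the word, this makes level k + 2 occur whenever levels
    k and k + 1 do, so the arm cannot end.

    Three arms of length at most 2 need another argument, as no arm is forced to meet all gaps: any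
    two consecutive gaps share an arm, and such a repetition is impossible next to the first centre.

    On the cycle, the earlier of the first occurrences of two adjacent letters has nothing adjacent
    before it, while the later one has; hence the alternation, which an odd length forbids. *)

Section HeapOrder.

Variables (P : finType) (C : rel P) (Csym : symmetric C) (E : heap C).
Implicit Types x y z : E.

Lemma lt_le_trans y x z : lt x y -> le y z -> lt x z.
Proof.
case/andP=> nxy lxy lyz; rewrite /lt (le_trans lxy lyz) andbT.
apply: contra nxy => /eqP exz; apply/eqP/le_anti; rewrite lxy /=.
by rewrite exz.
Qed.

Lemma le_lt_trans y x z : le x y -> lt y z -> lt x z.
Proof.
move=> lxy /andP[nyz lyz]; rewrite /lt (le_trans lxy lyz) andbT.
apply: contra nyz => /eqP exz; apply/eqP/le_anti; rewrite lyz /=.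
by rewrite -exz.
Qed.

Lemma ltE x y : lt x y -> le x y. Proof. by case/andP. Qed.

Lemma lt_transH : transitive (@lt _ _ E).
Proof. by move=> y x z xy /ltE; apply: lt_le_trans. Qed.

Lemma lt_irr x : lt x x = false. Proof. by rewrite /lt eqxx. Qed.

Lemma lt_asym x y : lt x y -> lt y x = false.
Proof. by move=> xy; apply/negP => /(lt_transH xy); rewrite lt_irr. Qed.

Lemma le_eqVltH x y : le x y = (x == y) || lt x y.
Proof. by rewrite /lt; case: eqP => //= ->; apply: le_refl. Qed.

Lemma lt_first_step x y : lt x y ->
  exists u, [/\ C (lab x) (lab u), lt x u & le u y].
Proof.
case/andP=> nxy; rewrite le_closure => /connectP[s].
elim: s x nxy => [|z s IHs] x nxy /=; first by move=> _ e; rewrite e eqxx in nxy.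
case/andP=> /andP[lxz Cxz] zs ylast.
have [exz|nxz] := eqVneq x z; first by subst z; apply: IHs.
exists z; rewrite /lt nxz lxz; split=> //.
by rewrite le_closure; apply/connectP; exists s.
Qed.

Lemma lt_last_step x y : lt x y ->
  exists u, [/\ C (lab u) (lab y), lt u y & le x u].
Proof.
case/andP=> nxy; rewrite le_closure => /connectP[s].
elim/last_ind: s y nxy => [|s z IHs] y nxy /=.
  by move=> _ e; rewrite e eqxx in nxy.
rewrite rcons_path last_rcons => /andP[xs /andP[lxz Cxz]] ey; subst y.
have [exz|nxz] := eqVneq (last x s) z; first exact: IHs.
exists (last x s); rewrite /lt nxz lxz; split=> //.
by rewrite le_closure; apply/connectP; exists s.
Qed.

Lemma comparable_lt x y : C (lab x) (lab y) -> x != y -> lt x y || lt y x.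
Proof.
move=> /le_comparable /orP[] l n; rewrite /lt n l //=.
by rewrite eq_sym n orbT.
Qed.

(** Whatever lies strictly between [x] and [y] is above some element, and below some element, of the
    interval with label concurrent with [lab x]. If there were only one such element [u], it would
    be the whole interval, and [x], [u], [y] would be a balanced convex chain of length 3; an empty
    interval gives one of length 2. *)
Lemma P2_between : P2 E -> forall x y, lt x y -> lab x = lab y ->
  exists u v, [/\ u != v, lt x u && lt u y, lt x v && lt v y,
    C (lab x) (lab u) & C (lab x) (lab v)].
Proof.
move=> hP2 x y xy exy.
have sbetween z : lt x z -> lt z y -> exists u, [/\ lt x u && lt u y, C (lab x) (lab u) & le u z].
  move=> xz zy; have [u [Cu xu uz]] := lt_first_step xz.
  by exists u; rewrite xu (le_lt_trans uz zy).
have [/existsP[z /andP[xz zy]]|/existsPn emp] := boolP [exists z, lt x z && lt z y]; last first.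
  have [] // := hP2 [:: x; y]; split=> /=; first by rewrite xy.
  move=> a z b; rewrite !inE => /orP[]/eqP-> /orP[]/eqP-> az zb; have := lt_transH az zb.
  - by rewrite lt_irr.
  - by have := emp z; rewrite az zb.
  - by rewrite lt_asym.
  - by rewrite lt_irr.
have [u [xuy Cxu uz]] := sbetween _ xz zy.
case/andP: (xuy) => xu uy.
have [/existsP[v /and4P[nvu xv vy Cxv]]|/existsPn uniq] :=
  boolP [exists v, [&& v != u, lt x v, lt v y & C (lab x) (lab v)]].
  by exists u, v; rewrite eq_sym nvu xv vy.
have uniqu v : lt x v -> lt v y -> v = u.
  move=> xv vy; have nb w : lt x w -> lt w y -> C (lab x) (lab w) -> w = u.
    move=> xw wy Cw; apply/eqP; apply: contraT => n.
    by have := uniq w; rewrite n xw wy Cw.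
  have [a [Ca xa av]] := lt_first_step xv.
  have [b [Cb yb vb]] := lt_last_step vy.
  have ea : a = u by apply: nb => //; apply: le_lt_trans vy.
  have eb : b = u by apply: nb => //; [apply: lt_le_trans vb|rewrite exy Csym].
  by apply: le_anti; rewrite -{1}eb vb -ea av.
have [] // := hP2 [:: x; u; y]; split=> //=; first by rewrite xu uy.
move=> a c b; rewrite !inE => Ha Hb ac cb; apply/orP; right; apply/orP; left; apply/eqP.
have xy_of d : d \in [:: x; u; y] -> le x d && le d y.
  rewrite !inE => /or3P[]/eqP->; rewrite ?le_refl ?(ltE xu) ?(ltE uy) ?(ltE xy) //.
have /andP[xa _] := xy_of a ltac:(by rewrite !inE).
have /andP[_ yb] := xy_of b ltac:(by rewrite !inE).
by apply: uniqu; [apply: le_lt_trans ac|apply: lt_le_trans yb].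
Qed.

End HeapOrder.

(** * Words with holes, their reversal and their relabelling *)

Section Words.

Variables (V : eqType) (C : rel V).

Definition adjw (w : nat -> option V) (i j : nat) : bool :=
  if (w i, w j) is (Some p, Some q) then C p q else false.

(* A word with holes, read as a linear extension of a heap in which no element
   has exactly one element above it or exactly one element below it. Position 0
   and the positions from n on are holes, so that i |-> n - i reverses it. *)
Record irreducible_word (n : nat) (w : nat -> option V) : Prop := {
  iw_gap : forall i j p, i < j -> w i = Some p -> w j = Some p ->
    exists k l, [/\ i < k, k < l, l < j, adjw w i k & adjw w i l];
  iw_top : forall i j, i < j -> adjw w i j ->
    exists k, (i < k /\ k <> j /\ adjw w i k) \/ (j < k /\ adjw w j k);
  iw_bot : forall i j, i < j -> adjw w i j ->
    exists k, (k < j /\ k <> i /\ adjw w k j) \/ (k < i /\ adjw w k i);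
  iw_start : w 0 = None;
  iw_end : forall i, n <= i -> w i = None
}.

Definition isolated_word (w : nat -> option V) : Prop :=
  forall i j, i < j -> adjw w i j -> False.

Lemma adjwC w : symmetric C -> symmetric (adjw w).
Proof. by move=> Cs i j; rewrite /adjw; case: (w i) (w j) => [p|] [q|]. Qed.

Definition rev_word n (w : nat -> option V) i := w (n - i).

Lemma adjw_rev n w i j : adjw (rev_word n w) i j = adjw w (n - i) (n - j).
Proof. by []. Qed.

Lemma adjw_bound n w i j : irreducible_word n w -> adjw w i j ->
  [/\ 0 < i, i < n, 0 < j & j < n].
Proof.
move=> iw; rewrite /adjw; case wi: (w i) => [p|] //; case wj: (w j) => [q|] // _.
split; rewrite ltnNge; apply/negP.
- by rewrite leqn0 => /eqP i0; rewrite i0 (iw_start iw) in wi.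
- by move/(iw_end iw); rewrite wi.
- by rewrite leqn0 => /eqP i0; rewrite i0 (iw_start iw) in wj.
- by move/(iw_end iw); rewrite wj.
Qed.

(** Reversal exchanges [iw_top] and [iw_bot], so each statement about the beginning of a word yields
    one about its end. *)
Lemma rev_irreducible n w : symmetric C ->
  irreducible_word n w -> irreducible_word n (rev_word n w).
Proof.
move=> Cs iw; have As := adjwC w Cs; split.
- move=> i j p ij wi wj.
  have jn : j < n.
    rewrite ltnNge; apply/negP => nj; move: wj; rewrite /rev_word.
    have -> : n - j = 0 by apply/eqP; rewrite subn_eq0.
    by rewrite (iw_start iw).
  have [|k [l [h1 h2 h3 h4 h5]]] := iw_gap iw (p := p) (i := n - j) (j := n - i) _ wj wi; first order_lia.
  have e : adjw w (n - i) =1 adjw w (n - j).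
    by move=> m; move: wi wj; rewrite /rev_word /adjw => -> ->.
  exists (n - l), (n - k); rewrite !adjw_rev !e.
  by rewrite !subKn; [split=> //; order_lia|order_lia|order_lia].
- move=> i j ij; rewrite adjw_rev => a; have [h1 h2 h3 h4] := adjw_bound iw a.
  have [||k] := iw_bot iw (i := n - j) (j := n - i); [order_lia|by rewrite As|].
  move=> hk; exists (n - k); rewrite !adjw_rev; case: hk => [[g1 [g2 g3]]|[g1 g2]].
    by left; rewrite As subKn; [split; [order_lia|split=> //; order_lia]|order_lia].
  by right; rewrite As subKn; [split=> //; order_lia|order_lia].
- move=> i j ij; rewrite adjw_rev => a; have [h1 h2 h3 h4] := adjw_bound iw a.
  have [||k] := iw_top iw (i := n - j) (j := n - i); [order_lia|by rewrite As|].
  move=> hk; exists (n - k); rewrite !adjw_rev; case: hk => [[g1 [g2 g3]]|[g1 g2]];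
    have [_ _ _ hk] := adjw_bound iw ltac:(eassumption).
    by left; rewrite As subKn; [split; [order_lia|split=> //; order_lia]|order_lia].
  by right; rewrite As subKn; [split=> //; order_lia|order_lia].
- by rewrite /rev_word subn0; apply: (iw_end iw).
- by move=> i ni; rewrite /rev_word (eqP (_ : n - i == 0)) ?subn_eq0 ?(iw_start iw).
Qed.

End Words.

(** Letters outside the domain of [f] become holes. By the first hypothesis no occurring neighbour
    of a kept letter is lost, so the witnesses survive. The second asks for faithfulness on
    occurring letters only, which is what allows a cycle to be cut open at an absent letter. *)
Lemma irreducible_word_map (V V' : eqType) (C : rel V) (C' : rel V')
    (f : V -> option V') n (w : nat -> option V) :
  (forall i j p q, w i = Some p -> w j = Some q -> C p q -> isSome (f p) = isSome (f q)) ->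
  (forall i j p q p' q', w i = Some p -> w j = Some q ->
     f p = Some p' -> f q = Some q' -> (C' p' q' = C p q) /\ (p' = q' -> p = q)) ->
  irreducible_word C n w -> irreducible_word C' n (fun i => obind f (w i)).
Proof.
move=> fdom fadj iw.
have A i j : adjw C' (fun i => obind f (w i)) i j -> adjw C w i j.
  rewrite /adjw; case wi: (w i) => [p|] //=; case wj: (w j) => [q|] //=; last by case: (f p).
  case fp: (f p) => [p'|] //; case fq: (f q) => [q'|] //.
  by have [-> _] := fadj _ _ _ _ _ _ wi wj fp fq.
have B i j : isSome (obind f (w i)) || isSome (obind f (w j)) ->
    adjw C w i j -> adjw C' (fun i => obind f (w i)) i j.
  rewrite /adjw; case wi: (w i) => [p|] //=; case wj: (w j) => [q|] //=.
  move=> h Cpq; have := fdom _ _ _ _ wi wj Cpq; move: h.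
  case fp: (f p) => [p'|] //; case fq: (f q) => [q'|] // _ _.
  by have [-> _] := fadj _ _ _ _ _ _ wi wj fp fq.
have D i j : adjw C' (fun i => obind f (w i)) i j ->
    isSome (obind f (w i)) && isSome (obind f (w j)).
  by rewrite /adjw; case: (obind f (w i)) => //; case: (obind f (w j)).
split.
- move=> i j p' ij; case wi: (w i) => [p|] //= fp; case wj: (w j) => [q|] //= fq.
  have [_ e] := fadj _ _ _ _ _ _ wi wj fp fq.
  have ep := e erefl; subst q.
  have [k [l [h1 h2 h3 h4 h5]]] := iw_gap iw ij wi wj; exists k, l.
  by split=> //; apply: B => //; rewrite wi /= fp.
- move=> i j ij a; have /andP[di dj] := D _ _ a.
  have [k [[h1 [h2 h3]]|[h1 h2]]] := iw_top iw ij (A _ _ a); exists k.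
    by left; split=> //; split=> //; apply: B; rewrite ?di.
  by right; split=> //; apply: B; rewrite ?dj.
- move=> i j ij a; have /andP[di dj] := D _ _ a.
  have [k [[h1 [h2 h3]]|[h1 h2]]] := iw_bot iw ij (A _ _ a); exists k.
    by left; split=> //; split=> //; apply: B; rewrite ?dj ?orbT.
  by right; split=> //; apply: B; rewrite ?di ?orbT.
- by rewrite (iw_start iw).
- by move=> i ni; rewrite (iw_end iw).
Qed.

(** * From heaps to words *)

Section Reducible.

Variables (P : finType) (C : rel P) (Crefl : reflexive C) (Csym : symmetric C).

Definition one_above (E : heap C) (a b : E) : bool :=
  lt b a && [forall z, lt b z ==> (z == a)].

Definition one_below (E : heap C) (a b : E) : bool :=
  lt a b && [forall z, lt z b ==> (z == a)].

Definition reducible (E : heap C) : bool :=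
  [exists a : E, exists b : E, one_above a b || one_below a b].

Section LinearExtension.

Variable E : heap C.

(** A linear extension: the number of elements below decides, [enum_rank] breaks ties, and the
    successor leaves position 0 free for [iw_start]. *)
Definition heap_time (x : E) : nat :=
  (#|[set y | lt y x]| * #|E| + enum_rank x).+1.

Lemma heap_time_lt x y : lt x y -> heap_time x < heap_time y.
Proof.
move=> xy; have : #|[set z | lt z x]| < #|[set z | lt z y]|.
  apply: proper_card; apply/properP; split.
    by apply/subsetP => z; rewrite !inE => zx; apply: lt_transH xy.
  by exists x; rewrite inE ?lt_irr.
rewrite /heap_time ltnS => /(leq_mul (leqnn #|E|)).
rewrite mulnS [#|E| * _]mulnC [#|E| * _]mulnC => h.
apply: leq_trans (leq_addr _ _); apply: leq_trans h.
by rewrite addnC ltn_add2r.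
Qed.

Lemma heap_time_inj : injective heap_time.
Proof.
move=> x y [] /(f_equal (modn^~ #|E|)).
rewrite !modnMDl !modn_small ?ltn_ord // => e.
by apply: enum_rank_inj; apply: val_inj.
Qed.

Definition heap_word (i : nat) : option P :=
  omap (@lab _ _ E) [pick x | heap_time x == i].

Lemma heap_wordE x : heap_word (heap_time x) = Some (lab x).
Proof.
rewrite /heap_word; case: pickP => [y /eqP/heap_time_inj -> //|/(_ x)].
by rewrite eqxx.
Qed.

Lemma heap_word_some i p : heap_word i = Some p ->
  exists2 x : E, heap_time x = i & lab x = p.
Proof.
by rewrite /heap_word; case: pickP => [y /eqP ty [<-]|//]; exists y.
Qed.

Lemma heap_word_adj i j : adjw C heap_word i j ->
  exists x y : E, [/\ heap_time x = i, heap_time y = j & C (lab x) (lab y)].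
Proof.
rewrite /adjw; case wi: (heap_word i) => [p|] //; case wj: (heap_word j) => [q|] // Cpq.
have [x ti lx] := heap_word_some wi; have [y tj ly] := heap_word_some wj.
by exists x, y; rewrite lx ly.
Qed.

Lemma heap_word_adjE x y :
  adjw C heap_word (heap_time x) (heap_time y) = C (lab x) (lab y).
Proof. by rewrite /adjw !heap_wordE. Qed.

Lemma heap_time_ltE x y :
  C (lab x) (lab y) -> (heap_time x < heap_time y) = lt x y.
Proof.
move=> Cxy; apply/idP/idP; last exact: heap_time_lt.
move=> txy; have nxy : x != y by apply: contraTneq txy => ->; rewrite ltnn.
case/orP: (comparable_lt Cxy nxy) => // /heap_time_lt.
by rewrite ltnNge (ltnW txy).
Qed.

Lemma heap_word_irreducible : P2 E -> ~~ reducible E ->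
  exists n, irreducible_word C n heap_word.
Proof.
move=> hP2 irr; have irra (a b : E) : ~~ one_above a b /\ ~~ one_below a b.
  apply/andP; rewrite -negb_or; apply: contra irr => h.
  by apply/existsP; exists a; apply/existsP; exists b.
exists (\max_(x : E) heap_time x).+1; split=> //.
- move=> i j p ij /heap_word_some[x tx lx] /heap_word_some[y ty ly]; subst i j.
  have lxy : lab x = lab y by rewrite lx.
  rewrite heap_time_ltE ?lxy ?Crefl // in ij.
  have [u [v [nuv /andP[xu uy] /andP[xv vy] Cu Cv]]] := P2_between Csym hP2 ij lxy.
  have : heap_time u != heap_time v by apply: contra nuv => /eqP/heap_time_inj/eqP.
  rewrite neq_ltn => /orP[] tuv; [exists (heap_time u), (heap_time v)|exists (heap_time v), (heap_time u)];
    by rewrite !heap_word_adjE tuv; split=> //; apply: heap_time_lt.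
- move=> i j ij /heap_word_adj[x [y [tx ty Cxy]]]; subst i j.
  rewrite heap_time_ltE // in ij.
  have [/negP na _] := irra y x.
  have [/existsP[z /andP[xz nzy]]|/existsPn h] := boolP [exists z, lt x z && (z != y)]; last first.
    case: na; rewrite /one_above ij; apply/forallP => z; apply/implyP => xz.
    by have := h z; rewrite xz negbK.
  (* The first step from [x] towards [z] is either a neighbour of [x] other than [y], or [y] itself,
     and in that case [z] lies above [y]. *)
  have [u [Cu xu uz]] := lt_first_step xz.
  have [euy|nuy] := eqVneq u y.
    subst u; have : lt y z by rewrite /lt eq_sym nzy.
    case/lt_first_step => v [Cv yv _]; exists (heap_time v); right.
    by rewrite heap_word_adjE; split=> //; apply: heap_time_lt.
  exists (heap_time u); left; split; first exact: heap_time_lt.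
  by split; [move/heap_time_inj/eqP; apply/negP|rewrite heap_word_adjE].
- move=> i j ij /heap_word_adj[x [y [tx ty Cxy]]]; subst i j.
  rewrite heap_time_ltE // in ij.
  have [_ /negP na] := irra x y.
  have [/existsP[z /andP[xz nzy]]|/existsPn h] := boolP [exists z, lt z y && (z != x)]; last first.
    case: na; rewrite /one_below ij; apply/forallP => z; apply/implyP => xz.
    by have := h z; rewrite xz negbK.
  have [u [Cu xu uz]] := lt_last_step xz.
  have [euy|nuy] := eqVneq u x.
    subst u; have : lt z x by rewrite /lt nzy.
    case/lt_last_step => v [Cv yv _]; exists (heap_time v); right.
    by rewrite heap_word_adjE; split=> //; apply: heap_time_lt.
  exists (heap_time u); left; split; first exact: heap_time_lt.
  by split; [move/heap_time_inj/eqP; apply/negP|rewrite heap_word_adjE].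
- by rewrite /heap_word; case: pickP.
- move=> i; rewrite /heap_word; case: pickP => // x /eqP <-.
  by rewrite ltnNge leq_bigmax.
Qed.

End LinearExtension.

Section Del.

Variables (E : heap C) (F : {set E}).
Hypothesis Fconvex : forall x y z : E, x \in F -> z \in F -> le x y -> le y z -> y \in F.

(** A chain of concurrent steps between two members of a convex set stays in the set, so no relation
    is lost by restricting before taking the closure. *)
Lemma sub_leE (x y : subheap Csym F) : le x y = le (val x) (val y).
Proof.
apply/idP/idP; first exact: sub_le_le.
rewrite [le (val x) _]le_closure => /connectP[s].
elim: s x => [|z s IHs] x /=; first by move=> _ /val_inj ->; apply: le_refl.
case/andP=> /andP[lxz Cxz] zs ylast.
have lzy : le z (val y) by rewrite le_closure; apply/connectP; exists s.
have zF : z \in F by apply: Fconvex lxz lzy; apply: valP.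
apply: le_trans (IHs (Sub z zF) zs ylast).
by apply: connect1; rewrite /sub_step lxz.
Qed.

Lemma sub_ltE (x y : subheap Csym F) : lt x y = lt (val x) (val y).
Proof. by rewrite /lt sub_leE. Qed.

Lemma sub_P2 : P2 E -> P2 (subheap Csym F).
Proof.
move=> hP2 s [ss sc] sb; have := hP2 (map val s); rewrite size_map; apply.
  split.
    by rewrite sorted_map; apply: sub_sorted ss => x y; rewrite sub_ltE.
  move=> x y z /mapP[x' x's ->] /mapP[z' z's ->] xy yz.
  have yF : y \in F by apply: (Fconvex (valP x') (valP z')); apply: ltE.
  rewrite -[y]/(val (Sub y yF : subheap Csym F)) mem_map; last exact: val_inj.
  by apply: (sc x' _ z'); rewrite ?sub_ltE.
by case: s sb {ss sc} => //= x s sb; rewrite last_map; apply: sb.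
Qed.

End Del.

Lemma maximal_convex (E : heap C) (a : E) : a \in maximals E ->
  forall x y z : E, x \in [set~ a] -> z \in [set~ a] -> le x y -> le y z -> y \in [set~ a].
Proof.
rewrite inE => /forallP am x y z _; rewrite !inE => nza _ yz.
by apply: contraNN (am z) => /eqP e; subst a; rewrite /lt yz eq_sym nza.
Qed.

Lemma minimal_convex (E : heap C) (a : E) : a \in minimals E ->
  forall x y z : E, x \in [set~ a] -> z \in [set~ a] -> le x y -> le y z -> y \in [set~ a].
Proof.
rewrite inE => /forallP am x y z; rewrite !inE => nxa _ xy _.
by apply: contraNN (am x) => /eqP e; subst a; rewrite /lt xy nxa.
Qed.

(** Only the last step of the sequence matters: [b] is extremal once [a] is removed and was not
    before, so [a] is all that lies on that side of [b]. *)
Lemma P1_reducible (E : heap C) : P1 Csym E -> trivial_heap E \/ reducible E.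
Proof.
case=> E1 tE1 /clos_rt_rtn1_iff; case=> [|F E' hp _]; first by left.
right; case: hp => [][a [_ am [b [bm nb _]]]];
  apply/existsP; exists a; apply/existsP; exists (val b).
  have ub z : lt (val b) z -> z == a.
    move=> bz; apply: contraT => nza; move: bm; rewrite inE => /forallP.
    have zF : z \in [set~ a] by rewrite !inE.
    by move/(_ (Sub z zF)); rewrite (sub_ltE (maximal_convex am)) /= bz.
  rewrite /one_above; apply/orP; left; apply/andP; split; last by apply/forallP => z; apply/implyP/ub.
  move: nb; rewrite inE negb_forall => /existsP[z]; rewrite negbK => bz.
  by have /eqP e := ub _ bz; rewrite e in bz.
have ub z : lt z (val b) -> z == a.
  move=> bz; apply: contraT => nza; move: bm; rewrite inE => /forallP.
  have zF : z \in [set~ a] by rewrite !inE.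
  by move/(_ (Sub z zF)); rewrite (sub_ltE (minimal_convex am)) /= bz.
apply/orP; right; apply/andP; split; last by apply/forallP => z; apply/implyP/ub.
move: nb; rewrite inE negb_forall => /existsP[z]; rewrite negbK => bz.
by have /eqP e := ub _ bz; rewrite e in bz.
Qed.

(** Anything above [a] would also be above [b], so [a] is maximal. Equal labels are impossible,
    since P2 would put further elements between [b] and [a]. *)
Lemma one_above_prec (E : heap C) (a b : E) : P2 E -> one_above a b ->
  a \in maximals E /\ prec_plus Csym (del Csym a) E.
Proof.
move=> hP2 /andP[ba /forallP ub].
have ub' z : lt b z -> z = a by move=> bz; apply/eqP; apply: (implyP (ub z)).
have am : a \in maximals E.
  rewrite inE; apply/forallP => y; apply/negP => ay.
  by have e := ub' _ (lt_transH ba ay); rewrite e lt_irr in ay.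
split=> //; exists a; split=> //.
have bF : b \in [set~ a] by rewrite !inE; case/andP: ba.
exists (Sub b bF); split.
- rewrite inE; apply/forallP => y; rewrite (sub_ltE (maximal_convex am)) /=.
  by apply/negP => /ub'/eqP; apply/negP; have := valP y; rewrite !inE; apply.
- by rewrite inE negb_forall; apply/existsP; exists a; rewrite negbK.
apply/eqP => e; have [u [v [_ /andP[bu ua] _ _ _]]] := P2_between Csym hP2 ba e.
by move: ua; rewrite (ub' _ bu) lt_irr.
Qed.

Lemma one_below_prec (E : heap C) (a b : E) : P2 E -> one_below a b ->
  a \in minimals E /\ prec_minus Csym (del Csym a) E.
Proof.
move=> hP2 /andP[ba /forallP ub].
have ub' z : lt z b -> z = a by move=> bz; apply/eqP; apply: (implyP (ub z)).
have am : a \in minimals E.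
  rewrite inE; apply/forallP => y; apply/negP => ay.
  by have e := ub' _ (lt_transH ay ba); rewrite e lt_irr in ay.
split=> //; exists a; split=> //.
have bF : b \in [set~ a] by rewrite !inE eq_sym; case/andP: ba.
exists (Sub b bF); split.
- rewrite inE; apply/forallP => y; rewrite (sub_ltE (minimal_convex am)) /=.
  by apply/negP => /ub'/eqP; apply/negP; have := valP y; rewrite !inE; apply.
- by rewrite inE negb_forall; apply/existsP; exists a; rewrite negbK.
apply/eqP => e; have [u [v [_ /andP[au ub2] _ _ _]]] := P2_between Csym hP2 ba (esym e).
by move: au; rewrite (ub' _ ub2) lt_irr.
Qed.

(** Induction on the number of elements: a reducible heap is one step above a smaller heap with P2,
    and the word of an irreducible one shows that it is trivial. *)
Lemma regular_of_words :
  (forall n w, irreducible_word C n w -> isolated_word C w) -> regular Csym.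
Proof.
move=> hw E; have [m] := ubnP #|E|; elim: m E => // m IHm E Em hP2.
have [red|irr] := boolP (reducible E); last first.
  exists E; last exact: rt_refl.
  have [n iw] := heap_word_irreducible hP2 irr.
  move=> x y; rewrite le_eqVltH => /orP[/eqP //|].
  case/lt_first_step=> u [Cu xu _].
  have := hw _ _ iw _ _ (heap_time_lt xu).
  by rewrite heap_word_adjE Cu => /(_ isT).
suff [a [ham hprec]] : exists a : E, (a \in maximals E \/ a \in minimals E) /\
    prec Csym (del Csym a) E.
  have [||E1 tE1 h1] := IHm (del Csym a).
  - rewrite /= card_sig -ltnS; apply: leq_trans Em.
    rewrite ltnS; apply: proper_card; apply/properP; split; first by apply/subsetP.
    by exists a; rewrite // !inE eqxx.
  - apply: sub_P2 => //; case: ham; [exact: maximal_convex|exact: minimal_convex].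
  by exists E1 => //; apply: rt_trans h1 (rt_step _ _ _ _ hprec).
case/existsP: red => a /existsP[b /orP[/(one_above_prec hP2)|/(one_below_prec hP2)] [am pa]];
  by exists a; split; [left + right|left + right].
Qed.

End Reducible.

(** * Heaps from pieces placed at given times *)

Section TimedPieces.

Variables (P : finType) (C : rel P) (Crefl : reflexive C) (Csym : symmetric C).
Variables (T : finType) (l : T -> P) (t : T -> nat).
Hypothesis t_inj : forall x y, C (l x) (l y) -> t x = t y -> x = y.

(** Pieces with labels that are not concurrent may share a time, so a heap can be given by layers
    instead of a linear order. *)
Definition timed_step : rel T := fun x y => (t x <= t y) && C (l x) (l y).
Definition timed_le : rel T := connect timed_step.

Lemma timed_le_lt x y : timed_le x y -> x = y \/ t x < t y.
Proof.
case/connectP=> s; elim: s x => [|z s IHs] x /=; first by move=> _ ->; left.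
case/andP=> /andP[txz Cxz] zs ylast.
have [exz|nxz] := eqVneq x z; first by subst z; apply: IHs.
have txz' : t x < t z.
  by rewrite ltn_neqAle txz andbT; apply: contra nxz => /eqP/(t_inj Cxz)->.
by right; case: (IHs z zs ylast) => [<- //|]; apply: ltn_trans.
Qed.

Lemma timed_le_refl : reflexive timed_le.
Proof. exact: connect0. Qed.

Lemma timed_le_anti : antisymmetric timed_le.
Proof.
move=> x y /andP[/timed_le_lt[//|xy] /timed_le_lt[//|yx]].
by move: (ltn_trans xy yx); rewrite ltnn.
Qed.

Lemma timed_le_trans : transitive timed_le.
Proof. by move=> y x z; apply: connect_trans. Qed.

Lemma timed_le_comparable x y : C (l x) (l y) -> timed_le x y || timed_le y x.
Proof.
move=> Cxy; case/orP: (leq_total (t x) (t y)) => h; apply/orP; [left|right];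
  by apply: connect1; rewrite /timed_step h // Csym.
Qed.

Lemma timed_le_closure x y :
  timed_le x y = connect (fun x y => timed_le x y && C (l x) (l y)) x y.
Proof.
apply/idP/idP; apply: connect_sub => u v.
  move=> uv; apply: connect1; case/andP: (uv) => _ ->.
  by rewrite andbT; apply: connect1.
by case/andP.
Qed.

Definition timed_heap : heap C :=
  Heap timed_le_refl timed_le_anti timed_le_trans timed_le_comparable timed_le_closure.

Lemma timed_ltW (x y : timed_heap) : lt x y -> t x < t y.
Proof. by case/andP=> /eqP nxy /timed_le_lt[]. Qed.

Lemma timed_lt (x y : timed_heap) : t x < t y -> C (l x) (l y) -> lt x y.
Proof.
move=> txy Cxy; rewrite /lt; apply/andP; split.
  by apply: contraTneq txy => ->; rewrite ltnn.
by apply: connect1; rewrite /timed_step (ltnW txy).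
Qed.

Hypothesis t_gap : forall x y, l x = l y -> t x < t y ->
  exists u v, [/\ u <> v, t x < t u < t y, t x < t v < t y, C (l x) (l u) & C (l x) (l v)].
Hypothesis t_top : forall x y, t x < t y -> C (l x) (l y) ->
  exists z, (z <> y /\ t x < t z /\ C (l x) (l z)) \/ (t y < t z /\ C (l y) (l z)).
Hypothesis t_bot : forall x y, t x < t y -> C (l x) (l y) ->
  exists z, (z <> x /\ t z < t y /\ C (l z) (l y)) \/ (t z < t x /\ C (l z) (l x)).
Hypothesis t_nontrivial : exists x y, t x < t y /\ C (l x) (l y).

(** Between the ends of a balanced chain with more than one element, [t_gap] finds two pieces
    comparable to both ends. Convexity draws them into the chain, which then has at least four
    elements. *)
Lemma timed_heap_P2 : P2 timed_heap.
Proof.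
move=> [|x s] [ss sc] //= sb.
have sb' : l x = l (last x s) := sb.
have last_mem : last x s \in x :: s by rewrite mem_last.
have between u v : lt x v -> t u < t v -> t x < t u -> C (l x) (l u) -> C (l u) (l v) ->
    v \in x :: s -> u \in x :: s.
  move=> xv uv xu Cxu Cuv vs; apply: (sc x u v); rewrite ?mem_head //; exact: timed_lt.
have key : t x < t (last x s) -> 2 < size s.
  move=> txl; have [u [v [nuv /andP[xu uy] /andP[xv vy] Cu Cv]]] := t_gap sb txl.
  have Cxl : C (l x) (l (last x s)) by rewrite -sb'.
  have lxl : lt (x : timed_heap) (last x s) by apply: timed_lt.
  have us : u \in x :: s by apply: (between u (last x s)) => //; rewrite -sb' Csym.
  have vs : v \in x :: s by apply: (between v (last x s)) => //; rewrite -sb' Csym.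
  have : size [:: x; u; v; last x s] <= size (x :: s); last by [].
  apply: uniq_leq_size; last by move=> z; rewrite !inE => /or4P[]/eqP-> //; rewrite -?in_cons ?mem_head.
  rewrite /= !inE !negb_or !andbT; apply/and3P; split.
  - by apply/and3P; split; apply/eqP => e; move: xu xv txl; rewrite -?e ltnn.
  - by apply/andP; split; apply/eqP => // e; move: uy; rewrite e ltnn.
  - by apply/eqP => e; move: vy; rewrite e ltnn.
have tl y s' : s = y :: s' -> t x < t (last x s).
  move=> es; apply: (@timed_ltW x); rewrite es /=; move: ss; rewrite es /= => ss.
  have pss : path (@lt _ _ timed_heap) x (y :: s') := ss.
  have /allP := order_path_min (@lt_transH _ _ timed_heap) pss; apply; exact: mem_last.
case: s ss sc {sb'} sb last_mem between key tl => [|y s] //= _ _ _ _ _ key tl.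
by have := key (tl y s erefl); case: s {key tl} => [|? []].
Qed.

Lemma timed_heap_irreducible : ~~ reducible timed_heap.
Proof.
apply/existsPn => a; apply/existsPn => b; rewrite negb_or; apply/andP; split.
  apply/negP => /andP[ba /forallP ub].
  have ub' z : lt b z -> z = a by move=> bz; apply/eqP; apply: (implyP (ub z)).
  have [u [Cu bu _]] := lt_first_step ba.
  have e := ub' _ bu; subst u.
  have [z [[nza [bz Cz]]|[az Cz]]] := t_top (timed_ltW ba) Cu.
    by apply: nza; apply: ub'; apply: timed_lt.
  have lz := timed_lt az Cz; have e := ub' _ (lt_transH ba lz).
  by rewrite e lt_irr in lz.
apply/negP => /andP[ba /forallP ub].
have ub' z : lt z b -> z = a by move=> bz; apply/eqP; apply: (implyP (ub z)).
have [u [Cu bu _]] := lt_last_step ba.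
have e := ub' _ bu; subst u.
have [z [[nza [bz Cz]]|[az Cz]]] := t_bot (timed_ltW ba) Cu.
  by apply: nza; apply: ub'; apply: timed_lt.
have lz := timed_lt az Cz; have e := ub' _ (lt_transH lz ba).
by rewrite e lt_irr in lz.
Qed.

Lemma timed_not_regular : ~ regular Csym.
Proof.
move=> reg; have /P1_reducible[tr|] := reg _ timed_heap_P2; last by apply/negP/timed_heap_irreducible.
have [x [y [xy Cxy]]] := t_nontrivial.
have lxy := timed_lt xy Cxy.
by have e := tr _ _ (ltE lxy); rewrite e lt_irr in lxy.
Qed.

End TimedPieces.

(** * Words on spiders *)

(* [None] is the centre; [Some (i, k)] is the vertex at distance k + 1 from the
   centre on arm i. *)
Definition spider_adj : rel (option (nat * nat)) := fun x y =>
  match x, y with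
  | None, None => false
  | None, Some (_, k) | Some (_, k), None => k == 0
  | Some (i, k), Some (j, l) => (i == j) && path_adj k l
  end.

Definition spider_rel : rel (option (nat * nat)) :=
  fun x y => (x == y) || spider_adj x y.

(** Level 0 is the centre whatever [i] is, so the lemmas on an arm at [k = 0] speak of the centre,
    and [at_node w i 0] is the same for all arms. *)
Definition spider_node (i k : nat) : option (nat * nat) :=
  if k is k'.+1 then Some (i, k') else None.

(** The bound [K] on the levels carries the inductions that start at the leaves. *)
Definition spider_word (K n : nat) (w : nat -> option (option (nat * nat))) : Prop :=
  irreducible_word spider_rel n w /\
  forall t i k, w t = Some (Some (i, k)) -> i < 3 /\ k < K.

Definition at_node (w : nat -> option (option (nat * nat))) i k t : bool :=
  w t == Some (spider_node i k).

Lemma spider_rel_sym : symmetric spider_rel.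
Proof.
move=> x y; rewrite /spider_rel eq_sym; congr orb.
case: x y => [[i k]|] [[j l]|] //=.
by rewrite eq_sym /path_adj orbC.
Qed.

Lemma rev_spider_word K n w : spider_word K n w -> spider_word K n (rev_word n w).
Proof.
case=> iw wK; split; first exact: rev_irreducible spider_rel_sym iw.
by move=> t i k; apply: wK.
Qed.

Lemma at_node_rev n w i k t : at_node (rev_word n w) i k t = at_node w i k (n - t).
Proof. by []. Qed.

Lemma ex_first (Q : pred nat) t : Q t ->
  exists x, [/\ Q x, x <= t & forall u, u < x -> ~~ Q u].
Proof.
move=> Qt; have ex : exists u, Q u by exists t.
case: (ex_minnP ex) => x Qx xmin; exists x; split=> //; first exact: xmin.
by move=> u ux; apply: contraTN ux => /xmin; rewrite -leqNgt.
Qed.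

Lemma ex_last_before (Q : pred nat) y t : Q y -> y < t ->
  exists x, [/\ Q x, x < t & forall u, x < u -> u < t -> ~~ Q u].
Proof.
move=> Qy yt; have ex : exists u, Q u && (u < t) by exists y; rewrite Qy.
have bd u : Q u && (u < t) -> u <= t by case/andP=> _ /ltnW.
case: (ex_maxnP ex bd) => x /andP[Qx xt] xmax; exists x; split=> // u xu ut.
by apply: contraTN xu => Qu; rewrite -leqNgt xmax // Qu.
Qed.

Lemma ex_first_after (Q : pred nat) y t : Q y -> t < y ->
  exists x, [/\ Q x, t < x & forall u, t < u -> u < x -> ~~ Q u].
Proof.
move=> Qy yt; have [|x [/andP[Qx tx] _ xmin]] := @ex_first (fun u => Q u && (t < u)) y.
  by rewrite Qy.
by exists x; split=> // u tu ux; have := xmin u ux; rewrite tu andbT.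
Qed.

(** * Occurrences along an arm and around the centre *)

Section Arms.

Variables (K n : nat) (w : nat -> option (option (nat * nat))).
Hypothesis sw : spider_word K n w.

Let iw : irreducible_word spider_rel n w := proj1 sw.
Let L := at_node w.
Let adj := adjw spider_rel w.

Lemma adj_sym : symmetric adj.
Proof. by apply: adjwC; apply: spider_rel_sym. Qed.

Lemma at_node_pos i k t : L i k t -> 0 < t /\ t < n.
Proof.
move=> /eqP wt; split; rewrite ltnNge; apply/negP.
  by rewrite leqn0 => /eqP t0; rewrite t0 (iw_start iw) in wt.
by move/(iw_end iw); rewrite wt.
Qed.

Lemma adj_arm i k t u : L i k.+1 t ->
  adj t u = [|| L i k u, L i k.+1 u | L i k.+2 u].
Proof.
rewrite /adj /adjw /L /at_node => /eqP -> /=; case: (w u) => [[[j l]|]|]; last by case: k.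
  rewrite /spider_rel /= /path_adj; case: k => [|k] /=;
  rewrite /eq_op /= /eq_op /= /eq_op /= /eq_op /=;
  have [->|nij] := eqVneq i j; rewrite ?eqxx /= ?[j == i]eq_sym ?(negbTE nij) //=; order_lia.
by case: k.
Qed.

Lemma adj_centre i0 t u : L i0 0 t ->
  adj t u = L i0 0 u || [exists i : 'I_3, L i 1 u].
Proof.
rewrite /adj /adjw /L /at_node => /eqP -> /=; case wu: (w u) => [[[j l]|]|] //=.
- have [j3 _] := (proj2 sw) _ _ _ wu.
  rewrite /spider_rel /=; apply/idP/existsP.
    by move/eqP->; exists (Ordinal j3).
  by case=> i /eqP[_ ->].
- by symmetry; apply/existsP => -[].
Qed.

Lemma at_node_uniq i k j l t : L i k t -> L j l t -> k = l.
Proof. by rewrite /L /at_node => /eqP -> /eqP[]; case: k l => [|k] [|l] // [_ ->]. Qed.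

(** Induction from the leaf inwards, then on the right end of the gap. If both neighbours inside the
    gap are of level k + 2, the case already treated puts a letter of level k + 1 between them, and
    the gap gets shorter. *)
Lemma arm_between i k s t : s < t -> L i k.+1 s -> L i k.+1 t ->
  exists u, [/\ s < u, u < t & L i k u].
Proof.
have [m] := ubnP (K - k); elim: m k s t => // m IHm k s t Km.
have [d] := ubnP t; elim: d t => // d IHd t td st Ls Lt.
have Kk : k < K by have [] := (proj2 sw) _ _ _ (eqP Ls).
have [u [v [su uv vt]]] := iw_gap iw st (eqP Ls) (eqP Lt).
rewrite -!/(adj _ _) !(adj_arm _ Ls).
have rec x : s < x -> x < t -> L i k.+1 x -> exists u, [/\ s < u, u < t & L i k u].
  move=> sx xt Lx; have [||y [sy yx Ly]] := IHd x _ _ Ls Lx; [order_lia|order_lia|].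
  by exists y; split=> //; order_lia.
move=> /or3P[Lu|Lu|Lu]; first by exists u; split=> //; order_lia.
  by move=> _; apply: rec Lu; order_lia.
move=> /or3P[Lv|Lv|Lv]; first by exists v; split=> //; order_lia.
  by apply: rec Lv; order_lia.
have [||x [ux xv Lx]] := IHm k.+1 u v _ _ Lu Lv; [order_lia|order_lia|].
by apply: rec Lx; order_lia.
Qed.

Lemma arm_two_or i k s t : s < t -> L i k.+1 s -> L i k.+1 t ->
  (exists u v, [/\ s < u, u < v, v < t, L i k u & L i k v]) \/
  (exists u, [/\ s < u, u < t & L i k.+2 u]).
Proof.
move=> st Ls Lt; have [u [v [su uv vt]]] := iw_gap iw st (eqP Ls) (eqP Lt).
have twice x : s < x -> x < t -> L i k.+1 x ->
    exists u v, [/\ s < u, u < v, v < t, L i k u & L i k v].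
  move=> sx xt Lx; have [y [sy yx Ly]] := arm_between sx Ls Lx.
  by have [z [xz zt Lz]] := arm_between xt Lx Lt; exists y, z; split=> //; order_lia.
rewrite -!/(adj _ _) !(adj_arm _ Ls).
move=> /or3P[Lu|Lu|Lu].
- move=> /or3P[Lv|Lv|Lv]; first by left; exists u, v.
    by left; apply: twice Lv; order_lia.
  by right; exists v; split=> //; order_lia.
- by move=> _; left; apply: twice Lu; order_lia.
- by move=> _; right; exists u; split=> //; order_lia.
Qed.

(** Induction from the leaf inwards. A neighbour [u] before [t] must be of level k + 2, the only one
    of that level before [t], and by induction has itself no neighbour before it; this is what
    [iw_bot] excludes. *)
Lemma arm_minimal i k t : L i k.+1 t -> (forall u, u < t -> ~~ L i k u) ->
  forall u, u < t -> ~~ adj u t.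
Proof.
have [m] := ubnP (K - k); elim: m k t => // m IHm k t Km Lt nL u ut.
have Kk : k < K by have [] := (proj2 sw) _ _ _ (eqP Lt).
have nL1 v : v < t -> ~~ L i k.+1 v.
  move=> vt; apply/negP => Lv; have [x [vx xt]] := arm_between vt Lv Lt.
  by apply/negP/nL.
have nL2 v v' : v < v' -> v' < t -> L i k.+2 v -> ~~ L i k.+2 v'.
  move=> vv' vt Lv; apply/negP => Lv'; have [x [vx xt]] := arm_between vv' Lv Lv'.
  by apply/negP/nL1; order_lia.
apply/negP => a; have := a; rewrite adj_sym (adj_arm _ Lt) (negbTE (nL _ ut)) (negbTE (nL1 _ ut)) /= => Lu.
have umin : forall v, v < u -> ~~ adj v u.
  by apply: IHm Lu _; [order_lia|move=> v vu; apply: nL1; order_lia].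
have [h [[ht [hu]]|[hu]]] := iw_bot iw ut a; last by apply/negP/umin.
rewrite -/(adj _ _) adj_sym (adj_arm _ Lt) (negbTE (nL _ ht)) (negbTE (nL1 _ ht)) /= => Lh.
have [uh|hu'] := ltnP u h; first by have := nL2 _ _ uh ht Lu; rewrite Lh.
by have := nL2 h u; rewrite Lu Lh => /(_ _ ut isT); apply/implyP; order_lia.
Qed.

Definition arm_gaps i k := forall s t, s < t -> L i k s -> L i k t ->
  exists u, [/\ s < u, u < t & L i k.+1 u].

(* The two ways in which an arm of an irreducible word can begin: at outer
   starts, level k + 1 comes first; at inner ones, level k. *)
Definition outer_start i k := forall t, L i k t -> exists u, u < t /\ L i k.+1 u.
Definition inner_start i k :=
  (forall t, L i k.+1 t -> exists u, u < t /\ L i k u) /\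
  (forall t, L i k t -> (forall u, u < t -> ~~ L i k u) -> forall u, u < t -> ~~ adj u t).

(** If a gap of level k + 1 contains two letters of level k, these enclose one of level k + 1, which
    leaves a shorter gap. *)
Lemma arm_gapsS i k : arm_gaps i k -> arm_gaps i k.+1.
Proof.
move=> g s t; have [d] := ubnP t; elim: d t => // d IHd t td st Ls Lt.
case: (arm_two_or st Ls Lt) => // -[u [v [su uv vt Lu Lv]]].
have [x [ux xv Lx]] := g _ _ uv Lu Lv.
have [||y [sy yx Ly]] := IHd x _ _ Ls Lx; [order_lia|order_lia|].
by exists y; split=> //; order_lia.
Qed.

(** The first letter of level k + 1 precedes all of level k, so [arm_minimal] applies to it; in
    particular no letter of level k + 2 comes earlier. *)
Lemma outer_startS i k x0 : L i k.+1 x0 -> outer_start i k -> inner_start i k.+1.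
Proof.
move=> Lx0 bo.
have nomin t : L i k.+1 t -> (forall u, u < t -> ~~ L i k.+1 u) ->
    forall u, u < t -> ~~ adj u t.
  move=> Lt tmin; apply: arm_minimal Lt _ => u ut; apply/negP => /bo[v [vu Lv]].
  by have := tmin v; rewrite Lv => /(_ (ltn_trans vu ut)).
split=> // t Lt; have [x [Lx _ xmin]] := ex_first Lx0.
have [xt|] := ltnP x t; first by exists x.
rewrite leq_eqVlt => /orP[/eqP e|tx].
  by subst t; have := at_node_uniq Lt Lx; order_lia.
have := nomin x Lx xmin t tx.
by rewrite adj_sym (adj_arm _ Lx) Lt !orbT.
Qed.

(** Exactly one letter of level k precedes the first letter [t] of level k + 1, since two would
    enclose one of level k + 1. Nothing adjacent precedes that letter, so [iw_bot] asks for another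
    neighbour of [t], and only level k + 2 is left. *)
Lemma inner_startS i k : arm_gaps i k -> inner_start i k -> outer_start i k.+1.
Proof.
move=> g [b1 b2] t0 /ex_first[t [Lt tt0 tmin]].
have [z [zt Lz]] := b1 _ Lt.
have uz y y' : y < y' -> y' < t -> L i k y -> ~~ L i k y'.
  move=> yy' yt Ly; apply/negP => Ly'; have [x [yx xy' Lx]] := g _ _ yy' Ly Ly'.
  by have := tmin x; rewrite Lx => /(_ ltac:(order_lia)).
have azt : adj z t by rewrite adj_sym (adj_arm _ Lt) Lz.
have [h [[ht [hz]]|[hz]]] := iw_bot iw zt azt; last first.
  move=> ahz; exfalso; move: ahz; apply/negP; apply: b2 hz => // y yz; apply/negP => Ly.
  by have := uz _ _ yz zt Ly; rewrite Lz.
rewrite -/(adj _ _) adj_sym (adj_arm _ Lt) => /or3P[Lh|Lh|Lh].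
- have [hz'|zh] := ltnP h z; first by have := uz _ _ hz' zt Lh; rewrite Lz.
  by have := uz z h; rewrite Lz Lh => /(_ ltac:(order_lia) ht isT).
- by have := tmin _ ht; rewrite Lh.
- by exists h; split=> //; order_lia.
Qed.

(** The two neighbours in the gap lie on different arms, because two letters of level 1 on one arm
    enclose a centre. *)
Lemma centre_gap s t : s < t -> L 0 0 s -> L 0 0 t ->
  (forall u, s < u -> u < t -> ~~ L 0 0 u) ->
  exists i j u v, [/\ i < 3, j < 3 & i <> j] /\
    [/\ s < u, u < t & L i 1 u] /\ [/\ s < v, v < t & L j 1 v].
Proof.
move=> st Ls Lt nc; have [u [v [su uv vt]]] := iw_gap iw st (eqP Ls) (eqP Lt).
rewrite -!/(adj _ _) !(adj_centre _ Ls) (negbTE (nc u su (ltn_trans uv vt))).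
rewrite (negbTE (nc v (ltn_trans su uv) vt)) /= => /existsP[i Lu] /existsP[j Lv].
exists i, j, u, v; split; last by split; split=> //; order_lia.
split=> // eij; rewrite eij in Lu.
have [x [ux xv Lx]] := arm_between uv Lu Lv.
by have := nc x; rewrite [L 0 0 x]Lx => /(_ ltac:(order_lia) ltac:(order_lia)).
Qed.

(** A neighbour before the first centre has no neighbour before itself, so [iw_bot] demands a second
    one; on the same arm, the two would enclose an earlier centre. *)
Lemma centre_start x u0 : L 0 0 x -> (forall u, u < x -> ~~ L 0 0 u) ->
  u0 < x -> adj u0 x ->
  exists i j u v, [/\ i < 3, j < 3 & i <> j] /\
    [/\ u < x & L i 1 u] /\ [/\ v < x & L j 1 v].
Proof.
move=> Lx xmin ux a; have := a; rewrite adj_sym (adj_centre _ Lx) (negbTE (xmin _ ux)) /=.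
case/existsP=> i Lu.
have umin : forall v, v < u0 -> ~~ adj v u0.
  by apply: arm_minimal Lu _ => v vu; apply: xmin; order_lia.
have [h [[hx [hu]]|[hu]]] := iw_bot iw ux a; last by have /negP := umin _ hu.
rewrite -/(adj _ _) adj_sym (adj_centre _ Lx) (negbTE (xmin _ hx)) /= => /existsP[j Lh].
exists i, j, u0, h; split=> //; split=> // eij; rewrite -eij in Lh.
wlog uh : u0 h ux hx hu Lu Lh {a umin} / u0 < h.
  move=> W; have [|] := ltnP u0 h; first exact: W.
  by move=> h1; apply: (W h u0) => //; order_lia.
have [y [uy yh Ly]] := arm_between uh Lu Lh.
by have := xmin y; rewrite [L 0 0 y]Ly => /(_ ltac:(order_lia)).
Qed.

Section ShortArm.

Variable i : nat.

Lemma arm_two_centres a b : (forall t, ~~ L i 2 t) -> a < b -> L i 1 a -> L i 1 b ->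
  exists u v, [/\ a < u, u < v, v < b, L 0 0 u & L 0 0 v].
Proof.
move=> len ab La Lb; case: (arm_two_or ab La Lb) => // -[u [_ _]].
by rewrite (negbTE (len u)).
Qed.

(** As nothing adjacent precedes [x], the letter [b] needs a second neighbour before it. It is no
    centre, and a letter of level 1 would be separated from [b] by [x], hence precede [x]. *)
Lemma second_level_below x b : L 0 0 x -> (forall u, u < x -> ~~ adj u x) ->
  x < b -> L i 1 b -> (forall y, y < b -> L 0 0 y -> y = x) ->
  exists u, u < b /\ L i 2 u.
Proof.
move=> Lx xmin xb Lb cx.
have a : adj x b by rewrite adj_sym (adj_arm _ Lb) [L i 0 x]Lx.
have [h [[hb [hx]]|[hx]]] := iw_bot iw xb a; last by have /negP := xmin _ hx.
rewrite -/(adj _ _) adj_sym (adj_arm _ Lb) => /or3P[Lh|Lh|Lh].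
- by have := cx _ hb Lh.
- have [y [hy yb Ly]] := arm_between hb Lh Lb.
  have e := cx _ yb Ly; subst y; have := xmin _ hy.
  by rewrite (adj_arm _ Lh) [L i 0 x]Lx.
- by exists h.
Qed.

Hypothesis len2 : forall t, ~~ L i 3 t.

Lemma arm_two_firsts a b : a < b -> L i 2 a -> L i 2 b ->
  exists u v, [/\ a < u, u < v, v < b, L i 1 u & L i 1 v].
Proof.
move=> ab La Lb; case: (arm_two_or ab La Lb) => // -[u [_ _]].
by rewrite (negbTE (len2 u)).
Qed.

(** With a single centre, the gap from [b0] to [b] must contain a letter of level 2. Since [b0] has
    no neighbour before it, that letter needs a second neighbour before itself; every choice puts
    two letters of level 1, and hence two centres, before [b]. *)
Lemma short_arm_start x b0 b : L 0 0 x -> b0 < x -> x < b -> L i 1 b0 -> L i 1 b ->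
  (forall y, y < b -> L 0 0 y -> y = x) -> False.
Proof.
move=> Lx b0x xb Lb0 Lb cx.
have one u v : u < v -> v < b -> L i 1 u -> L i 1 v -> False.
  move=> uv vb Lu Lv; have [y [uy yv Ly]] := arm_between uv Lu Lv.
  have [z [vz zb Lz]] := arm_between vb Lv Lb.
  have := cx y ltac:(order_lia) Ly; have := cx z zb Lz; order_lia.
case: (arm_two_or (ltn_trans b0x xb) Lb0 Lb) => [[u [v [bu uv vb Lu Lv]]]|[u [bu ub Lu]]].
  have := cx u ltac:(order_lia) Lu; have := cx v vb Lv; order_lia.
have bmin : forall v, v < b0 -> ~~ adj v b0.
  apply: arm_minimal Lb0 _ => v vb; apply/negP => Lv; have := cx v ltac:(order_lia) Lv; order_lia.
have a : adj b0 u by rewrite (adj_arm _ Lb0) Lu !orbT.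
have [h [[hu [hb]]|[hb]]] := iw_bot iw bu a; last by apply/negP/bmin.
rewrite -/(adj _ _) adj_sym (adj_arm _ Lu) => /or3P[Lh|Lh|Lh].
- have [hb'|bh] := ltnP h b0; first by apply: (one h b0) => //; order_lia.
  by apply: (one b0 h) => //; order_lia.
- have [v [v' [hv vv' vu Lv Lv']]] := arm_two_firsts hu Lh Lu.
  by apply: (one v v') => //; order_lia.
- by have := len2 h; rewrite Lh.
Qed.

(** There is a letter of level 2 before [b] by [second_level_below], and another between [b] and
    [b'] because only one centre is there. They enclose two letters of level 1, and together with
    [b'] these yield two centres after [x], hence after [b]. *)
Lemma short_arm_after_centre x x' b b' : L 0 0 x -> (forall u, u < x -> ~~ adj u x) ->
  x < b -> b < b' -> L i 1 b -> L i 1 b' ->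
  (forall y, y < b -> L 0 0 y -> y = x) ->
  (forall y, b < y -> y < b' -> L 0 0 y -> y = x') -> False.
Proof.
move=> Lx xmin xb bb' Lb Lb' cx cx'.
have [u [ub Lu]] := second_level_below Lx xmin xb Lb cx.
case: (arm_two_or bb' Lb Lb') => [[y [z [by' yz zb Ly Lz]]]|[u' [bu' ub' Lu']]].
  have := cx' y ltac:(order_lia) ltac:(order_lia) Ly; have := cx' z ltac:(order_lia) ltac:(order_lia) Lz; order_lia.
have [v [v' [uv vv' vu' Lv Lv']]] := arm_two_firsts (ltn_trans ub bu') Lu Lu'.
have xv : x < v.
  rewrite ltn_neqAle; apply/andP; split.
    by apply/eqP => e; subst v; have := at_node_uniq Lv Lx.
  rewrite leqNgt; apply/negP => /xmin; rewrite (adj_arm _ Lv).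
  by rewrite [L i 0 x]Lx.
have [y [vy yv Ly]] := arm_between vv' Lv Lv'.
have [z [vz zb Lz]] := arm_between (ltn_trans vu' ub') Lv' Lb'.
have bt c : L 0 0 c -> x < c -> b < c.
  move=> Lc xc; rewrite ltnNge leq_eqVlt; apply/negP => /orP[/eqP e|cb].
    by subst c; have := at_node_uniq Lb Lc.
  have := cx _ cb Lc; order_lia.
have := cx' y (bt _ Ly ltac:(order_lia)) ltac:(order_lia) Ly.
have := cx' z (bt _ Lz ltac:(order_lia)) ltac:(order_lia) Lz; order_lia.
Qed.

(** Each of the two gaps has at most one centre, hence a letter of level 2. These two enclose two
    letters of level 1, which force a second centre into one of the gaps, depending on the side of
    [b'] on which they lie. *)
Lemma short_arm_run b b' b'' x x' : b < b' -> b' < b'' -> L i 1 b -> L i 1 b' -> L i 1 b'' ->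
  (forall y, b < y -> y < b' -> L 0 0 y -> y = x) ->
  (forall y, b' < y -> y < b'' -> L 0 0 y -> y = x') -> False.
Proof.
move=> bb' bb'' Lb Lb' Lb'' cx cx'.
case: (arm_two_or bb' Lb Lb') => [[y [z [by' yz zb Ly Lz]]]|[u [bu ub Lu]]].
  have := cx y ltac:(order_lia) ltac:(order_lia) Ly; have := cx z ltac:(order_lia) ltac:(order_lia) Lz; order_lia.
case: (arm_two_or bb'' Lb' Lb'') => [[y [z [by' yz zb Ly Lz]]]|[u' [bu' ub' Lu']]].
  have := cx' y ltac:(order_lia) ltac:(order_lia) Ly; have := cx' z ltac:(order_lia) ltac:(order_lia) Lz; order_lia.
have [v [v' [uv vv' vu' Lv Lv']]] := arm_two_firsts (ltn_trans ub bu') Lu Lu'.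
have [vb|bv] := ltnP v b'.
  have [y [vy yv Ly]] := arm_between (ltn_trans bu uv) Lb Lv.
  have [z [vz zb Lz]] := arm_between vb Lv Lb'.
  have := cx y ltac:(order_lia) ltac:(order_lia) Ly; have := cx z ltac:(order_lia) ltac:(order_lia) Lz; order_lia.
have [y [vy yv Ly]] := arm_between (leq_ltn_trans bv vv') Lb' Lv'.
have [z [vz zb Lz]] := arm_between (ltn_trans vu' ub') Lv' Lb''.
have := cx' y ltac:(order_lia) ltac:(order_lia) Ly; have := cx' z ltac:(order_lia) ltac:(order_lia) Lz; order_lia.
Qed.

End ShortArm.

End Arms.

Local Notation adjs := (adjw spider_rel).

Section Spiders.

Variable K : nat.
Implicit Types (n : nat) (w : nat -> option (option (nat * nat))).

Lemma rev_arm_gaps n w i k : spider_word K n w ->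
  arm_gaps w i k -> arm_gaps (rev_word n w) i k.
Proof.
move=> sw g s t st Ls Lt; have [s0 sn] := at_node_pos (rev_spider_word sw) Ls.
have [t0 tn] := at_node_pos (rev_spider_word sw) Lt.
have [|u [h1 h2 Lu]] := g (n - t) (n - s) _ Lt Ls; first order_lia.
exists (n - u); rewrite at_node_rev subKn; last order_lia.
by split=> //; order_lia.
Qed.

Lemma rev_ex n w i k t : spider_word K n w ->
  at_node w i k t -> at_node (rev_word n w) i k (n - t).
Proof.
by move=> sw Lt; have [t0 tn] := at_node_pos sw Lt; rewrite at_node_rev subKn // ltnW.
Qed.

(** Level k + 2 must occur, and so on outwards beyond [K]. If one end is of inner type,
    [inner_startS] supplies it. If both are of outer type, letters of level k + 1 lie on both sides
    of one of level k, and the gap between them meets level k + 2. *)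
Lemma alternating_arm n w i k : spider_word K n w -> arm_gaps w i k ->
  outer_start w i k \/ inner_start w i k ->
  outer_start (rev_word n w) i k \/ inner_start (rev_word n w) i k ->
  (exists t, at_node w i k t) -> (exists t, at_node w i k.+1 t) -> False.
Proof.
move=> sw; have sr := rev_spider_word sw.
have [m] := ubnP (K - k); elim: m k => // m IHm k Km g b1 b2 [t Lt] [u Lu].
have Kk : k < K by have [] := (proj2 sw) _ _ _ (eqP Lu).
have g' := arm_gapsS sw g; have gr := rev_arm_gaps sw g.
have Lur := rev_ex sw Lu.
have e2 : exists t, at_node w i k.+2 t.
  case: b1 => [b1|/(inner_startS sw g)/(_ u Lu)[v [_ Lv]]]; last by exists v.
  case: b2 => [b2|/(inner_startS sr gr)/(_ _ Lur)[v [_ Lv]]]; last by exists (n - v).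
  have [v [vt Lv]] := b1 _ Lt; have [v' [vt' Lv']] := b2 _ (rev_ex sw Lt).
  have [t0 tn] := at_node_pos sw Lt; have [v0 vn] := at_node_pos sw Lv.
  have [|x [_ _ Lx]] := g' v (n - v') _ Lv Lv'; first order_lia.
  by exists x.
apply: (IHm k.+1) => //; first order_lia.
- by case: b1 => b; [right; apply: outer_startS b|left; apply: inner_startS b] => //; eassumption.
- by case: b2 => b; [right; apply: outer_startS b|left; apply: inner_startS b] => //; eassumption.
- by exists u.
Qed.

Definition node_isolated w i k :=
  forall t u, at_node w i k t -> t <> u -> ~~ adjs w t u.

Lemma arm_maximal n w i k t : spider_word K n w -> at_node w i k.+1 t ->
  (forall u, t < u -> ~~ at_node w i k u) -> forall u, t < u -> ~~ adjs w t u.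
Proof.
move=> sw Lt tmax u tu; apply/negP => a.
have [h1 h2 h3 h4] := adjw_bound (proj1 sw) a.
have := arm_minimal (rev_spider_word sw) (rev_ex sw Lt) _ (u := n - u).
rewrite adjw_rev !subKn; [|order_lia|order_lia].
rewrite adjwC ?a; last exact: spider_rel_sym.
move=> H; suff : ~~ true by []; apply: H; last order_lia.
by move=> v vt; rewrite at_node_rev; apply: tmax; order_lia.
Qed.

(** If level k + 1 occurs, then level k does not, as it would be adjacent; so [arm_minimal] and
    [arm_maximal] apply. *)
Lemma node_isolatedS n w i k : spider_word K n w ->
  node_isolated w i k -> node_isolated w i k.+1.
Proof.
move=> sw iso t u Lt tu; have As := adjwC w spider_rel_sym.
have nL v : ~~ at_node w i k v.
  apply/negP => Lv; have := iso v t Lv; rewrite As (adj_arm _ Lt) Lv.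
  move=> H; suff : ~~ true by []; apply: H => e; subst v.
  by have := at_node_uniq Lt Lv; order_lia.
have [h|h] := ltnP u t; first by rewrite As; apply: (arm_minimal sw Lt) => // v _.
by apply: (arm_maximal sw Lt) => [v _|]; [apply: nL|order_lia].
Qed.

Lemma centre_isolated n w : spider_word K n w -> node_isolated w 0 0 ->
  isolated_word spider_rel w.
Proof.
move=> sw iso s t st a.
have all i k : node_isolated w i k by elim: k => [//|k /(node_isolatedS sw)].
have [i [k Ls]] : exists i k, at_node w i k s.
  rewrite /at_node; move: a; rewrite /adjw; case: (w s) => [[[i k]|]|] // _.
    by exists i, k.+1.
  by exists 0, 0.
by have := all i k s t Ls; rewrite a => /(_ ltac:(order_lia)).
Qed.

Lemma short_arm_around n w i x b0 b : spider_word K n w -> (forall t, ~~ at_node w i 3 t) ->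
  at_node w 0 0 x -> (forall y, y < b -> at_node w 0 0 y -> y = x) ->
  b0 < x -> x < b -> at_node w i 1 b0 -> ~~ at_node w i 1 b.
Proof.
move=> sw len Lx cx b0x xb Lb0; apply/negP => Lb.
exact: (short_arm_start sw len Lx b0x xb Lb0 Lb cx).
Qed.

Lemma centre_stop n w x u0 : spider_word K n w -> at_node w 0 0 x ->
  (forall u, x < u -> ~~ at_node w 0 0 u) -> x < u0 -> adjs w x u0 ->
  exists i j u v, [/\ i < 3, j < 3 & i <> j] /\
    [/\ x < u & at_node w i 1 u] /\ [/\ x < v & at_node w j 1 v].
Proof.
move=> sw Lx xmax xu a; have [h1 h2 h3 h4] := adjw_bound (proj1 sw) a.
have [|||i [j [u [v [h [[ux Lu] [vx Lv]]]]]]] :=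
    centre_start (rev_spider_word sw) (rev_ex sw Lx) _ (u0 := n - u0).
- by move=> v vx; rewrite at_node_rev; apply: xmax; order_lia.
- order_lia.
- by rewrite adjw_rev !subKn; [rewrite adjwC //; exact: spider_rel_sym|order_lia|order_lia].
exists i, j, (n - u), (n - v); split=> //.
have [u1 un] := at_node_pos (rev_spider_word sw) Lu.
have [v1 vn] := at_node_pos (rev_spider_word sw) Lv.
by split; split=> //; order_lia.
Qed.

(** * Spiders with two arms of length at most 1 and 2 *)

Section OneTwoArms.

Definition one_two_arms w := forall t i k, w t = Some (Some (i, k)) ->
  (i = 0 -> k < 1) /\ (i = 1 -> k < 2).

Lemma one_two_len w : one_two_arms w ->
  [/\ forall t, ~~ at_node w 0 2 t, forall t, ~~ at_node w 0 3 t & forall t, ~~ at_node w 1 3 t].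
Proof.
move=> h; split=> t; apply/negP => /eqP/h[] //.
- by move=> /(_ erefl).
- by move=> /(_ erefl).
- by move=> _ /(_ erefl).
Qed.

(** Arm 0 cannot meet two consecutive gaps, so the preceding gap meets arm 1. There is a preceding
    gap: if [s] were the first centre, then either arm 0 or arm 1 would precede it, against
    [short_arm_start], or nothing adjacent would, and [second_level_below] would need level 2 on arm
    0. *)
Lemma first_arm_not_third_before n w s t a b : spider_word K n w -> one_two_arms w ->
  at_node w 0 0 s -> (forall u, s < u -> u < t -> ~~ at_node w 0 0 u) ->
  s < a -> a < t -> at_node w 0 1 a -> s < b -> b < t -> at_node w 1 1 b ->
  exists b', [/\ b' < s, at_node w 1 1 b' &
    forall y, b' < y -> y < b -> at_node w 0 0 y -> y = s].
Proof.
move=> sw /one_two_len[l02 l03 l13] Ls nc sa at_ La sb bt Lb.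
have [/existsP[/= y0 Ly0]|/existsPn nos] := boolP [exists y : 'I_s, at_node w 0 0 y].
  have [s' [Ls' s's nc']] := ex_last_before Ly0 (ltn_ord y0).
  have na u : s' < u -> u < s -> ~~ at_node w 0 1 u.
    move=> su us; apply/negP => Lu.
    have [x [x' [ux xx' xa Lx Lx']]] := arm_two_centres sw l02 (ltn_trans us sa) Lu La.
    have c y : at_node w 0 0 y -> u < y -> y < a -> y = s.
      move=> Ly uy ya; apply/eqP; rewrite eqn_leq; apply/andP; split; rewrite leqNgt; apply/negP => h.
        by have := nc y h; rewrite Ly => /(_ ltac:(order_lia)).
      by have := nc' y; rewrite Ly h => /(_ ltac:(order_lia) isT).
    by have := c x Lx; have := c x' Lx'; order_lia.
  have [i [j [u [v [[i3 j3 ij] [[su us Lu] [sv vs Lv]]]]]]] := centre_gap sw s's Ls' Ls nc'.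
  suff [b' [s'b' b's Lb']] : exists b', [/\ s' < b', b' < s & at_node w 1 1 b'].
    exists b'; split=> // y by' yb Ly; apply/eqP; rewrite eqn_leq; apply/andP; split;
      rewrite leqNgt; apply/negP => h.
      by have := nc y h; rewrite Ly => /(_ ltac:(order_lia)).
    by have := nc' y; rewrite Ly h => /(_ ltac:(order_lia) isT).
  have ni : i <> 0 by move=> e; subst i; have := na u su us; rewrite Lu.
  have nj : j <> 0 by move=> e; subst j; have := na v sv vs; rewrite Lv.
  have [e|e] : i = 1 \/ j = 1 by order_lia.
    by subst i; exists u.
  by subst j; exists v.
have smin u : u < s -> ~~ at_node w 0 0 u by move=> us; have := nos (Ordinal us).
have cx y x : x < t -> y < x -> at_node w 0 0 y -> y = s.
  move=> xt yx Ly; apply/eqP; rewrite eqn_leq; apply/andP; split; rewrite leqNgt; apply/negP => h.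
    by have := nc y h; rewrite Ly => /(_ ltac:(order_lia)).
  by have := smin _ h; rewrite Ly.
have [/existsP[/= u0 au0]|/existsPn nos'] := boolP [exists y : 'I_s, adjs w y s].
  have [i [j [u [v [[i3 j3 ij] [[us Lu] [vs Lv]]]]]]] := centre_start sw Ls smin (ltn_ord u0) au0.
  have n01 k x : k < 2 -> x < s -> ~~ at_node w k 1 x.
    case: k => [|[|//]] _ xs; apply/negP => Lx.
      exact: (short_arm_start sw l03 Ls xs sa Lx La (fun y => cx y a at_)).
    exact: (short_arm_start sw l13 Ls xs sb Lx Lb (fun y => cx y b bt)).
  have [h|h] : i < 2 \/ j < 2 by order_lia.
    by have := n01 i u h us; rewrite Lu.
  by have := n01 j v h vs; rewrite Lv.
have := second_level_below sw Ls _ sa La (fun y => cx y a at_).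
case; first by move=> u us; have := nos' (Ordinal us).
by move=> u [_ Lu]; have := l02 u; rewrite Lu.
Qed.

(** A gap that meets only arms 0 and 1 has neighbouring gaps that both meet arm 1, the later one by
    reversal, and [short_arm_run] excludes three such gaps in a row. *)
Lemma third_arm_gaps n w : spider_word K n w -> one_two_arms w -> arm_gaps w 2 0.
Proof.
move=> sw ot s t0 st0 Ls Lt0; have sr := rev_spider_word sw.
have [t [Lt st nc]] := ex_first_after (Q := at_node w 0 0) Lt0 st0.
have tt0 : t <= t0.
  rewrite leqNgt; apply/negP => h; have := nc t0 st0 h.
  by rewrite [at_node w 0 0 t0]Lt0.
suff [u [su ut Lu]] : exists u, [/\ s < u, u < t & at_node w 2 1 u] by exists u; split=> //; order_lia.
have [i [j [u [v [[i3 j3 ij] [[su ut Lu] [sv vt Lv]]]]]]] := centre_gap sw st Ls Lt nc.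
have [e|ni] := eqVneq i 2; first by subst i; exists u.
have [e|nj] := eqVneq j 2; first by subst j; exists v.
have [a [b [[sa at_ La] [sb bt Lb]]]] : exists a b,
    [/\ s < a, a < t & at_node w 0 1 a] /\ [/\ s < b, b < t & at_node w 1 1 b].
  have [[e1 e2]|[e1 e2]] : i = 0 /\ j = 1 \/ i = 1 /\ j = 0 by order_lia.
    by subst i j; exists u, v.
  by subst i j; exists v, u.
have [_ _ l13] := one_two_len ot.
have [b' [b's Lb' c1]] := first_arm_not_third_before sw ot Ls nc sa at_ La sb bt Lb.
have [t1 tn] := at_node_pos sw Lt.
have [|||||b'' [b's' Lb'' c2]] := @first_arm_not_third_before n (rev_word n w) (n - t) (n - s) (n - a) (n - b)
    sr (fun t => ot (n - t)) (rev_ex sw Lt) _ _ _ (rev_ex sw La) _ _ (rev_ex sw Lb); try order_lia.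
  by move=> x h1 h2; rewrite at_node_rev; apply: nc; order_lia.
have [b1 bn] := at_node_pos sr Lb''.
exfalso; apply: (short_arm_run sw l13 (b := b') (b' := b) (b'' := n - b'') (x := s) (x' := t)) => //; try order_lia.
move=> y yb yb'' Ly; have := c2 (n - y); rewrite at_node_rev subKn; last order_lia.
by move=> /(_ ltac:(order_lia) ltac:(order_lia) Ly); order_lia.
Qed.

(** If nothing adjacent precedes the first centre, the start is inner; if arm 2 does, it is outer.
    Otherwise arms 0 and 1 both precede it, so neither can follow before the next centre, whereas
    two arms would have to. So this centre is the only one and nothing adjacent follows it, and a
    letter of arm 0 before it has only this centre above. *)
Lemma third_arm_start n w x0 : spider_word K n w -> one_two_arms w -> at_node w 0 0 x0 ->
  outer_start w 2 0 \/ inner_start w 2 0.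
Proof.
move=> sw ot Lx0; have [l02 l03 l13] := one_two_len ot.
have [x [Lx _ xmin]] := ex_first Lx0.
have l3 k : k < 2 -> forall t, ~~ at_node w k 3 t by case: k => [|[|]].
have [/existsP[/= u0 au0]|/existsPn nos] := boolP [exists y : 'I_x, adjs w y x]; last first.
  right; split.
    move=> t Lt; exists x; split=> //; have [//|] := ltnP x t.
    rewrite leq_eqVlt => /orP[/eqP e|tx]; first by subst t; have := at_node_uniq Lt Lx.
    by have := nos (Ordinal tx); rewrite /= (adj_arm _ Lt) [at_node w 2 0 x]Lx.
  move=> t Lt tmin; have -> : t = x.
    apply/eqP; rewrite eqn_leq; apply/andP; split; rewrite leqNgt; apply/negP.
      by move=> /tmin; rewrite [at_node w 2 0 x]Lx.
    by move=> /xmin; rewrite [at_node w 0 0 t]Lt.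
  by move=> u ux; have := nos (Ordinal ux).
left; have [i [j [u [v [[i3 j3 ij] [[us Lu] [vs Lv]]]]]]] := centre_start sw Lx xmin (ltn_ord u0) au0.
suff [d [dx Ld]] : exists d, d < x /\ at_node w 2 1 d.
  move=> t Lt; exists d; split=> //; apply: leq_trans dx _.
  by rewrite leqNgt; apply/negP => /xmin; rewrite [at_node w 0 0 t]Lt.
have [e|ni] := eqVneq i 2; first by subst i; exists u.
have [e|nj] := eqVneq j 2; first by subst j; exists v.
exfalso; have below k : k < 2 -> exists b, b < x /\ at_node w k 1 b.
  move=> k2; have [e|e] : k = i \/ k = j by order_lia.
    by subst k; exists u.
  by subst k; exists v.
have above k b : k < 2 -> x < b -> (forall y, x < y -> y < b -> ~~ at_node w 0 0 y) ->
    ~~ at_node w k 1 b.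
  move=> k2 xb nc; have [b0 [b0x Lb0]] := below k k2.
  apply: (short_arm_around sw (l3 k k2) Lx _ b0x xb Lb0) => y yb Ly.
  apply/eqP; rewrite eqn_leq; apply/andP; split; rewrite leqNgt; apply/negP => h.
    by have := nc _ h yb; rewrite Ly.
  by have := xmin _ h; rewrite Ly.
have absurd i' j' a b : i' < 3 -> j' < 3 -> i' <> j' -> x < a -> x < b ->
    (forall y, x < y -> y < a -> ~~ at_node w 0 0 y) ->
    (forall y, x < y -> y < b -> ~~ at_node w 0 0 y) ->
    at_node w i' 1 a -> at_node w j' 1 b -> False.
  move=> h1 h2 h3 xa xb na nb La Lb.
  have [h|h] : i' < 2 \/ j' < 2 by order_lia.
    by have := above i' a h xa na; rewrite La.
  by have := above j' b h xb nb; rewrite Lb.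
have [/existsP[/= y]|/existsPn nomore] := boolP [exists y : 'I_n, (x < y) && at_node w 0 0 y].
  case/andP=> xy Ly; have [x' [Lx' xx' nc]] := ex_first_after Ly xy.
  have [i' [j' [a [b [[h1 h2 h3] [[sa at_ La] [sb bt Lb]]]]]]] := centre_gap sw xx' Lx Lx' nc.
  apply: (absurd _ _ _ _ h1 h2 h3 sa sb) La Lb => z xz za; apply: nc => //; order_lia.
have xmax y : x < y -> ~~ at_node w 0 0 y.
  move=> xy; apply/negP => Ly; have [_ yn] := at_node_pos sw Ly.
  by have := nomore (Ordinal yn); rewrite /= xy Ly.
have [/existsP[/= u1 /andP[xu1 au1]]|/existsPn top] :=
    boolP [exists y : 'I_n, (x < y) && adjs w x y].
  have [i' [j' [a [b [[h1 h2 h3] [[sa La] [sb Lb]]]]]]] := centre_stop sw Lx xmax xu1 au1.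
  by apply: (absurd _ _ _ _ h1 h2 h3 sa sb) La Lb => z xz za; apply: xmax.
have xtop y : x < y -> ~~ adjs w x y.
  move=> xy; apply/negP => a; have [_ _ _ yn] := adjw_bound (proj1 sw) a.
  by have := top (Ordinal yn); rewrite /= xy a.
have [a [ax La]] := below 0 isT.
have aax : adjs w a x by rewrite (adj_arm _ La) [at_node w 0 0 x]Lx.
have [k [[ak [kx]]|[xk]]] := iw_top (proj1 sw) ax aax; last by apply/negP/xtop.
rewrite (adj_arm _ La) => /or3P[Lk|Lk|Lk].
- have [xk|kx'] := ltnP x k; first by have := xmax _ xk; rewrite Lk.
  by have := xmin k; rewrite [at_node w 0 0 k]Lk => /(_ ltac:(order_lia)).
- have [y1 [y2 [ay1 yy yk Ly1 Ly2]]] := arm_two_centres sw l02 ak La Lk.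
  have [xy|yx] := ltnP x y2; first by have := xmax _ xy; rewrite Ly2.
  by have := xmin y1; rewrite Ly1 => /(_ ltac:(order_lia)).
- by have := l02 k; rewrite Lk.
Qed.

Theorem one_two_spider_isolated n w : spider_word K n w -> one_two_arms w ->
  isolated_word spider_rel w.
Proof.
move=> sw ot s t st ast; have sr := rev_spider_word sw.
have otr : one_two_arms (rev_word n w) := fun t => ot (n - t).
(* The goal is [False], so the centre may be assumed not to be isolated; this provides a centre [x]
   with a neighbour [y]. *)
suff niso : ~ ~ node_isolated w 0 0 by apply: niso => /(centre_isolated sw)/(_ s t st ast).
move=> niso; apply: (niso) => x y Lx xy; apply/negP => axy.
have g := third_arm_gaps sw ot.
have b1 := third_arm_start sw ot Lx.
have b2 := third_arm_start sr otr (rev_ex sw Lx).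
apply: (alternating_arm sw g b1 b2); first by exists x.
have [/existsP[/= z /andP[nzx Lz]]|/existsPn only] :=
    boolP [exists z : 'I_n, (z != x :> nat) && at_node w 0 0 z].
  move: nzx; rewrite neq_ltn => /orP[] h; [have [u [_ _ Lu]] := g _ _ h Lz Lx|
    have [u [_ _ Lu]] := g _ _ h Lx Lz]; by exists u.
have onl z : at_node w 0 0 z -> z = x.
  move=> Lz; have [_ zn] := at_node_pos sw Lz; apply/eqP/contraT => h.
  by have := only (Ordinal zn); rewrite /= h Lz.
case: b1 => [b1|[_ b1]]; first by have [u [_ Lu]] := b1 _ Lx; exists u.
case: b2 => [b2|[_ b2]]; first by have [u [_ Lu]] := b2 _ (rev_ex sw Lx); exists (n - u).
exfalso; have [yx|xy'] := ltnP y x.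
  have := b1 x Lx _ y yx; rewrite adjwC ?axy; last exact: spider_rel_sym.
  suff H : forall u, u < x -> ~~ at_node w 2 0 u by move/(_ H).
  by move=> u ux; apply/negP => /onl; order_lia.
have [h1 h2 h3 h4] := adjw_bound (proj1 sw) axy.
have := b2 _ (rev_ex sw Lx) _ (n - y) ltac:(order_lia).
rewrite adjw_rev !subKn ?(ltnW h2) ?(ltnW h4) // adjwC ?axy; last exact: spider_rel_sym.
suff H : forall u, u < n - x -> ~~ at_node (rev_word n w) 2 0 u by move/(_ H).
by move=> u ux; apply/negP => /onl; order_lia.
Qed.

End OneTwoArms.

End Spiders.

(** * Spiders with all arms of length at most 2 *)

Section TwoArms.

Variable K : nat.
Implicit Types (n : nat) (w : nat -> option (option (nat * nat))).

Definition two_arms w := forall t i k, w t = Some (Some (i, k)) -> k < 2.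

Lemma pigeonhole3 (Q R : nat -> Prop) i j i' j' : i < 3 -> j < 3 -> i <> j ->
  i' < 3 -> j' < 3 -> i' <> j' -> Q i -> Q j -> R i' -> R j' -> exists k, Q k /\ R k.
Proof.
move=> h1 h2 h3 h4 h5 h6 Qi Qj Ri Rj.
have [e|[e|[e|e]]] : i = i' \/ i = j' \/ j = i' \/ j = j' by order_lia.
- by subst; exists i'.
- by subst; exists j'.
- by subst; exists i'.
- by subst; exists j'.
Qed.

(** Otherwise two of the three arms precede the first centre. If two also follow it before the next
    centre, one arm does both, against [short_arm_start]. If nothing adjacent follows, the letter
    [u] before the centre needs a letter of level 2 after it, which in turn lacks a second neighbour
    before it. *)
Lemma two_arms_centre_minimal n w x : spider_word K n w -> two_arms w ->
  at_node w 0 0 x -> (forall u, u < x -> ~~ at_node w 0 0 u) ->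
  forall u, u < x -> ~~ adjs w u x.
Proof.
move=> sw ta Lx xmin u0 u0x; apply/negP => au0.
have l3 i t : ~~ at_node w i 3 t by apply/negP => /eqP/ta.
have [i [j [u [v [[i3 j3 ij] [[ux Lu] [vx Lv]]]]]]] := centre_start sw Lx xmin u0x au0.
have Qi : exists b, b < x /\ at_node w i 1 b by exists u.
have Qj : exists b, b < x /\ at_node w j 1 b by exists v.
have absurd k b0 b : b0 < x -> at_node w k 1 b0 -> x < b -> at_node w k 1 b ->
    (forall y, x < y -> y < b -> ~~ at_node w 0 0 y) -> False.
  move=> b0x Lb0 xb Lb nc; have := short_arm_around sw (l3 k) Lx _ b0x xb Lb0.
  rewrite Lb; suff H : forall y, y < b -> at_node w 0 0 y -> y = x by move/(_ H).
  move=> y yb Ly; apply/eqP; rewrite eqn_leq; apply/andP; split; rewrite leqNgt; apply/negP => h.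
    by have := nc _ h yb; rewrite Ly.
  by have := xmin _ h; rewrite Ly.
have [/existsP[/= y]|/existsPn nomore] := boolP [exists y : 'I_n, (x < y) && at_node w 0 0 y].
  case/andP=> xy Ly; have [x' [Lx' xx' nc]] := ex_first_after Ly xy.
  have [i' [j' [a [b [[h1 h2 h3] [Ra Rb]]]]]] := centre_gap sw xx' Lx Lx' nc.
  have Ri : exists b, [/\ x < b, b < x' & at_node w i' 1 b] by exists a.
  have Rj : exists b, [/\ x < b, b < x' & at_node w j' 1 b] by exists b.
  have [k [[b0 [b0x Lb0]] [b1 [xb bx Lb]]]] := pigeonhole3
    (Q := fun k => exists b, b < x /\ at_node w k 1 b)
    (R := fun k => exists b, [/\ x < b, b < x' & at_node w k 1 b]) i3 j3 ij h1 h2 h3 Qi Qj Ri Rj.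
  by apply: (absurd k b0 b1) => // z xz zb; apply: nc => //; order_lia.
have xmax y : x < y -> ~~ at_node w 0 0 y.
  move=> xy; apply/negP => Ly; have [_ yn] := at_node_pos sw Ly.
  by have := nomore (Ordinal yn); rewrite /= xy Ly.
have [/existsP[/= u1 /andP[xu1 au1]]|/existsPn top] :=
    boolP [exists y : 'I_n, (x < y) && adjs w x y].
  have [i' [j' [a [b [[h1 h2 h3] [Ra Rb]]]]]] := centre_stop sw Lx xmax xu1 au1.
  have Ri : exists b, x < b /\ at_node w i' 1 b by exists a; case: Ra.
  have Rj : exists b, x < b /\ at_node w j' 1 b by exists b; case: Rb.
  have [k [[b0 [b0x Lb0]] [b1 [xb Lb]]]] := pigeonhole3
    (Q := fun k => exists b, b < x /\ at_node w k 1 b)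
    (R := fun k => exists b, x < b /\ at_node w k 1 b) i3 j3 ij h1 h2 h3 Qi Qj Ri Rj.
  by apply: (absurd k b0 b1) => // z xz zb; apply: xmax.
have xtop y : x < y -> ~~ adjs w x y.
  move=> xy; apply/negP => a; have [_ _ _ yn] := adjw_bound (proj1 sw) a.
  by have := top (Ordinal yn); rewrite /= xy a.
have onlyx y : at_node w 0 0 y -> y = x.
  move=> Ly; apply/eqP; rewrite eqn_leq; apply/andP; split; rewrite leqNgt; apply/negP => h.
    by have := xmax _ h; rewrite Ly.
  by have := xmin _ h; rewrite Ly.
have only1 a b : a < b -> at_node w i 1 a -> at_node w i 1 b -> False.
  move=> ab La Lb; have [y [ay yb Ly]] := arm_between sw ab La Lb.
  have e := onlyx _ Ly; subst y; have := xtop _ yb.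
  by rewrite adjwC ?(adj_arm _ Lb) ?[at_node w i 0 x]Lx //; apply: spider_rel_sym.
have aux : adjs w u x by rewrite (adj_arm _ Lu) [at_node w i 0 x]Lx.
have [k [[uk [kx]]|[xk]]] := iw_top (proj1 sw) ux aux; last by apply/negP/xtop.
rewrite (adj_arm _ Lu) => /or3P[Lk|Lk|Lk].
- by have := onlyx k Lk.
- exact: only1 uk Lu Lk.
have umin : forall v, v < u -> ~~ adjs w v u.
  by apply: (arm_minimal sw Lu) => z zu; apply: xmin; order_lia.
have auk : adjs w u k by rewrite (adj_arm _ Lu) Lk !orbT.
have [h [[hk [hu]]|[hu]]] := iw_bot (proj1 sw) uk auk; last by apply/negP/umin.
rewrite adjwC ?(adj_arm _ Lk); last exact: spider_rel_sym.
move=> /or3P[Lh|Lh|Lh].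
- by have [hu'|uh] := ltnP h u; [apply: (only1 h u)|apply: (only1 u h) => //; order_lia].
- have [a [b [_ ab _ La Lb]]] := arm_two_firsts sw (l3 i) hk Lh Lk.
  exact: only1 ab La Lb.
- by have := l3 i h; rewrite Lh.
Qed.

(** With three centres, the first two gaps share an arm, against [short_arm_after_centre]. With two,
    the letter of an arm in the gap lies between two letters of level 2, which enclose two letters
    of level 1 and so a centre; one of those letters then precedes the first centre or follows the
    last one. *)
Theorem two_arms_isolated n w : spider_word K n w -> two_arms w ->
  isolated_word spider_rel w.
Proof.
move=> sw ta; have sr := rev_spider_word sw; have As := adjwC w spider_rel_sym.
have tar : two_arms (rev_word n w) := fun t => ta (n - t).
have l3 i t : ~~ at_node w i 3 t by apply/negP => /eqP/ta.
have cmin := two_arms_centre_minimal sw ta.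
have cmax x : at_node w 0 0 x -> (forall u, x < u -> ~~ at_node w 0 0 u) ->
    forall u, x < u -> ~~ adjs w x u.
  move=> Lx xmax u xu; apply/negP => a; have [h1 h2 h3 h4] := adjw_bound (proj1 sw) a.
  have := two_arms_centre_minimal sr tar (rev_ex sw Lx) _ (u := n - u).
  rewrite adjw_rev !subKn; [|order_lia|order_lia]; rewrite As a => H.
  suff : ~~ true by []; apply: H; last order_lia.
  by move=> v vx; rewrite at_node_rev; apply: xmax; order_lia.
apply: (centre_isolated sw) => x0 y0 Lx0 xy0; apply/negP => a0.
have [x [Lx xx0 xmin]] := ex_first Lx0.
have xm := cmin _ Lx xmin.
have [/existsP[/= y /andP[xy Ly]]|/existsPn nomore] :=
    boolP [exists y : 'I_n, (x < y) && at_node w 0 0 y]; last first.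
  have xmax y : x < y -> ~~ at_node w 0 0 y.
    move=> xy; apply/negP => Ly; have [_ yn] := at_node_pos sw Ly.
    by have := nomore (Ordinal yn); rewrite /= xy Ly.
  have e : x0 = x.
    by apply/eqP; rewrite eqn_leq xx0 andbT leqNgt; apply: contraTN Lx0; apply: xmax.
  subst x0; have [h|h] := ltnP x y0; first by have := cmax _ Lx xmax _ h; rewrite a0.
  by have := xm y0; rewrite As a0 => /(_ ltac:(order_lia)).
have [x' [Lx' xx' nc]] := ex_first_after Ly xy.
have [i [j [u [v [[i3 j3 ij] [Qu Qv]]]]]] := centre_gap sw xx' Lx Lx' nc.
have cx b y1 : b < x' -> y1 < b -> at_node w 0 0 y1 -> y1 = x.
  move=> bx yb Ly1; apply/eqP; rewrite eqn_leq; apply/andP; split; rewrite leqNgt; apply/negP => h.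
    by have := nc _ h; rewrite Ly1 => /(_ ltac:(order_lia)).
  by have := xmin _ h; rewrite Ly1.
have [/existsP[/= y2 /andP[xy2 Ly2]]|/existsPn nomore] :=
    boolP [exists y : 'I_n, (x' < y) && at_node w 0 0 y].
  have [x'' [Lx'' xx'' nc']] := ex_first_after Ly2 xy2.
  have [i' [j' [a [b [[h1 h2 h3] [Ra Rb]]]]]] := centre_gap sw xx'' Lx' Lx'' nc'.
  have Qi : exists b, [/\ x < b, b < x' & at_node w i 1 b] by exists u.
  have Qj : exists b, [/\ x < b, b < x' & at_node w j 1 b] by exists v.
  have Ri : exists b, [/\ x' < b, b < x'' & at_node w i' 1 b] by exists a.
  have Rj : exists b, [/\ x' < b, b < x'' & at_node w j' 1 b] by exists b.
  have [k [[b0 [xb0 bx0 Lb0]] [b1 [xb bx Lb]]]] := pigeonhole3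
    (Q := fun k => exists b, [/\ x < b, b < x' & at_node w k 1 b])
    (R := fun k => exists b, [/\ x' < b, b < x'' & at_node w k 1 b]) i3 j3 ij h1 h2 h3 Qi Qj Ri Rj.
  apply: (short_arm_after_centre sw (l3 k) Lx xm xb0 (x' := x') (b' := b1)) => //; first order_lia.
    by move=> z zb; apply: cx bx0 zb.
  move=> z bz zb Lz; apply/eqP; rewrite eqn_leq; apply/andP; split; rewrite leqNgt; apply/negP => h.
    by have := nc' _ h; rewrite Lz => /(_ ltac:(order_lia)).
  by have := nc z; rewrite Lz => /(_ ltac:(order_lia) h).
have xmax y1 : x' < y1 -> ~~ at_node w 0 0 y1.
  move=> xy1; apply/negP => Ly1; have [_ yn] := at_node_pos sw Ly1.
  by have := nomore (Ordinal yn); rewrite /= xy1 Ly1.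
have xM := cmax _ Lx' xmax.
case: Qu => xu ux Lu.
have [b [bu Lb]] := second_level_below sw Lx xm xu Lu (fun y => @cx u y ux).
have [x1' xn'] := at_node_pos sw Lx'.
have := second_level_below sr (rev_ex sw Lx') _ _ (rev_ex sw Lu) _.
case.
- move=> z zx; rewrite adjw_rev subKn; last order_lia.
  by rewrite As; apply: xM; order_lia.
- order_lia.
- move=> z zu Lz; have [z1 zn] := at_node_pos sr Lz.
  have h : n - z = x'; last order_lia.
  apply/eqP; rewrite eqn_leq; apply/andP; split; rewrite leqNgt; apply/negP => h.
    by have := xmax _ h; rewrite -at_node_rev Lz.
  by have := nc (n - z); rewrite -at_node_rev Lz => /(_ ltac:(order_lia) h).
move=> b' [b'u Lb']; have [b1 bn] := at_node_pos sr Lb'.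
have [|a [a' [_ aa' _ La La']]] := arm_two_firsts sw (l3 i) (a := b) (b := n - b') _ Lb Lb'.
  order_lia.
have [z [az za Lz]] := arm_between sw aa' La La'.
have [zx|xz] := ltnP z x'.
  have e : z = x.
    apply/eqP; rewrite eqn_leq; apply/andP; split; rewrite leqNgt; apply/negP => h.
      by have := nc _ h zx; rewrite [at_node w 0 0 z]Lz.
    by have := xmin _ h; rewrite [at_node w 0 0 z]Lz.
  by subst z; have := xm _ az; rewrite (adj_arm _ La) [at_node w i 0 x]Lx.
have e : z = x'.
  by apply/eqP; rewrite eqn_leq xz andbT leqNgt; apply: contraTN Lz; apply: xmax.
by subst z; have := xM _ za; rewrite As (adj_arm _ La') [at_node w i 0 x']Lx'.
Qed.

End TwoArms.

(** * Complete graphs and odd cycles *)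

(** Above the last letter but one there is only the last letter. *)
Lemma complete_isolated (V : eqType) (C : rel V) n w : (forall x y, C x y) ->
  irreducible_word C n w -> isolated_word C w.
Proof.
move=> Ct iw s t st a; pose Q u := isSome (w u).
have [s1 sn t1 tn] := adjw_bound iw a.
have [Qs Qt] : Q s /\ Q t by move: a; rewrite /Q /adjw; case: (w s) => //; case: (w t).
have aQ u v : Q u -> Q v -> adjw C w u v.
  by rewrite /Q /adjw; case: (w u) => // x; case: (w v) => // y; rewrite Ct.
have [m [Qm mn mlast]] := ex_last_before Qt tn.
have tm : t <= m by rewrite leqNgt; apply/negP => h; have := mlast _ h tn; rewrite Qt.
have [m' [Qm' m'm m'last]] := ex_last_before Qs (leq_trans st tm).
have Qadj u v : adjw C w u v -> Q v /\ v < n.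
  by move=> b; have [_ _ _ vn] := adjw_bound iw b; split=> //; move: b; rewrite /Q /adjw;
    case: (w u) => //; case: (w v).
have [k [[h1 [h2 /Qadj[h3 h4]]]|[h1 /Qadj[h3 h4]]]] := iw_top iw m'm (aQ _ _ Qm' Qm).
  have [km|mk] := ltnP k m; first by have := m'last _ h1 km; rewrite h3.
  by have := mlast k; rewrite h3 h4 => /(_ ltac:(order_lia) isT).
by have := mlast k h1 h4; rewrite h3.
Qed.

Section CycleGap.

Variables (V : eqType) (C : rel V) (n N : nat) (w : nat -> option V) (f g : V -> V).
Hypotheses (iw : irreducible_word C n w) (fK : cancel f g) (gK : cancel g f).
Hypothesis CE : forall p q, C p q = [|| q == p, q == f p | q == g p].
Hypotheses (N1 : 1 < N) (gN : forall p, iter N g p = p).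

(* A gap of [p] without [f p] contains a gap of [g p] without [p], and so on
   around the cycle until a gap of [f p] is reached. *)
Lemma cycle_gap p s t : s < t -> w s = Some p -> w t = Some p ->
  exists u, [/\ s < u, u < t & w u = Some (f p)].
Proof.
move=> st ws wt.
have [/existsP[/= u /andP[su /eqP wu]]|/existsPn no] :=
    boolP [exists u : 'I_t, (s < u) && (w u == Some (f p))]; first by exists u; split.
have none u : s < u -> u < t -> w u <> Some (f p).
  by move=> su ut wu; have := no (Ordinal ut); rewrite /= su wu eqxx.
have chain j : exists s' t', [/\ s <= s' < t', t' <= t & j = 0 \/ s < s'] /\
    [/\ w s' = Some (iter j g p), w t' = Some (iter j g p) &
      forall u, s' < u -> u < t' -> w u <> Some (f (iter j g p))].
  elim: j => [|j [s' [t' [[/andP[ss' s't'] t't _] [ws' wt' nf]]]]].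
    by exists s, t; split; split=> //; [rewrite leqnn|left].
  have [|x [/eqP wx s'x nx]] := ex_first_after (Q := fun u => w u == Some (iter j g p)) _ s't'.
    by rewrite wt'.
  have xt' : x <= t' by rewrite leqNgt; apply/negP => h; have := nx _ s't' h; rewrite wt' eqxx.
  have [u [v [s'u uv vx au av]]] := iw_gap iw s'x ws' wx.
  have nb y : s' < y -> y < x -> adjw C w s' y -> w y = Some (iter j.+1 g p).
    move=> sy yx; rewrite /adjw ws'; case wy: (w y) => [q|] //; rewrite CE => /or3P[] /eqP e.
    - by have := nx _ sy yx; rewrite wy e eqxx.
    - by have := nf y sy ltac:(order_lia); rewrite wy e.
    - by rewrite e.
  exists u, v; split; first by split; [order_lia|order_lia|right; order_lia].
  split; [by apply: nb au; order_lia|by apply: nb av; order_lia|].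
  move=> y uy yv /= e; rewrite gK in e.
  by have := nx y ltac:(order_lia) ltac:(order_lia); rewrite e eqxx.
(* After N - 1 steps of [g] the letter is [f p]. By [N1] at least one step was made, so this
   occurrence lies strictly inside the gap. *)
have [s' [t' [[/andP[ss' s't'] t't h] [ws' wt' _]]]] := chain N.-1.
have e : iter N.-1 g p = f p.
  by have := gN (f p); rewrite -{1}(prednK (ltnW N1)) iterSr fK.
rewrite e in ws'; have := none s'; rewrite ws'; case: h => [h|h]; first by order_lia.
by move=> /(_ h ltac:(order_lia)).
Qed.

End CycleGap.

Section CycleStart.

Variables (V : eqType) (C : rel V) (n N : nat) (w : nat -> option V) (f g : V -> V).
Hypotheses (iw : irreducible_word C n w) (fK : cancel f g) (gK : cancel g f).
Hypothesis CE : forall p q, C p q = [|| q == p, q == f p | q == g p].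
Hypotheses (N1 : 1 < N) (fN : forall p, iter N f p = p).

(** A neighbour before [t] can only be [f q], and the first [f q] has no neighbour before it by
    induction. So [iw_bot] asks for a second [f q] before [t], and by [cycle_gap] the two enclose a
    [q] that comes too early. *)
Lemma cycle_first_minimal q t : w t = Some q ->
  (forall u, u < t -> w u <> Some q) -> (forall u, u < t -> w u <> Some (g q)) ->
  forall u, u < t -> ~~ adjw C w u t.
Proof.
have Cs : symmetric C.
  move=> x y; rewrite !CE [y == x]eq_sym; congr orb; rewrite orbC; congr orb.
    by rewrite eq_sym (can2_eq gK fK).
  by rewrite eq_sym (can2_eq fK gK).
have As := adjwC w Cs.
have [m] := ubnP t; elim: m t q => // m IHm t q tm wt nq ng u ut; apply/negP => a.
have nb y : y < t -> adjw C w y t -> w y = Some (f q).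
  move=> yt; rewrite As /adjw wt; case wy: (w y) => [q'|] //; rewrite CE => /or3P[]/eqP e.
  - by have := nq _ yt; rewrite wy e.
  - by rewrite e.
  - by have := ng _ yt; rewrite wy e.
have [|t1 [/eqP wt1 t1u t1min]] := ex_first (Q := fun y => w y == Some (f q)) (t := u).
  by apply/eqP/nb.
have t1t : t1 < t by order_lia.
have src : forall v, v < t1 -> ~~ adjw C w v t1.
  apply: (IHm t1 (f q)) => //; first order_lia.
    by move=> v vt e; have := t1min _ vt; rewrite e eqxx.
  by move=> v vt; rewrite fK; apply: nq; order_lia.
have a1 : adjw C w t1 t by rewrite As /adjw wt wt1 CE eqxx orbT.
have [h [[ht [ht1 ah]]|[ht]]] := iw_bot iw t1t a1; last by apply/negP/src.
have wh := nb _ ht ah.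
have t1h : t1 < h.
  rewrite ltn_neqAle eq_sym; apply/andP; split; first by apply/eqP.
  by rewrite leqNgt; apply/negP => /t1min; rewrite wh eqxx.
have [|y [t1y yh wy]] := cycle_gap iw gK fK _ N1 fN t1h wt1 wh => //.
  by move=> p' q'; rewrite CE; case: (q' == p') => //=; rewrite orbC.
by rewrite fK in wy; apply: (nq y) => //; order_lia.
Qed.

End CycleStart.

(** [S] tells whether nothing adjacent precedes the first occurrence of a letter. It changes at each
    step along the cycle, which N odd steps back to the same letter contradict. *)
Theorem odd_cycle_occurs (V : eqType) (C : rel V) n N w (f g : V -> V) (p0 : V) :
  irreducible_word C n w -> cancel f g -> cancel g f ->
  (forall p q, C p q = [|| q == p, q == f p | q == g p]) ->
  1 < N -> odd N -> (forall p, iter N f p = p) -> (forall p, iter N g p = p) ->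
  (forall p, f p <> p) -> (forall p, exists t, w t == Some p) -> False.
Proof.
move=> iw fK gK CE N1 oN fN gN fp occ.
have CE' p q : C p q = [|| q == p, q == g p | q == f p].
  by rewrite CE; case: (q == p) => //=; rewrite orbC.
pose tau p := ex_minn (occ p).
have tauP p : w (tau p) = Some p by rewrite /tau; case: ex_minnP => m /eqP.
have tau_min p u : u < tau p -> w u <> Some p.
  by rewrite /tau; case: ex_minnP => m _ mm um wu; have := mm u; rewrite wu eqxx => /(_ isT); order_lia.
pose S p := [forall u : 'I_(tau p), ~~ adjw C w u (tau p)].
have Sf p : S (f p) = ~~ S p.
  have npf : tau p <> tau (f p).
    by move=> e; have := tauP p; rewrite e tauP => -[] /fp.
  have [h|h] := ltnP (tau p) (tau (f p)).
    have -> : S p.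
      apply/forallP => /= u; apply: (cycle_first_minimal iw gK fK CE' N1 gN (tauP p)) => // v vt.
        exact: tau_min.
      by apply: tau_min; order_lia.
    apply/negP => /forallP/(_ (Ordinal h)) /=.
    by rewrite /adjw !tauP CE eqxx orbT.
  have h' : tau (f p) < tau p by order_lia.
  have -> : S (f p).
    apply/forallP => /= u; apply: (cycle_first_minimal iw fK gK CE N1 fN (tauP (f p))) => // v vt.
      exact: tau_min.
    by rewrite fK; apply: tau_min; order_lia.
  apply/esym/negP => /forallP/(_ (Ordinal h')) /=.
  by rewrite /adjw !tauP CE fK eqxx !orbT.
have Si j p : S (iter j f p) = odd j (+) S p.
  by elim: j => //= j IHj; rewrite Sf IHj; case: (odd j) (S p) => [] [].
by have := Si N p0; rewrite fN oN; case: (S p0).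
Qed.

(** * Words on the graphs of the list *)

Definition graph_rel (G : graph) : rel G := fun x y => (x == y) || adj x y.

Definition star_node p q r (x : star_graph p q r) : option (nat * nat) :=
  match x with
  | None => None
  | Some (inl (inl i)) => Some (0, val i)
  | Some (inl (inr i)) => Some (1, val i)
  | Some (inr i) => Some (2, val i)
  end.

Lemma star_node_inj p q r : injective (@star_node p q r).
Proof. by move=> [[[i|i]|i]|] [[[j|j]|j]|] // [] /val_inj ->. Qed.

Lemma star_node_adj p q r (x y : star_graph p q r) :
  spider_adj (star_node x) (star_node y) = adj x y.
Proof. by case: x y => [[[i|i]|i]|] [[[j|j]|j]|]. Qed.

Lemma star_isolated p q r n w :
  (p <= 1 /\ q <= 2) \/ [/\ p <= 2, q <= 2 & r <= 2] ->
  irreducible_word (@graph_rel (star_graph p q r)) n w ->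
  isolated_word (@graph_rel (star_graph p q r)) w.
Proof.
move=> pqr iw.
pose f (x : star_graph p q r) := Some (star_node x).
have fadj x y x' y' : f x = Some x' -> f y = Some y' ->
    spider_rel x' y' = graph_rel x y /\ (x' = y' -> x = y).
  move=> [<-] [<-]; split; last exact: star_node_inj.
  by rewrite /spider_rel /graph_rel (inj_eq (@star_node_inj _ _ _)) star_node_adj.
have iw' : irreducible_word spider_rel n (fun i => obind f (w i)).
  by apply: irreducible_word_map iw => // i j x y x' y' _ _; apply: fadj.
have lev t i k : obind f (w t) = Some (Some (i, k)) ->
    [/\ i < 3, k < maxn p (maxn q r), i = 0 -> k < p, i = 1 -> k < q & i = 2 -> k < r].
  case: (w t) => [[[[j|j]|j]|]|] //= [<- <-]; have := ltn_ord j; split=> //; order_lia.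
have sw : spider_word (maxn p (maxn q r)) n (fun i => obind f (w i)).
  by split=> // t i k /lev[].
have iso : isolated_word spider_rel (fun i => obind f (w i)).
  case: pqr => [[p1 q2]|[p2 q2 r2]].
    apply: (one_two_spider_isolated sw) => t i k /lev[_ _ h1 h2 _].
    by split=> /[dup] ?; [move/h1|move/h2]; order_lia.
  apply: (two_arms_isolated sw) => t i k /lev[i3 _ h1 h2 h3].
  by case: i i3 h1 h2 h3 => [|[|[|]]] // _ h1 h2 h3; [have := h1 erefl|have := h2 erefl|have := h3 erefl]; order_lia.
move=> s t st; rewrite /adjw; case ws: (w s) => [x|] //; case wt: (w t) => [y|] // a.
apply: (iso s t st); rewrite /adjw ws wt /=.
by have [] := fadj x y _ _ erefl erefl => ->.
Qed.

Definition path_rel : rel nat := fun i j => (i == j) || path_adj i j.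

(** A path is a spider with arms 0 and 1 empty and its end 0 as the centre. *)
Lemma path_isolated n w : irreducible_word path_rel n w ->
  (exists K, forall t k, w t = Some k -> k < K) -> isolated_word path_rel w.
Proof.
move=> iw [K wK]; pose f k := Some (spider_node 2 k).
have fadj x y x' y' : f x = Some x' -> f y = Some y' ->
    spider_rel x' y' = path_rel x y /\ (x' = y' -> x = y).
  move=> [<-] [<-]; have inj : forall x y, spider_node 2 x = spider_node 2 y -> x = y.
    by move=> [|i] [|j] // [->].
  split; last exact: inj.
  rewrite /spider_rel /path_rel; congr orb; first by apply/eqP/eqP => [/inj|->].
  by case: x y => [|x] [|y]; rewrite /= /path_adj //= ?orbF // eq_sym.
have iw' : irreducible_word spider_rel n (fun i => obind f (w i)).
  by apply: irreducible_word_map iw => // i j x y x' y' _ _; apply: fadj.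
have lev t i k : obind f (w t) = Some (Some (i, k)) -> i = 2 /\ k < K.
  case wt: (w t) => [[|x]|] //= [<- <-]; split=> //; have := wK _ _ wt; order_lia.
have iso : isolated_word spider_rel (fun i => obind f (w i)).
  apply: (@one_two_spider_isolated K n) => [|t i k /lev[-> _] //].
  by split=> // t i k /lev[-> ->].
move=> s t st; rewrite /adjw; case ws: (w s) => [x|] //; case wt: (w t) => [y|] // a.
apply: (iso s t st); rewrite /adjw ws wt /=.
by have [] := fadj x y _ _ erefl erefl => ->.
Qed.

Lemma path_graph_isolated m n w : irreducible_word (@graph_rel (path_graph m)) n w ->
  isolated_word (@graph_rel (path_graph m)) w.
Proof.
move=> iw; pose f (x : path_graph m) : option nat := Some (val x).
have iso : isolated_word path_rel (fun i => obind f (w i)).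
  apply: (@path_isolated n).
    by apply: irreducible_word_map iw => // i j x y x' y' _ _ [<-] [<-]; split=> [//|/val_inj].
  by exists m => t k; case: (w t) => [x|] //= [<-]; apply: ltn_ord.
by move=> s t st a; apply: (iso s t st); move: a; rewrite /adjw; case: (w s) => // x; case: (w t).
Qed.

Lemma cycle_adjE m (i j : 'I_m) :
  (i.+1 %% m == j) = (j == i.+1 :> nat) || (i == m.-1 :> nat) && (j == 0 :> nat).
Proof.
have := ltn_ord i; have := ltn_ord j => jm im.
have [e|h] := eqVneq (i : nat) m.-1.
  by have -> : i.+1 = m; [order_lia|rewrite modnn; order_lia].
by rewrite modn_small; order_lia.
Qed.

(** [d] is the distance from [q] in one direction around the cycle; it numbers the path left when
    [q] is removed. *)
Lemma cut_cycle m q x y : q < m -> x < m -> y < m -> x <> q -> y <> q ->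
  let d x := if q <= x then x - q else x + m - q in
  path_rel (d x) (d y) = (x == y) || ((y == x.+1) || (x == m.-1) && (y == 0)
    || ((x == y.+1) || (y == m.-1) && (x == 0))) /\ (d x = d y -> x = y).
Proof.
move=> qm xm ym xq yq /=; rewrite /path_rel /path_adj.
by case: leqP => h1; case: leqP => h2; split; order_lia.
Qed.

Lemma cut_cycle_lt m q x : q < m -> x < m -> (if q <= x then x - q else x + m - q) < m.
Proof. by move=> qm xm; case: (leqP q x) => h; order_lia. Qed.

Lemma odd_cycle_isolated m n w : (3 <= m) && odd m ->
  irreducible_word (@graph_rel (cycle_graph m)) n w ->
  isolated_word (@graph_rel (cycle_graph m)) w.
Proof.
move=> /andP[m3 om] iw.
have [/existsP[q /forallP nq]|/existsPn occ] :=
    boolP [exists q : 'I_m, [forall t : 'I_n, w t != Some q]]; last first.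
  exfalso; case: m m3 om w iw occ => // m m3 om w iw occ.
  have fN p : iter m.+1 (@ordS m.+1) p = p.
    have val_iter k : val (iter k (@ordS m.+1) p) = (p + k) %% m.+1.
      elim: k => [|k IHk]; first by rewrite addn0 modn_small.
      by rewrite /= IHk -addn1 modnDml addn1 addnS.
    by apply: val_inj; rewrite val_iter modnDr modn_small.
  apply: (odd_cycle_occurs (f := @ordS _) (g := @ord_pred _) (N := m.+1) ord0 iw) => //.
  - exact: ordSK.
  - exact: ord_predK.
  - move=> p q; rewrite /graph_rel eq_sym; congr [|| _, _ | _].
      by apply/eqP/eqP => [e|-> //]; apply: val_inj.
    apply/eqP/eqP => [e|->]; last exact: (congr1 val (ord_predK p)).
    have <- : ordS q = p by apply: val_inj.
    by rewrite ordSK.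
  - exact: ltnW.
  - have cancel_iter k p : iter k (@ord_pred m.+1) (iter k (@ordS m.+1) p) = p.
      by elim: k p => // k IHk p; rewrite iterSr [iter k.+1 (@ordS _) _]iterS ordSK.
    by move=> p; rewrite -[in LHS](fN p) cancel_iter.
  - move=> p /(congr1 val)/eqP; rewrite /= cycle_adjE; order_lia.
  - move=> p; have := occ p; rewrite negb_forall => /existsP[t]; rewrite negbK.
    by exists t.
move: q nq => /= q nq; have nq' t x : w t = Some x -> x <> q.
  move=> wt e; subst x; have tn : t < n by rewrite ltnNge; apply/negP => /(iw_end iw); rewrite wt.
  by have := nq (Ordinal tn); rewrite /= wt eqxx.
(* The letter q does not occur, so the cycle is cut open at q. *)
pose d (x : 'I_m) := if q <= x then x - q else x + m - q.
pose f (x : cycle_graph m) : option nat := Some (d x).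
have dadj (x y : 'I_m) : x <> q -> y <> q -> path_rel (d x) (d y) = graph_rel (x : cycle_graph m) y /\ (d x = d y -> x = y).
  move=> nxq nyq; have xq : (x : nat) <> q by move=> h; apply: nxq; apply: val_inj.
  have yq : (y : nat) <> q by move=> h; apply: nyq; apply: val_inj.
  have [dE dI] := cut_cycle (ltn_ord q) (ltn_ord x) (ltn_ord y) xq yq.
  split; last by move=> h; apply: val_inj; apply: dI.
  by rewrite /graph_rel /= !cycle_adjE; apply: dE.
have iso : isolated_word path_rel (fun i => obind f (w i)).
  apply: (@path_isolated n).
    apply: irreducible_word_map iw => // i j x y x' y' wi wj [<-] [<-].
    exact: dadj (nq' _ _ wi) (nq' _ _ wj).
  by exists m => t k; case: (w t) => [x|] //= [<-]; apply: cut_cycle_lt (ltn_ord q) (ltn_ord x).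
move=> s t st; rewrite /adjw; case ws: (w s) => [x|] //; case wt: (w t) => [y|] // a.
apply: (iso s t st); rewrite /adjw ws wt /=.
by have [-> _] := dadj x y (nq' _ _ ws) (nq' _ _ wt).
Qed.

Lemma regular_type_isolated (H : graph) n w : regular_type H ->
  irreducible_word (@graph_rel H) n w -> isolated_word (@graph_rel H) w.
Proof.
have main G : graph_iso H G ->
    (forall n w, irreducible_word (@graph_rel G) n w -> isolated_word (@graph_rel G) w) ->
    irreducible_word (@graph_rel H) n w -> isolated_word (@graph_rel H) w.
  case=> f fb fadj hG iw; have finj := bij_inj fb; pose f' x := Some (f x).
  have iso : isolated_word (@graph_rel G) (fun i => obind f' (w i)).
    apply: (hG n); apply: irreducible_word_map iw => // i j x y x' y' _ _ [<-] [<-].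
    by split; [rewrite /graph_rel (inj_eq finj) fadj|apply: finj].
  move=> s t st; rewrite /adjw; case ws: (w s) => [x|] //; case wt: (w t) => [y|] // a.
  by apply: (iso s t st); rewrite /adjw ws wt /= /graph_rel (inj_eq finj) fadj.
case=> [[m /main]|[[m _ /main]|[[m m4 /main]|[[m m6 /main]|[[m m3 /main]|/main]]]]]; apply.
- by move=> n' w'; apply: complete_isolated => x y; rewrite /graph_rel /=; case: eqP.
- exact: path_graph_isolated.
- by move=> n' w'; apply: star_isolated; left.
- by move=> n' w'; apply: star_isolated; left.
- by move=> n' w'; apply: odd_cycle_isolated.
- by move=> n' w'; apply: star_isolated; right.
Qed.

Lemma regular_of_types (P : finType) (C : rel P) (Crefl : reflexive C) (Csym : symmetric C) :
  (forall v : concurrency_graph C, regular_type (component v)) -> regular Csym.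
Proof.
move=> hreg; apply: (regular_of_words Crefl) => n w iw s t st ast.
have [p [q [ws wt Cpq]]] : exists p q, [/\ w s = Some p, w t = Some q & C p q].
  by move: ast; rewrite /adjw; case: (w s) => // p; case: (w t) => // q; exists p, q.
pose e := @adj (concurrency_graph C); pose G := @component (concurrency_graph C) p.
pose f x : option G := insub x.
have Ccon x y : C x y -> connect e p x = connect e p y.
  move=> Cxy; have [-> //|nxy] := eqVneq x y.
  apply: same_connect_r; last by apply: connect1; rewrite /e /= nxy.
  by apply: sym_connect_sym => a b; rewrite /e /= eq_sym Csym.
have fS x : isSome (f x) = connect e p x.
  by rewrite /f; case: insubP => [u ->|/negbTE ->].
have iw' : irreducible_word (@graph_rel G) n (fun i => obind f (w i)).
  apply: irreducible_word_map iw => [i j x y _ _ Cxy|i j x y x' y' _ _].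
    by rewrite !fS; apply: Ccon.
  rewrite /f; case: insubP => // u _ <- [<-]; case: insubP => // v _ <- [<-].
  split=> [|-> //]; rewrite /graph_rel /= -(inj_eq val_inj) /=.
  by case: eqP => [->|] //=; rewrite ?Crefl.
have cq : connect e p q by rewrite -(Ccon _ _ Cpq) connect0.
apply: (regular_type_isolated (hreg p) iw' st).
rewrite /adjw ws wt /= /f (insubT (connect e p) (connect0 e p)) (insubT (connect e p) cq) /=.
rewrite /graph_rel -(inj_eq val_inj) /=; case: eqP => //= _.
Qed.

(** * Graphs carrying irreducible heaps *)

Definition word_adj (V : eqType) (r : rel V) (x0 : V) (s : seq V) i j :=
  r (nth x0 s i) (nth x0 s j).

(** The hypotheses of [timed_not_regular] in boolean form, with positions as times, so that an
    explicit word is checked by computation. *)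
Definition bad_word (V : eqType) (r : rel V) (x0 : V) (s : seq V) : bool :=
  let m := iota 0 (size s) in let a := word_adj r x0 s in
  [&& all (fun i => all (fun j => (i < j) && (nth x0 s i == nth x0 s j) ==>
        has (fun k => has (fun l => [&& k != l, i < k < j, i < l < j, a i k & a i l]) m) m) m) m,
      all (fun i => all (fun j => (i < j) && a i j ==>
        has (fun k => [&& k != j, i < k & a i k] || (j < k) && a j k) m) m) m,
      all (fun i => all (fun j => (i < j) && a i j ==>
        has (fun k => [&& k != i, k < j & a k j] || (k < i) && a k i) m) m) m
    & has (fun i => has (fun j => (i < j) && a i j) m) m].

Definition cycle_adj n i j :=
  [|| j == i.+1, i == j.+1, (i == 0) && (j == n.-1) | (j == 0) && (i == n.-1)].

Section BadConfigurations.

Variables (P : finType) (C : rel P) (Crefl : reflexive C) (Csym : symmetric C).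
Hypothesis reg : regular Csym.

Lemma bad_word_absurd (V : eqType) (r : rel V) x0 (s : seq V) (h : V -> P) :
  {in s &, forall a b, C (h a) (h b) = r a b} -> {in s &, injective h} ->
  ~~ bad_word r x0 s.
Proof.
move=> hC hi; apply/negP => /and4P[/allP b1 /allP b2 /allP b3 /hasP b4].
pose l (i : 'I_(size s)) := h (nth x0 s i).
have ns (i : 'I_(size s)) : nth x0 s i \in s by rewrite mem_nth.
have lC i j : C (l i) (l j) = word_adj r x0 s i j by apply: hC.
have io (i : 'I_(size s)) : val i \in iota 0 (size s) by rewrite mem_iota add0n ltn_ord.
have oi k : k \in iota 0 (size s) -> exists i : 'I_(size s), val i = k.
  by rewrite mem_iota add0n /= => ks; exists (Ordinal ks).
apply: (@timed_not_regular _ _ Crefl Csym _ l (fun i => val i)) reg.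
- by move=> i j _; apply: val_inj.
- move=> i j lij ij; have /allP/(_ _ (io j)) := b1 _ (io i).
  have -> : (val i < val j) && (nth x0 s (val i) == nth x0 s (val j)).
    by rewrite ij /=; apply/eqP; apply: hi.
  case/hasP=> k /oi[k' <-] /hasP[k2 /oi[k2' <-]] /and5P[n1 h1 h2 h3 h4].
  by exists k', k2'; rewrite !lC; split=> // e; rewrite e eqxx in n1.
- move=> i j ij; rewrite lC => aij; have /allP/(_ _ (io j)) := b2 _ (io i).
  rewrite /= ij aij /= => /hasP[k /oi[k' <-]] /orP[/and3P[n1 h1 h2]|/andP[h1 h2]]; exists k'; rewrite !lC.
    by left; split=> // e; rewrite e eqxx in n1.
  by right.
- move=> i j ij; rewrite lC => aij; have /allP/(_ _ (io j)) := b3 _ (io i).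
  rewrite /= ij aij /= => /hasP[k /oi[k' <-]] /orP[/and3P[n1 h1 h2]|/andP[h1 h2]]; exists k'; rewrite !lC.
    by left; split=> // e; rewrite e eqxx in n1.
  by right.
- case: b4 => i /oi[i' <-] /hasP[j /oi[j' <-]] /andP[ij a].
  by exists i', j'; rewrite lC.
Qed.

(** On K4 minus the edge between [y] and [v], the word y v x z y v works: both repeated letters
    enclose [x] and [z]. *)
Lemma diamond_absurd (x y z v : P) : C x y -> C x z -> C x v -> C z y -> C z v ->
  C y v = false -> x <> z -> False.
Proof.
move=> xy xz xv zy zv yv nxz.
have nCne a b c : C a b -> C c b = false -> a <> c by move=> ab cb e; rewrite e cb in ab.
pose r i j := ~~ (((i == 0) && (j == 1)) || ((i == 1) && (j == 0))).
suff : ~~ bad_word r 0 [:: 0; 1; 2; 3; 0; 1] by [].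
apply: (@bad_word_absurd _ r 0 _ (fun i => nth x [:: y; v; x; z] i)).
- move=> a b; rewrite !inE.
  do 6?[case/orP] => /eqP->; do 6?[case/orP] => /eqP->;
    rewrite /r /= ?Crefl ?yv ?[C v y]Csym ?yv ?[C y x]Csym ?[C y z]Csym ?[C v x]Csym ?[C v z]Csym ?[C z x]Csym
      ?xy ?xz ?xv ?zy ?zv //.
have yv' : C v y = false by rewrite Csym.
have nyv : y <> v by move=> e; rewrite e Crefl in yv.
have nxy : x <> y := nCne _ _ _ xv yv.
have nxv : x <> v := nCne _ _ _ xy yv'.
have nzy : z <> y := nCne _ _ _ zv yv.
have nzv : z <> v := nCne _ _ _ zy yv'.
move=> a b; rewrite !inE.
by do 6?[case/orP] => /eqP->; do 6?[case/orP] => /eqP-> //= e; exfalso; congruence.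
Qed.

(** * Graphs of affine type D *)

Section Dtilde.

Variables (k : nat) (c : nat -> P) (q : bool * bool -> P).
Hypothesis k0 : 0 < k.
Hypothesis Cc : forall i j, i < k -> j < k -> C (c i) (c j) = (i == j) || path_adj i j.
Hypothesis cI : forall i j, i < k -> j < k -> c i = c j -> i = j.
Hypothesis Cq : forall x y, x <> y -> C (q x) (q y) = false.
Hypothesis Cqc : forall x j, j < k -> C (q x) (c j) = (j == if x.1 then k.-1 else 0).
Hypothesis qc : forall x j, j < k -> q x <> c j.

(** Each vertex is used once: two leaves at the bottom, the path in order, the other two leaves on
    top. The component [x.1] selects the end of the path to which the leaf [q x] is joined; for
    [k = 1] the graph is a star with four leaves. *)
Lemma Dtilde_absurd : False.
Proof.
have Ccq x j : j < k -> C (c j) (q x) = (j == if x.1 then k.-1 else 0) by move=> h; rewrite Csym Cqc.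
pose l (x : 'I_k + bool * bool) := match x with inl j => c j | inr y => q y end.
pose t (x : 'I_k + bool * bool) := match x with inl j => j.+1 | inr y => if y.1 then k.+1 else 0 end.
have qE x y : C (q x) (q y) -> x = y.
  by move=> h; apply/eqP; apply: contraTT h => /eqP/Cq ->.
pose first : 'I_k := Ordinal k0.
apply: (@timed_not_regular _ _ Crefl Csym _ l t) reg.
- move=> [i|x] [j|y] /=; rewrite ?Cqc ?Ccq //.
  + by move=> _ [/val_inj ->].
  + have := ltn_ord i; case: y => [[] ?] /= ik; order_lia.
  + have := ltn_ord j; case: x => [[] ?] /= ik; order_lia.
  + by move=> /qE ->.
- move=> [i|x] [j|y] /= e; try by (have := qc e) || (have := qc (esym e)).
  + by have := cI (ltn_ord i) (ltn_ord j) e; order_lia.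
  + by move/esym/qc: e => /(_ (ltn_ord i)).
  + by move/qc: e => /(_ (ltn_ord j)).
  + have h : C (q x) (q y) by rewrite e Crefl.
    by rewrite (qE _ _ h) ltnn.
- move=> [i|x] [j|y] /=.
  + move=> ij; rewrite Cc ?ltn_ord // => a.
    have eji : j = i.+1 :> nat by move: a; rewrite /path_adj; order_lia.
    have [h|h] := eqVneq (j : nat) k.-1.
      exists (inr (true, true)); right; rewrite /= Ccq ?ltn_ord // h; split=> //; order_lia.
    have jk : j.+1 < k by have := ltn_ord j; order_lia.
    exists (inl (Ordinal jk)); right; rewrite /= Cc ?ltn_ord //; split=> //.
    by rewrite /path_adj eqxx orbT.
  + case: y => [[] b] /=; last by order_lia.
    move=> _; rewrite Ccq ?ltn_ord // => /= /eqP a.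
    exists (inr (true, ~~ b)); left; split; first by case=> /esym; case: b.
    by rewrite /= Ccq ?ltn_ord // a /= eqxx; split=> //; order_lia.
  + case: x => [[] b] /=; first by have := ltn_ord j; order_lia.
    move=> _; rewrite Cqc ?ltn_ord // => /= /eqP j0.
    have [h|h] := eqVneq (j : nat) k.-1.
      exists (inr (true, true)); right; rewrite /= Ccq ?ltn_ord // h; split=> //; order_lia.
    have jk : j.+1 < k by have := ltn_ord j; order_lia.
    exists (inl (Ordinal jk)); right; rewrite /= Cc ?ltn_ord //; split=> //.
    by rewrite /path_adj eqxx orbT.
  + by move=> h /qE e; rewrite e ltnn in h.
- move=> [i|x] [j|y] /=.
  + move=> ij; rewrite Cc ?ltn_ord // => a.
    have eji : j = i.+1 :> nat by move: a; rewrite /path_adj; order_lia.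
    have [h|h] := eqVneq (i : nat) 0.
      by exists (inr (false, true)); right; rewrite /= Cqc ?ltn_ord // h.
    have ik : i.-1 < k by have := ltn_ord i; order_lia.
    exists (inl (Ordinal ik)); right; rewrite /= Cc ?ltn_ord //; split=> //; first order_lia.
    by rewrite /path_adj; apply/orP; right; apply/orP; left; order_lia.
  + case: y => [[] b] /=; last by order_lia.
    move=> _; rewrite Ccq ?ltn_ord // => /= /eqP a.
    have [h|h] := eqVneq (i : nat) 0.
      by exists (inr (false, true)); right; rewrite /= Cqc ?ltn_ord // h.
    have ik : i.-1 < k by have := ltn_ord i; order_lia.
    exists (inl (Ordinal ik)); right; rewrite /= Cc ?ltn_ord //; split=> //; first order_lia.
    by rewrite /path_adj; apply/orP; right; apply/orP; left; order_lia.
  + case: x => [[] b] /=; first by have := ltn_ord j; order_lia.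
    move=> _; rewrite Cqc ?ltn_ord // => /= /eqP j0.
    exists (inr (false, ~~ b)); left; split; first by case=> /esym; case: b.
    by rewrite /= Cqc ?ltn_ord // j0.
  + by move=> h /qE e; rewrite e ltnn in h.
- by exists (inr (false, true)), (inl first); rewrite /= Cqc.
Qed.

End Dtilde.

(** * Even cycles and cycles with a pendant vertex *)

Section Cycle.

Variables (n : nat) (c : nat -> P).
Hypothesis n3 : 2 < n.
Hypothesis Cc : forall i j, i < n -> j < n -> C (c i) (c j) = (i == j) || cycle_adj n i j.
Hypothesis cI : forall i j, i < n -> j < n -> c i = c j -> i = j.

(** On an even cycle, the even vertices in one layer and the odd ones above give a heap where each
    element has exactly two neighbours in the other layer. *)
Lemma regular_cycle_odd : odd n.
Proof.
apply/negPn/negP => en.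
pose nx i := if i == n.-1 then 0 else i.+1.
pose pv i := if i == 0 then n.-1 else i.-1.
have adjP i j : i < n -> j < n -> cycle_adj n i j = (j == nx i) || (j == pv i).
  by rewrite /cycle_adj /nx /pv => ? ?; case: (i =P n.-1) => ?; case: (i =P 0) => ?; order_lia.
have nxn i : i < n -> nx i < n by rewrite /nx => ?; case: (i =P n.-1) => ?; order_lia.
have pvn i : i < n -> pv i < n by rewrite /pv => ?; case: (i =P 0) => ?; order_lia.
have nxo i : i < n -> odd (nx i) = ~~ odd i by rewrite /nx => ?; case: (i =P n.-1) => ? //=; order_lia.
have pvo i : i < n -> odd (pv i) = ~~ odd i by rewrite /pv => ?; case: (i =P 0) => ? //=; order_lia.
have nxpv i : i < n -> nx i <> pv i.
  by rewrite /nx /pv => ?; case: (i =P n.-1) => ?; case: (i =P 0) => ?; order_lia.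
pose l (i : 'I_n) := c i; pose t (i : 'I_n) : nat := odd i.
have other (i j : 'I_n) : t i <> t j -> C (l i) (l j) ->
    exists z : 'I_n, [/\ z <> j, t z = t j & C (l i) (l z)].
  move=> tij; rewrite /l Cc // => /orP[/eqP/val_inj e|]; first by case: tij; rewrite e.
  have i_n := ltn_ord i; rewrite adjP // => /orP[]/eqP e.
    exists (Ordinal (pvn _ i_n)); split.
    - by move/(congr1 val) => /=; rewrite e; move/esym; apply: nxpv.
    - by rewrite /t /= pvo // e nxo.
    - by rewrite Cc ?pvn // adjP ?pvn // eqxx !orbT.
  exists (Ordinal (nxn _ i_n)); split.
  - by move/(congr1 val) => /=; rewrite e; apply: nxpv.
  - by rewrite /t /= nxo // e pvo.
  - by rewrite Cc ?nxn // adjP ?nxn // eqxx !orbT.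
apply: (@timed_not_regular _ _ Crefl Csym _ l t) reg.
- move=> i j; rewrite /l Cc // => /orP[/eqP/val_inj //|].
  have i_n := ltn_ord i; rewrite adjP // /t => /orP[]/eqP->; rewrite ?nxo ?pvo //; by case: (odd i).
- by move=> i j /(cI (ltn_ord i) (ltn_ord j))/val_inj ->; rewrite ltnn.
- move=> i j tij /other[|z [zj tz Cz]]; first by order_lia.
  by exists z; left; rewrite tz.
- move=> i j tij; rewrite Csym => /other[|z [zj tz Cz]]; first by order_lia.
  by exists z; left; rewrite tz Csym.
- have n0 : 0 < n by order_lia.
  have n1 : 1 < n by order_lia.
  by exists (Ordinal n0), (Ordinal n1); rewrite /l /= Cc.
Qed.

(* The word c0 v c1 c2 ... c(n-1) c0 c1 v c2, where v is the pendant. *)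
Lemma pendant_cycle_absurd (v : P) :
  (forall j, j < n -> C v (c j) = (j == 1)) -> (forall j, j < n -> v <> c j) -> False.
Proof.
move=> Cv vc.
have Cv' j : j < n -> C (c j) v = (j == 1) by move=> h; rewrite Csym Cv.
pose lt' p := if p < n then p else p - n.
have ltn' p : p < n + 3 -> lt' p < n by rewrite /lt'; case: ifP; order_lia.
pose l (x : 'I_(n + 3) + bool) := match x with inl p => c (lt' p) | inr _ => v end.
(* The two pieces [v] share time 0 with [c 0] and time n + 2 with [c 2], which are not adjacent to
   [v]. *)
pose t (x : 'I_(n + 3) + bool) := match x with inl p => nat_of_ord p | inr b => if b then n + 2 else 0 end.
have Cl (p p' : 'I_(n + 3)) : C (l (inl p)) (l (inl p')) = (lt' p == lt' p') || cycle_adj n (lt' p) (lt' p').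
  by rewrite /= Cc ?ltn'.
have Csucc (p p' : 'I_(n + 3)) : p' = p.+1 :> nat -> C (l (inl p)) (l (inl p')).
  move=> e; rewrite Cl; have := ltn_ord p'; rewrite e /lt' /cycle_adj.
  by case: ifP; case: ifP; order_lia.
have ord p : p < n + 3 -> exists p' : 'I_(n + 3), nat_of_ord p' = p.
  by move=> h; exists (Ordinal h).
have [o1 o1E] : exists p' : 'I_(n + 3), nat_of_ord p' = 1 by apply: ord; order_lia.
have [o2 o2E] : exists p' : 'I_(n + 3), nat_of_ord p' = n + 1 by apply: ord; order_lia.
have Cvl b (p : 'I_(n + 3)) : C (l (inr b)) (l (inl p)) = (lt' p == 1).
  by rewrite /= Cv // ltn'.
have Clv b (p : 'I_(n + 3)) : C (l (inl p)) (l (inr b)) = (lt' p == 1).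
  by rewrite Csym Cvl.
have lt1 p : p < n + 3 -> (lt' p == 1) = (p == 1) || (p == n + 1).
  by rewrite /lt' => h; case: ifP; order_lia.
have Cv1 b : C (l (inr b)) (l (inl o1)) by rewrite Cvl lt1 // o1E.
have Cv2 b : C (l (inr b)) (l (inl o2)) by rewrite Cvl lt1 // o2E eqxx orbT.
have C1v b : C (l (inl o1)) (l (inr b)) by rewrite Csym.
have C2v b : C (l (inl o2)) (l (inr b)) by rewrite Csym.
have n12 : inl o1 <> inl o2 :> 'I_(n + 3) + bool.
  by case=> e; have := congr1 val e => /=; order_lia.
apply: (@timed_not_regular _ _ Crefl Csym _ l t) reg.
- move=> [p|b] [p'|b'].
  + by move=> _ /= /val_inj ->.
  + rewrite Clv lt1 //= => h; case: b'; order_lia.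
  + rewrite Cvl lt1 //= => h; case: b; order_lia.
  + by case: b b' => [] [] //= _; order_lia.
- move=> [p|b] [p'|b'].
  + move=> e; have := cI (ltn' _ (ltn_ord p)) (ltn' _ (ltn_ord p')) e => {}e /= pp'.
    have pn := ltn_ord p; have pn' := ltn_ord p'.
    have ep : p' = p + n :> nat.
      move: e; rewrite /lt'; case: ifP; case: ifP; order_lia.
    have [u uE] : exists u : 'I_(n + 3), nat_of_ord u = p.+1 by apply: ord; order_lia.
    have [u' uE'] : exists u : 'I_(n + 3), nat_of_ord u = p'.-1 by apply: ord; order_lia.
    exists (inl u), (inl u'); split.
    * by case=> e'; have := congr1 val e' => /=; order_lia.
    * by rewrite /= uE; order_lia.
    * by rewrite /= uE'; order_lia.
    * by apply: Csucc; rewrite uE.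
    * suff : C (l (inl u')) (l (inl p')) by rewrite /= -e Csym.
      by apply: Csucc; rewrite uE'; order_lia.
  + by move=> /= /esym/vc; rewrite ltn' // => /(_ isT).
  + by move=> /= /vc; rewrite ltn' // => /(_ isT).
  + move=> _; case: b b' => [] [] /=; rewrite ?ltnn ?ltn0 // => h.
    exists (inl o1), (inl o2); split; [exact: n12|rewrite /t /= o1E; order_lia|rewrite /t /= o2E; order_lia| |].
      exact: (Cv1 false).
    exact: (Cv2 false).
- move=> [p|b] [p'|b'].
  + move=> /= pp' Cpp; have pn := ltn_ord p; have pn' := ltn_ord p'.
    have [u uE] : exists u : 'I_(n + 3), nat_of_ord u = p.+1 by apply: ord; order_lia.
    have [e|ne] := eqVneq p' u; last first.
      exists (inl u); left; split; first by case=> e; rewrite e eqxx in ne.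
      by rewrite [t _]uE; split=> //; apply: Csucc.
    have [h|h] := ltnP p.+2 (n + 3).
      exists (inl (Ordinal h)); right; split; first by rewrite e /t /= uE.
      by rewrite e; apply: Csucc; rewrite /= uE.
    exists (inr true); left; split=> //; split; first by rewrite /t /=; order_lia.
    by rewrite Clv lt1 //; order_lia.
  + rewrite Clv lt1 //=; case: b' => //= pn h; try order_lia.
    have [u uE] : exists u : 'I_(n + 3), nat_of_ord u = p.+1 by apply: ord; order_lia.
    by exists (inl u); left; rewrite [t (inl u)]uE; split=> //; split=> //; apply: Csucc.
  + rewrite Cvl lt1 //=; case: b => //= pn h; first by have := ltn_ord p'; order_lia.
    exists (inl (if p' == o1 then o2 else o1)); left.
    have [e|ne] := eqVneq p' o1.
      split; first by rewrite e; move/esym.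
      by split; [rewrite /t /= ?o1E ?o2E; order_lia|exact: (Cv2 false)].
    split; first by case=> e'; rewrite e' eqxx in ne.
    by split; [rewrite /t /= ?o1E ?o2E; order_lia|exact: (Cv1 false)].
  + case: b b' => [] [] //=; rewrite ?ltnn ?ltn0 //.
    by move=> _ _; exists (inl o1); left; split=> //; split; [rewrite /t /= ?o1E ?o2E; order_lia|exact: (Cv1 false)].
- move=> [p|b] [p'|b'].
  + move=> /= pp' Cpp; have pn := ltn_ord p; have pn' := ltn_ord p'.
    have [u uE] : exists u : 'I_(n + 3), nat_of_ord u = p'.-1 by apply: ord; order_lia.
    have [e|ne] := eqVneq p u; last first.
      exists (inl u); left; split; first by case=> e; rewrite e eqxx in ne.
      by rewrite [t (inl u)]uE; split; [rewrite /t /= ?o1E ?o2E; order_lia|apply: Csucc; order_lia].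
    have [h|h] := posnP p.
      exists (inr false); left; split=> //; split; first by rewrite /t /=; order_lia.
      have ep : nat_of_ord p = p'.-1 by rewrite e.
      have ep' : nat_of_ord p' = 1 by order_lia.
      by rewrite (Cvl false p') ep' /lt' (ltnW n3).
    have [u' uE'] : exists u : 'I_(n + 3), nat_of_ord u = p.-1 by apply: ord; order_lia.
    exists (inl u'); right; split; first by rewrite /t /=; order_lia.
    by apply: Csucc; order_lia.
  + rewrite Clv lt1 //=; case: b' => //= pn h; try order_lia.
    exists (inl (if p == o1 then o2 else o1)); left.
    have [e|ne] := eqVneq p o1.
      split; first by rewrite e; move/esym.
      by split; [rewrite /t /= ?o1E ?o2E; order_lia|exact: (C2v true)].
    split; first by case=> e'; rewrite e' eqxx in ne.
    by split; [rewrite /t /= ?o1E ?o2E; order_lia|exact: (C1v true)].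
  + rewrite Cvl lt1 //=; case: b => //= pn h; first by have := ltn_ord p'; order_lia.
    have [u uE] : exists u : 'I_(n + 3), nat_of_ord u = p'.-1 by apply: ord; order_lia.
    exists (inl u); left; split=> //; split; first by rewrite /t /=; order_lia.
    by apply: Csucc; order_lia.
  + case: b b' => [] [] //=; rewrite ?ltnn ?ltn0 //.
    by move=> _ _; exists (inl o1); left; split=> //; split; [rewrite /t /= ?o1E ?o2E; order_lia|exact: (C1v true)].
- by exists (inr false), (inl o1); split; [rewrite /t /= o1E|].
Qed.

End Cycle.

(** Reversal combined with the exchange of the two long arms fixes this word. *)
Definition word_133 : seq (option (nat * nat)) :=
  let a := Some (0, 0) in let b k := Some (1, k) in let d k := Some (2, k) in
  [:: b 2; b 0; a; b 1; None; b 0; d 0; None; d 1; a; d 0; d 2].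

(** The three centre gaps meet arms 2 and 1, then 1 and 0, then 0 and 2. Up to commuting letters,
    reversal combined with the exchange of arms 0 and 1 fixes the word. *)
Definition word_223 : seq (option (nat * nat)) :=
  let a k := Some (0, k) in let b k := Some (1, k) in let d k := Some (2, k) in
  [:: d 2; d 0; a 0; d 1; None; d 0; b 0; None; b 1; b 0; a 0; None; a 1; a 0; d 0;
      None; d 1; b 0; d 0; d 2].

Lemma bad_word_133 : bad_word spider_rel None word_133. Proof. by vm_compute. Qed.
Lemma bad_word_223 : bad_word spider_rel None word_223. Proof. by vm_compute. Qed.

End BadConfigurations.

(** * Connected graphs of a regular class *)

Section Component.

Variables (P : finType) (C : rel P) (Crefl : reflexive C) (Csym : symmetric C).
Hypothesis reg : regular Csym.
Variable v0 : P.

Let e : rel P := fun x y => (x != y) && C x y.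
Let comp : pred P := connect e v0.
Let goal : Prop := regular_type (@component (concurrency_graph C) v0).

Lemma edgeC x y : e x y = e y x.
Proof. by rewrite /e eq_sym Csym. Qed.

Lemma edge_irr x : e x x = false.
Proof. by rewrite /e eqxx. Qed.

Lemma CedgeE x y : C x y = (x == y) || e x y.
Proof. by rewrite /e; case: eqP => //= ->; rewrite Crefl. Qed.

Lemma comp_edge x y : comp x -> e x y -> comp y.
Proof. by move=> cx xy; apply: connect_trans cx (connect1 xy). Qed.

Lemma crossing (A : pred P) x y : comp x -> comp y -> A x -> ~~ A y ->
  exists a b, [/\ A a, comp a, ~~ A b & e a b].
Proof.
move=> cx cy; have es : connect_sym e by apply: sym_connect_sym; apply: edgeC.
have : connect e x y by apply: connect_trans cy; rewrite es.
case/connectP=> s; elim: s x cx => [|z s IHs] x cx /=; first by move=> _ -> Ay; rewrite Ay.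
case/andP=> xz zs ylast Ax nAy; have [Az|nAz] := boolP (A z).
  exact: (IHs z (comp_edge cx xz)).
by exists x, z.
Qed.

Lemma closed_or_crossing (T : finType) (h : T -> P) (x0 : T) : (forall x, comp (h x)) ->
  (forall y, comp y -> exists x, y = h x) \/
  (exists x b, [/\ comp b, e (h x) b & forall z, b <> h z]).
Proof.
move=> hc; pose A := [pred y | [exists x, y == h x]].
have [/forallP all|] := boolP [forall y, comp y ==> A y].
  by left=> y cy; have /existsP[x /eqP->] := implyP (all y) cy; exists x.
rewrite negb_forall => /existsP[y]; rewrite negb_imply => /andP[cy nAy].
have Ah x : A (h x) by apply/existsP; exists x.
have [a [b [/existsP[x /eqP ->] cx nAb ab]]] := crossing (hc x0) cy (Ah x0) nAy.
right; exists x, b; split=> //; first exact: comp_edge ab.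
by move=> z bz; move: nAb; rewrite bz Ah.
Qed.

Lemma iso_of_embedding (H : graph) (h : H -> P) (x0 : H) : injective h ->
  (forall x y, e (h x) (h y) = adj x y) -> (forall x, comp (h x)) ->
  (forall y, comp y -> exists x, y = h x) ->
  graph_iso (@component (concurrency_graph C) v0) H.
Proof.
move=> hI hA hc hs.
pose g x : @component (concurrency_graph C) v0 := Sub (h x) (hc x).
pose f (y : @component (concurrency_graph C) v0) := odflt x0 [pick x | h x == val y].
have hf y : h (f y) = val y.
  rewrite /f; case: pickP => [x /eqP //|no].
  by have [x e1] := hs _ (valP y); have := no x; rewrite e1 eqxx.
exists f.
  by exists g => x; [apply: val_inj; rewrite /= hf|apply: hI; rewrite hf].
by move=> x y; rewrite -hA !hf.
Qed.

Lemma complete_case : (forall x y, comp x -> comp y -> C x y) -> goal.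
Proof.
move=> h; left; exists #|@component (concurrency_graph C) v0|; exists enum_rank.
  by exists enum_val; [exact: enum_rankK|exact: enum_valK].
move=> x y /=; rewrite (inj_eq enum_rank_inj) -(inj_eq val_inj) /=.
by rewrite h ?andbT //; apply: valP.
Qed.

(** Let [u] outside a maximal clique be adjacent to its member [k] and not to [k'], and let [m] be a
    third member. If [m] is adjacent to [u], these four span K4 minus an edge; if not, [u] is a
    pendant at the triangle. *)
Lemma triangle_complete x y z : comp x -> e x y -> e y z -> e x z ->
  forall a b, comp a -> comp b -> C a b.
Proof.
move=> cx xy yz xz.
pose clique (A : {set P}) := [forall a in A, forall b in A, C a b].
have cliqueP (A : {set P}) : reflect {in A &, forall a b, C a b} (clique A).
  apply: (iffP forall_inP) => [h a b aA bA|h a aA]; first by have /forall_inP := h a aA; apply.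
  by apply/forall_inP => b; apply: h.
have c0 : clique [set x; y; z].
  apply/cliqueP => a b; rewrite !inE -!orbA => /or3P[]/eqP-> /or3P[]/eqP->;
  by rewrite CedgeE ?eqxx // ?xy ?yz ?xz ?[e y x]edgeC ?[e z x]edgeC ?[e z y]edgeC ?xy ?yz ?xz ?orbT.
have [K /maxsetP[/cliqueP cK Kmax] sK] := maxset_exists c0.
have [xK yK zK] : [/\ x \in K, y \in K & z \in K].
  by split; apply: (subsetP sK); rewrite !inE eqxx ?orbT.
suff all a : comp a -> a \in K by move=> a b /all aK /all bK; apply: cK.
move=> ca; apply: contraT => naK; exfalso.
have [k [u [kK ck nuK ku]]] := crossing (A := mem K) cx ca xK naK.
have [k' [k'K nk'u]] : exists k', k' \in K /\ C k' u = false.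
  have [/existsP[k' /andP[h1 /negbTE h2]]|/existsPn no] := boolP [exists k', (k' \in K) && ~~ C k' u].
    by exists k'.
  have adjK b : b \in K -> C b u by move=> bK; have := no b; rewrite bK negbK.
  have := Kmax (u |: K); rewrite subsetUr => H; have eq : u |: K = K.
    apply: H => //; apply/cliqueP => a1 a2; rewrite !inE => /predU1P[->|aK] /predU1P[->|bK] //.
    - by rewrite Csym adjK.
    - exact: adjK.
    - exact: cK.
  by move: nuK; rewrite /= -eq !inE eqxx.
have Cku : C k u by rewrite CedgeE ku orbT.
have nkk' : k <> k' by move=> h; rewrite h nk'u in Cku.
have [m [mK mk mk']] : exists m, [/\ m \in K, m <> k & m <> k'].
  have nxy : x <> y by move=> h; rewrite h edge_irr in xy.
  have nxz : x <> z by move=> h; rewrite h edge_irr in xz.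
  have nyz : y <> z by move=> h; rewrite h edge_irr in yz.
  have [/existsP[m /and3P[mK /eqP mk /eqP mk']]|/existsPn no] :=
      boolP [exists m, [&& m \in K, m != k & m != k']]; first by exists m.
  have kk' b : b \in K -> b = k \/ b = k'.
    move=> bK; have := no b; rewrite bK /= negb_and !negbK => /orP[]/eqP; [by left|by right].
  exfalso; case: (kk' x xK) => ex; case: (kk' y yK) => ey; case: (kk' z zK) => ez;
    by [apply: nxy; rewrite ex ey | apply: nxz; rewrite ex ez | apply: nyz; rewrite ey ez].
have [Cmu|nCmu] := boolP (C m u).
  by apply: (diamond_absurd Crefl reg (cK _ _ kK k'K) (cK _ _ kK mK) Cku (cK _ _ mK k'K) Cmu nk'u) => /esym.
(* [k] goes to index 1, where [pendant_cycle_absurd] attaches the pendant. *)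
pose c i := nth k [:: k'; k; m] i.
have cCK i : i < 3 -> c i \in K by case: i => [|[|[|]]].
apply: (@pendant_cycle_absurd _ _ Crefl _ reg 3 c isT _ _ u).
- by move=> i j i3 j3; rewrite cK ?cCK //; case: i i3 => [|[|[|]]] // _; case: j j3 => [|[|[|]]].
- by case=> [|[|[|i]]] // [|[|[|j]]] // _ _; rewrite /c /= => h; exfalso;
     first [exact: (nkk' h)|exact: (nkk' (esym h))|exact: (mk h)|exact: (mk (esym h))
           |exact: (mk' h)|exact: (mk' (esym h))].
- by case=> [|[|[|i]]] // _; rewrite /c /= Csym // (negbTE nCmu).
- move=> i i3 h; move: nuK; rewrite h; apply/negP; rewrite negbK; exact: cCK.
Qed.

Hypothesis tf : forall x y z, comp x -> e x y -> e y z -> e x z -> False.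

Definition induced_cycle n c :=
  [/\ forall i, i < n -> comp (c i), forall i j, i < n -> j < n -> c i = c j -> i = j
    & forall i j, i < n -> j < n -> e (c i) (c j) = cycle_adj n i j].

Lemma induced_cycle_C n c : induced_cycle n c ->
  forall i j, i < n -> j < n -> C (c i) (c j) = (i == j) || cycle_adj n i j.
Proof.
case=> _ cI cE i j h1 h2; rewrite CedgeE cE //; congr orb.
by apply/eqP/eqP => [/cI->|->].
Qed.

Lemma induced_cycle_odd n c : 2 < n -> induced_cycle n c -> odd n.
Proof.
move=> n3 ic; apply: (regular_cycle_odd Crefl reg n3 (induced_cycle_C ic)).
by case: ic.
Qed.

Lemma induced_cycle_pendant n c v : 2 < n -> induced_cycle n c ->
  (forall j, j < n -> e v (c j) = (j == 1)) -> (forall j, j < n -> v <> c j) -> False.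
Proof.
move=> n3 ic ev vc; have [_ cI _] := ic.
apply: (pendant_cycle_absurd Crefl reg n3 (induced_cycle_C ic) cI (v := v)) => // j jn.
by rewrite CedgeE ev //; case: eqP => // /vc; rewrite jn => /(_ isT).
Qed.

Lemma four_cycle x y z t : comp x -> e x y -> e y z -> e z t -> e t x ->
  x <> z -> y <> t -> False.
Proof.
move=> cx xy yz zt tx nxz nyt.
have cy := comp_edge cx xy; have cz := comp_edge cy yz; have ct := comp_edge cz zt.
have xz : e x z = false by apply/negP => /(tf cx xy yz).
have yt : e y t = false by apply/negP => /(tf cy yz zt).
have ne a b : e a b -> a <> b by move=> ab h; rewrite h edge_irr in ab.
suff : odd 4 by [].
apply: (@induced_cycle_odd 4 (fun k => nth x [:: x; y; z; t] k)) => //; split.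
- by case=> [|[|[|[|k]]]].
- case=> [|[|[|[|k]]]] // [|[|[|[|k']]]] // _ _ /= h; exfalso;
  first [exact: (ne _ _ xy h)|exact: (ne _ _ xy (esym h))|exact: (ne _ _ yz h)|exact: (ne _ _ yz (esym h))
    |exact: (ne _ _ zt h)|exact: (ne _ _ zt (esym h))|exact: (ne _ _ tx h)|exact: (ne _ _ tx (esym h))
    |exact: (nxz h)|exact: (nxz (esym h))|exact: (nyt h)|exact: (nyt (esym h))].
- case=> [|[|[|[|k]]]] // [|[|[|[|k']]]] // _ _ /=; rewrite ?edge_irr //;
  first [exact: xy|exact: yz|exact: zt|exact: tx|exact: xz|exact: yt
    |by rewrite edgeC ?xy|by rewrite edgeC ?yz|by rewrite edgeC ?zt|by rewrite edgeC ?tx|by rewrite edgeC ?xz|by rewrite edgeC ?yt].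
Qed.

Definition shift_index n i k := if k + i < n then k + i else k + i - n.

Lemma shift_index_lt n i k : i < n -> k < n -> shift_index n i k < n.
Proof. by rewrite /shift_index => ? ?; case: ifP; order_lia. Qed.

Lemma shift_cycle n c i : 2 < n -> i < n -> induced_cycle n c ->
  induced_cycle n (fun k => c (shift_index n i k)).
Proof.
move=> n3 i_n [cc cI cE]; split.
- by move=> k kn; apply: cc; apply: shift_index_lt.
- move=> k k' kn kn' /cI; rewrite !shift_index_lt // => /(_ isT isT); rewrite /shift_index.
  by case: ifP => ?; case: ifP => ?; order_lia.
- move=> k k' kn kn'; rewrite cE ?shift_index_lt // /shift_index /cycle_adj.
  by case: ifP => ?; case: ifP => ?; order_lia.
Qed.

(** A vertex [u] outside, adjacent to [c 0], is a pendant unless it has a further neighbour on the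
    cycle. With the first such [c j] it closes an induced cycle, at which the last vertex of the
    original cycle is a pendant, except for [j = n.-2], when a 4-cycle appears. *)
Lemma cycle_case n c : 3 < n -> induced_cycle n c -> goal.
Proof.
move=> n3 ic; have n2 : 2 < n by order_lia.
have on := induced_cycle_odd n2 ic.
have n0 : 0 < n by order_lia.
have [cc cI cE] := ic.
have [i|full|] := @closed_or_crossing _ (fun i : 'I_n => c i) (Ordinal n0); first exact: cc.
  right; right; right; right; left; exists n; first by rewrite on andbT.
  apply: (iso_of_embedding (H := cycle_graph n) (h := fun i : 'I_n => c i) (Ordinal n0)) => //.
  - by move=> i j /cI h; apply: val_inj; apply: h.
  - move=> i j; rewrite cE // /adj /= !cycle_adjE /cycle_adj.
    by move: (ltn_ord i) (ltn_ord j) => ? ?; order_lia.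
  - by move=> i; apply: cc.
move=> [i [u [cu eu nu]]]; exfalso.
have {}nu k : k < n -> u <> c k by move=> kn; apply: (nu (Ordinal kn)).
wlog i0 : c ic cc cI cE i eu nu / i = 0 :> nat.
  move=> W; apply: (W (fun k => c (shift_index n i k)) (shift_cycle n2 (ltn_ord i) ic) _ _ _ (Ordinal n0)) => //=.
  - by have [] := shift_cycle n2 (ltn_ord i) ic.
  - by have [] := shift_cycle n2 (ltn_ord i) ic.
  - by have [] := shift_cycle n2 (ltn_ord i) ic.
  - by rewrite /shift_index add0n ltn_ord.
  - by move=> k kn; apply: nu; apply: shift_index_lt.
rewrite i0 in eu; rewrite edgeC in eu.
have nadj1 : ~~ e u (c 1).
  by apply/negP => h; apply: (tf cu eu _ h); rewrite cE //; order_lia.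
have nadjn : ~~ e u (c n.-1).
  apply/negP => h; apply: (tf cu eu _ h); rewrite cE; [|order_lia|order_lia].
  by rewrite /cycle_adj; order_lia.
have [/existsP[/= j0 /andP[j00 ej0]]|/existsPn no] := boolP [exists j : 'I_n, (0 < j) && e u (c j)]; last first.
  (* Rotating by n - 1 moves [c 0] to index 1, the place of the pendant. *)
  have nn : n.-1 < n by order_lia.
  apply: (induced_cycle_pendant n2 (shift_cycle n2 nn ic) (v := u)).
    move=> j jn; rewrite /shift_index; case: ifP => h.
      have j0 : j = 0 by order_lia.
      by rewrite j0 add0n (negbTE nadjn).
    have [->|nj1] := eqVneq j 1; first by rewrite (_ : 1 + n.-1 - n = 0) ?eu //; order_lia.
    have jn' : j + n.-1 - n < n by order_lia.
    have := no (Ordinal jn'); rewrite /= => /negbTE; have -> /= : 0 < j + n.-1 - n by order_lia.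
    by [].
  by move=> j jn; apply: nu; apply: shift_index_lt.
have [j [ej j_gt0 jmin]] := ex_first_after (Q := fun j => e u (c j)) ej0 j00.
have jn : j < n.
  apply: leq_ltn_trans (ltn_ord j0); rewrite leqNgt; apply/negP => /(jmin _ j00).
  by rewrite ej0.
have j1 : j <> 1 by move=> h; rewrite -h ej in nadj1.
have jn1 : j <> n.-1 by move=> h; rewrite -h ej in nadjn.
have eu' k : k <= j -> e u (c k) = (k == 0) || (k == j).
  move=> kj; have [->|k0] := posnP k; first by rewrite eu.
  have [->|kj'] := eqVneq k j; first by rewrite ej orbT.
  by rewrite (negbTE (jmin _ k0 _)); order_lia.
pose d k := if k is k'.+1 then c k' else u.
have icd : induced_cycle j.+2 d.
  split.
  - by case=> [|k] //= kj; apply: cc; order_lia.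
  - case=> [|k] [|k'] //= h1 h2 h.
    + by have := nu k' ltac:(order_lia) h.
    + by have := nu k ltac:(order_lia) (esym h).
    + by congr S; apply: cI h; order_lia.
  - case=> [|k] [|k'] //= h1 h2.
    + by rewrite edge_irr /cycle_adj; order_lia.
    + by rewrite eu' /cycle_adj; order_lia.
    + by rewrite edgeC eu' /cycle_adj; order_lia.
    + by rewrite cE /cycle_adj; order_lia.
have oj : odd j.+2 by apply: induced_cycle_odd icd; order_lia.
have [jn2|jn2] := eqVneq j n.-2.
  clear icd oj eu' jmin; subst j.
  have l2 : n.-2 < n by order_lia.
  have l1 : n.-1 < n by order_lia.
  have e21 : cycle_adj n n.-2 n.-1 by rewrite /cycle_adj; order_lia.
  have e10 : cycle_adj n n.-1 0 by rewrite /cycle_adj; order_lia.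
  have n1 : n.-1 <> 0 by order_lia.
  have n20 : n.-2 <> 0 by order_lia.
  apply: (four_cycle (x := u) (y := c n.-2) (z := c n.-1) (t := c 0)) => //.
  - by rewrite cE.
  - by rewrite cE.
  - by rewrite edgeC.
  - exact: nu.
  - by move=> /cI h; apply: n20; apply: h.
apply: (induced_cycle_pendant _ icd (v := c n.-1)); first order_lia.
  case=> [|k] kj /=; first by rewrite edgeC (negbTE nadjn).
  by rewrite cE /cycle_adj; order_lia.
case=> [|k] kj /= h; first by apply: (nu n.-1); [order_lia|].
by have := cI _ _ _ _ h; order_lia.
Qed.

Definition induced_path m p :=
  [/\ forall i, i < m -> comp (p i), forall i j, i < m -> j < m -> p i = p j -> i = j
    & forall i j, i < m -> j < m -> e (p i) (p j) = path_adj i j].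

Lemma induced_path_le m p : induced_path m p -> m <= #|P|.
Proof.
case=> _ pI _; rewrite -[m]card_ord.
apply: (leq_card (fun i : 'I_m => p i)) => i j /pI h; apply: val_inj; exact: h.
Qed.

Lemma induced_path_rev m p : induced_path m p -> induced_path m (fun k => p (m.-1 - k)).
Proof.
case=> pc pI pE; split.
- by move=> i im; apply: pc; order_lia.
- by move=> i j im jm /pI; order_lia.
- by move=> i j im jm; rewrite pE /path_adj; order_lia.
Qed.

Lemma induced_path_cons m p u : comp u -> induced_path m p ->
  (forall j, j < m -> u <> p j) -> (forall j, j < m -> e u (p j) = (j == 0)) ->
  induced_path m.+1 (fun k => if k is k'.+1 then p k' else u).
Proof.
move=> cu [pc pI pE] nu eu; split.
- by case=> [|i] //= im; apply: pc.
- case=> [|i] [|j] //= im jm h; first by case: (nu _ jm h).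
    by case: (nu _ im (esym h)).
  by congr S; apply: pI h.
- case=> [|i] [|j] //= im jm; first by rewrite edge_irr.
  + by rewrite eu // /path_adj; order_lia.
  + by rewrite edgeC eu // /path_adj; order_lia.
  + by rewrite pE.
Qed.

Lemma induced_path_sub m p i k : induced_path m p -> i + k <= m ->
  induced_path k (fun j => p (i + j)).
Proof.
case=> pc pI pE ik; split.
- by move=> j jk; apply: pc; order_lia.
- by move=> j j' jk jk' /pI; order_lia.
- by move=> j j' jk jk'; rewrite pE /path_adj; order_lia.
Qed.

(** * Neighbours of a longest induced path *)

Section LongestPath.

Variables (m : nat) (p : nat -> P).
Hypothesis ip : induced_path m p.
Hypothesis m0 : 0 < m.
(** In place of maximality of the path: a longer one settles the goal. *)
Hypothesis IH : forall m' p', m < m' -> induced_path m' p' -> goal.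

Let pc := let: And3 h _ _ := ip in h.
Let pI := let: And3 _ h _ := ip in h.
Let pE := let: And3 _ _ h := ip in h.

(* A chord of the path from outside closes an induced cycle. *)
Lemma path_chord u i j : comp u -> (forall k, k < m -> u <> p k) ->
  i < j -> j < m -> e u (p i) -> e u (p j) -> goal.
Proof.
move=> cu nu ij0 jm0 ei ej0.
have [j' [ej ij jmin]] := ex_first_after (Q := fun k => e u (p k)) ej0 ij0.
have jm : j' < m.
  by apply: leq_ltn_trans jm0; rewrite leqNgt; apply/negP => /(jmin _ ij0); rewrite ej0.
have nij : j' <> i.+1.
  move=> h; apply: (tf cu ei _ ej); rewrite pE ?h /path_adj ?eqxx //; order_lia.
pose d k := if k is k'.+1 then p (i + k') else u.
have eu k : k <= j' - i -> e u (p (i + k)) = (k == 0) || (k == j' - i).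
  move=> kj; have [->|k0] := posnP k; first by rewrite addn0 ei.
  have [->|kj'] := eqVneq k (j' - i); first by rewrite subnKC ?ej ?orbT // ltnW.
  by rewrite (negbTE (jmin _ _ _)); order_lia.
apply: (@cycle_case (j' - i).+2 d); first order_lia.
split.
- by case=> [|k] //= kj; apply: pc; order_lia.
- case=> [|k] [|k'] //= h1 h2 h.
  + by have := nu _ _ h; order_lia.
  + by have := nu _ _ (esym h); order_lia.
  + by have := pI _ _ h; order_lia.
- case=> [|k] [|k'] //= h1 h2.
  + by rewrite edge_irr /cycle_adj; order_lia.
  + by rewrite eu /cycle_adj; order_lia.
  + by rewrite edgeC eu /cycle_adj; order_lia.
  + by rewrite pE /cycle_adj /path_adj; order_lia.
Qed.

(** With two neighbours on the path, [u] closes a cycle; with an end as its only neighbour, it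
    prolongs the path. *)
Lemma path_attach u k : (forall k, k < m -> u <> p k) ->
  k < m -> e (p k) u -> goal \/
  exists i, [/\ 0 < i, i.+1 < m & forall j, j < m -> e u (p j) = (j == i)].
Proof.
move=> nu km ek; have cu : comp u := comp_edge (pc km) ek.
rewrite edgeC in ek.
have [/existsP[/= j /andP[njk ej]]|/existsPn no] := boolP [exists j : 'I_m, (j != k :> nat) && e u (p j)].
  left; have [h|h] := ltnP j k; first exact: (path_chord cu nu h km ej ek).
  by apply: (path_chord cu nu (i := k) (j := j)) => //; order_lia.
have eu j : j < m -> e u (p j) = (j == k).
  move=> jm; have [->//|njk] := eqVneq j k.
  by have := no (Ordinal jm); rewrite /= njk => /negbTE.
have [k0|k0] := posnP k.
  left; apply: (IH (m' := m.+1)) (induced_path_cons cu ip nu _) => // j jm.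
  by rewrite eu // k0.
have [km1|km1] := ltnP k.+1 m; first by right; exists k.
left; apply: (IH (m' := m.+1)) (induced_path_cons cu (induced_path_rev ip) _ _) => // j jm.
  by apply: nu; order_lia.
by rewrite eu; order_lia.
Qed.

(** If [u] and [w] are adjacent, they close a triangle or an induced cycle with the path from [p i]
    to [p j]. If not, they are leaves of an affine D whose other leaves are [p i.-1] and
    [p j.+1]. *)
Lemma two_attached u w i j : (forall k, k < m -> u <> p k) -> (forall k, k < m -> w <> p k) ->
  0 < i -> j.+1 < m -> i <= j -> u <> w ->
  (forall k, k < m -> e u (p k) = (k == i)) -> (forall k, k < m -> e w (p k) = (k == j)) -> goal.
Proof.
move=> nu nw i0 jm ij uw eu ew.
have cu : comp u by apply: (comp_edge (pc (i := i) _)); rewrite 1?edgeC ?eu //; order_lia.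
have cw : comp w by apply: (comp_edge (pc (i := j) _)); rewrite 1?edgeC ?ew //; order_lia.
have [euw|neuw] := boolP (e u w).
  pose d k := if k is k'.+1 then (if k' <= j - i then p (i + k') else w) else u.
  have [eij|nij] := eqVneq i j.
    by exfalso; apply: (tf cu euw (y := w) (z := p i)); rewrite ?eu ?ew ?eij; order_lia.
  apply: (@cycle_case (j - i).+3 d); first order_lia.
  split.
  - by case=> [|k] //= kj; case: ifP => // ?; apply: pc; order_lia.
  - case=> [|k] [|k'] //= h1 h2; repeat case: ifP => ?.
    + by move=> /nu; order_lia.
    + by [].
    + by move=> /esym/nu; order_lia.
    + by move=> /esym.
    + by move=> /pI; order_lia.
    + by move=> /esym/nw; order_lia.
    + by move=> /nw; order_lia.
    + by order_lia.
  - case=> [|k] [|k'] //= h1 h2; repeat case: ifP => ?.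
    + by rewrite edge_irr /cycle_adj; order_lia.
    + by rewrite eu /cycle_adj; order_lia.
    + by rewrite euw /cycle_adj; order_lia.
    + by rewrite edgeC eu /cycle_adj; order_lia.
    + by rewrite edgeC euw /cycle_adj; order_lia.
    + by rewrite pE /cycle_adj /path_adj; order_lia.
    + by rewrite edgeC ew /cycle_adj; order_lia.
    + by rewrite ew /cycle_adj; order_lia.
    + by rewrite edge_irr /cycle_adj; order_lia.
exfalso; pose q (x : bool * bool) :=
  match x with (false, true) => u | (false, false) => p i.-1
             | (true, true) => w | (true, false) => p j.+1 end.
have CpE a b : a < m -> b < m -> C (p a) (p b) = (a == b) || path_adj a b.
  by move=> am bm; rewrite CedgeE pE //; congr orb; apply/eqP/eqP => [/pI->|->].
have CuE a : a < m -> C u (p a) = (a == i).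
  by move=> am; rewrite CedgeE eu //; case: eqP => // /nu; rewrite am => /(_ isT).
have CwE a : a < m -> C w (p a) = (a == j).
  by move=> am; rewrite CedgeE ew //; case: eqP => // /nw; rewrite am => /(_ isT).
have Cuw : C u w = false by rewrite CedgeE (negbTE neuw); case: eqP.
apply: (@Dtilde_absurd _ _ Crefl _ reg (j - i).+1 (fun k => p (i + k)) q).
- by [].
- by move=> a b ha hb; rewrite CpE /path_adj; order_lia.
- by move=> a b ha hb /pI; order_lia.
- case=> [[] []] [[] []] // _; rewrite /q ?Cuw ?[C w u]Csym ?Cuw //;
    rewrite ?CuE ?CwE ?[C _ u]Csym ?[C _ w]Csym ?CuE ?CwE ?CpE /path_adj; order_lia.
- by case=> [[] []] k kj /=; rewrite ?CuE ?CwE ?CpE /path_adj; order_lia.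
- by case=> [[] []] k kj /=; [apply: nw|move/pI|apply: nu|move/pI]; order_lia.
Qed.

Section Branch.

Variables (i : nat) (u : P).
Hypothesis nu : forall k, k < m -> u <> p k.
Hypothesis eu : forall j, j < m -> e u (p j) = (j == i).
(** The leg towards [p 0], with [i] vertices, is the shorter one or equal to the other, which has
    [m.-1 - i]. *)
Hypotheses (i0 : 0 < i) (im : i + i < m).

Lemma branch_comp : comp u.
Proof. by apply: (comp_edge (pc (i := i) _)); rewrite 1?edgeC ?eu //; order_lia. Qed.

Lemma other_attached w k : w <> u -> (forall k, k < m -> w <> p k) -> k < m -> e (p k) w -> goal.
Proof.
move=> wu nw km ek; case: (path_attach nw km ek) => // -[j [j0 jm ew]].
have [ij|ji] := leqP i j.
  by apply: (two_attached nu nw i0 jm ij) => // /esym.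
by apply: (two_attached nw nu j0 _ (ltnW ji)) => //; order_lia.
Qed.

(* The spider with legs (u, w), (p (i-1), ..., p 0) and (p (i+1), ..., p (m-1)). *)
Definition leg_vertex (w : P) (x : option (nat * nat)) : P :=
  match x with
  | None => p i
  | Some (0, 0) => u
  | Some (0, _) => w
  | Some (1, k) => p (i.-1 - k)
  | Some (_, k) => p (i.+1 + k)
  end.

Definition leg_valid (a b c : nat) (x : option (nat * nat)) : bool :=
  match x with
  | None => true
  | Some (0, k) => k < a
  | Some (1, k) => k < b
  | Some (2, k) => k < c
  | _ => false
  end.

Lemma leg_embedding w a : a <= 2 ->
  (a = 2 -> [/\ e u w, w <> u, forall k, k < m -> w <> p k & forall k, k < m -> e w (p k) = false]) ->
  [/\ {in leg_valid a i (m.-1 - i) &, forall x y, e (leg_vertex w x) (leg_vertex w y) = spider_adj x y}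
    & {in leg_valid a i (m.-1 - i) &, injective (leg_vertex w)}].
Proof.
move=> a2 hw.
have wP : 1 < a -> [/\ e u w, w <> u, forall k, k < m -> w <> p k & forall k, k < m -> e w (p k) = false].
  by move=> ha; apply: hw; order_lia.
have pu k : k < m -> e (p k) u = (k == i) by move=> h; rewrite edgeC eu.
split.
- move=> [[[|[|[|x]]] k]|] [[[|[|[|y]]] l]|]; rewrite /in_mem /= // => h1 h2;
  try (by rewrite ?pE ?eu ?pu /path_adj; order_lia); try (by rewrite edge_irr).
  + case: k l h1 h2 => [|[|k]] [|[|l]] h1 h2; try order_lia; rewrite ?edge_irr //;
      have [h _ _ _] := wP ltac:(order_lia); by [rewrite h|rewrite edgeC h].
  + case: k h1 => [|k] h1; first by rewrite eu /path_adj; order_lia.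
    by have [_ _ _ ->] := wP ltac:(order_lia); order_lia.
  + case: k h1 => [|k] h1; first by rewrite eu /path_adj; order_lia.
    by have [_ _ _ ->] := wP ltac:(order_lia); order_lia.
  + case: k h1 => [|k] h1; first by rewrite eu ?eqxx //; order_lia.
    by have [_ _ _ ->] := wP ltac:(order_lia); order_lia.
  + case: l h2 => [|l] h2; first by rewrite pu /path_adj; order_lia.
    by rewrite edgeC; have [_ _ _ ->] := wP ltac:(order_lia); order_lia.
  + case: l h2 => [|l] h2; first by rewrite pu /path_adj; order_lia.
    by rewrite edgeC; have [_ _ _ ->] := wP ltac:(order_lia); order_lia.
  + case: l h2 => [|l] h2; first by rewrite pu ?eqxx //; order_lia.
    by rewrite edgeC; have [_ _ _ ->] := wP ltac:(order_lia); order_lia.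
- have up k l : l < m -> k < a -> leg_vertex w (Some (0, k)) <> p l.
    case: k => [|k] lm ka /=; first exact: nu.
    by have [_ _ h _] := wP ltac:(order_lia); apply: h.
  move=> [[[|[|[|x]]] k]|] [[[|[|[|y]]] l]|]; rewrite /in_mem // => h1 h2;
    try (by rewrite /= => /pI h; congr Some; congr pair; move: h1 h2; rewrite /=; order_lia);
    try (by rewrite /= => /pI; move: h1 h2; rewrite /=; order_lia).
  + case: k l h1 h2 => [|[|k]] [|[|l]] /= h1 h2 //; try order_lia.
      by have [_ h _ _] := wP ltac:(order_lia) => /esym.
    by have [_ h _ _] := wP ltac:(order_lia).
  + by move=> h; case: (@up k (i.-1 - l) _ _ h); move: h1 h2 => /=; order_lia.
  + by move=> h; case: (@up k (i.+1 + l) _ _ h); move: h1 h2 => /=; order_lia.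
  + by move=> h; case: (@up k i _ _ h); move: h1 h2 => /=; order_lia.
  + by move=> h; case: (@up l (i.-1 - k) _ _ (esym h)); move: h1 h2 => /=; order_lia.
  + by move=> h; case: (@up l (i.+1 + k) _ _ (esym h)); move: h1 h2 => /=; order_lia.
  + by move=> h; case: (@up l i _ _ (esym h)); move: h1 h2 => /=; order_lia.
Qed.

Lemma leg_word_absurd w a b c (s : seq (option (nat * nat))) : a <= 2 -> b <= i -> c <= m.-1 - i ->
  (a = 2 -> [/\ e u w, w <> u, forall k, k < m -> w <> p k & forall k, k < m -> e w (p k) = false]) ->
  all (leg_valid a b c) s -> ~~ bad_word spider_rel None s.
Proof.
move=> a2 bi ci hw /allP vs; have [hE hI] := leg_embedding a2 hw.
have vs' x : x \in s -> x \in leg_valid a i (m.-1 - i).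
  move/vs; rewrite /in_mem /=; case: x => [[[|[|[|x]]] k]|] //=; order_lia.
apply: (@bad_word_absurd _ _ Crefl _ reg _ _ None s (leg_vertex w)); last first.
  by move=> x y /vs' vx /vs' vy; apply: hI.
move=> x y /vs' vx /vs' vy; rewrite CedgeE hE // /spider_rel; congr orb.
by apply/eqP/eqP => [/hI->|->].
Qed.

Lemma leg_star w a : 0 < a <= 2 -> (a = 2 -> comp w) ->
  (a = 2 -> [/\ e u w, w <> u, forall k, k < m -> w <> p k & forall k, k < m -> e w (p k) = false]) ->
  graph_iso (@component (concurrency_graph C) v0) (star_graph a i (m.-1 - i)) \/
  exists z, [/\ comp z, z <> u /\ (a = 2 -> z <> w), forall k, k < m -> z <> p k &
    [\/ exists k, k < m /\ e (p k) z, e u z | a = 2 /\ e w z]].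
Proof.
move=> /andP[a0 a2] cw hw; have [hE hI] := leg_embedding a2 hw.
pose h (x : star_graph a i (m.-1 - i)) := leg_vertex w (star_node x).
have valid (x : star_graph a i (m.-1 - i)) : star_node x \in leg_valid a i (m.-1 - i).
  by case: x => [[[x|x]|x]|]; rewrite /in_mem /=.
have hc x : comp (h x).
  case: x => [[[[x xa]|[x xi]]|[x xm]]|] //=; rewrite /h /=; try (by apply: pc; order_lia).
  by case: x xa => [|x] xa; [exact: branch_comp|apply: cw; order_lia].
case: (closed_or_crossing (h := h) None hc) => [full|[x [z [cz xz nz]]]].
  left; apply: (iso_of_embedding (h := h) None) => //.
    by move=> x y xy; apply: star_node_inj; apply: hI.
  by move=> x y; rewrite /h hE // star_node_adj.
right; exists z; split=> //.
- split; first exact: (nz (Some (inl (inl (Ordinal a0))))).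
  move=> ha; have a1 : 1 < a by order_lia.
  exact: (nz (Some (inl (inl (Ordinal a1))))).
- move=> k km; have [ki|ik|->] := ltngtP k i.
  + have hk : i.-1 - k < i by order_lia.
    have := nz (Some (inl (inr (Ordinal hk)))); rewrite /h /=.
    by have -> : i.-1 - (i.-1 - k) = k by order_lia.
  + have hk : k - i.+1 < m.-1 - i by order_lia.
    have := nz (Some (inr (Ordinal hk))); rewrite /h /=.
    by rewrite subnKC.
  + exact: (nz None).
- case: x xz => [[[[x xa]|[x xi]]|[x xm]]|]; rewrite /h /= => xz.
  + case: x xa xz => [|x] xa xz; first by constructor 2.
    by constructor 3; split=> //; order_lia.
  + by constructor 1; exists (i.-1 - x); split=> //; order_lia.
  + by constructor 1; exists (i.+1 + x); split=> //; order_lia.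
  + by constructor 1; exists i; split=> //; order_lia.
Qed.

(** With [u] as a leg of its own, [i = 1] is type D, [i = 2] type E, and more contains Γ(1,3,3). A
    further vertex [w] off the path hangs on [u]; a longer right leg would then contain Γ(2,2,3),
    which leaves affine E6. One more vertex gives an affine D or a longer path. *)
Lemma branch_case : goal.
Proof.
have cu := branch_comp.
have i_m : i < m by order_lia.
have l1 : i.-1 < m by order_lia.
have l2 : i.+1 < m by order_lia.
have ni1 : i.-1 != i by order_lia.
have ni2 : i.+1 != i by order_lia.
have ni3 : (i.-1 == i.+1) || path_adj i.-1 i.+1 = false by rewrite /path_adj; order_lia.
have ni4 : path_adj i.-1 i by rewrite /path_adj; order_lia.
have ni5 : path_adj i.+1 i by rewrite /path_adj; order_lia.
have [||iso|[w [cw [nwu _] nw ew]]] := @leg_star u 1 isT; [by []|by []| |].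
  have [i1|i_n1] := eqVneq i 1.
    right; right; left; exists (m.-1 - i + 3); first order_lia.
    by move: iso; rewrite /type_D addnK i1.
  have [i2|i_n2] := eqVneq i 2.
    right; right; right; left; exists (m.-1 - i + 4); first order_lia.
    by move: iso; rewrite /type_E addnK i2.
  have := @leg_word_absurd u 1 3 3 word_133; rewrite bad_word_133 => H.
  by exfalso; suff : ~~ true by []; apply: H => //; order_lia.
have [/existsP[/= k ek]|/existsPn npw] := boolP [exists k : 'I_m, e (p k) w].
  exact: (other_attached nwu nw (ltn_ord k) ek).
have ewp k : k < m -> e w (p k) = false.
  by move=> km; have := npw (Ordinal km); rewrite edgeC => /negbTE.
have euw : e u w.
  by case: ew => [[k [km]]|//|[//]]; rewrite edgeC ewp.
have ipi : induced_path (m - i) (fun j => p (i + j)).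
  by apply: (induced_path_sub ip); order_lia.
have ipu : induced_path (m - i).+1 (fun k => if k is k'.+1 then p (i + k') else u).
  apply: (induced_path_cons cu ipi) => j jm; first by apply: nu; order_lia.
  by rewrite eu; order_lia.
have ipw : induced_path (m - i).+2
    (fun k => if k is k'.+1 then (if k' is k''.+1 then p (i + k'') else u) else w).
  apply: (induced_path_cons cw ipu) => -[|j] jm //=.
  - by apply: nw; order_lia.
  - by rewrite edgeC euw.
  - by rewrite ewp; order_lia.
(* The path [w], [u], [p i], ..., [p m.-1] has m - i + 2 vertices, more than m if [i] is at most
   1. *)
have [i1|i1] := leqP i 1; first by apply: IH ipw; order_lia.
have hw : 2 = 2 -> [/\ e u w, w <> u, forall k, k < m -> w <> p k & forall k, k < m -> e w (p k) = false].
  by split.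
have [m5|m5] := leqP 3 (m.-1 - i).
  have := @leg_word_absurd w 2 2 3 word_223; rewrite bad_word_223 => H.
  by exfalso; suff : ~~ true by []; apply: H.
have i2 : i = 2 by order_lia.
have mi2 : m.-1 - i = 2 by order_lia.
have [iso|[z [cz [nzu nzw] nz ez]]] := @leg_star w 2 isT (fun _ => cw) hw.
  do 5 right; by rewrite /type_affE6; move: iso; rewrite mi2 i2.
have {}nzw := nzw erefl.
have [/existsP[/= k ek]|/existsPn npz] := boolP [exists k : 'I_m, e (p k) z].
  exact: (other_attached nzu nz (ltn_ord k) ek).
have ezp k : k < m -> e z (p k) = false.
  by move=> km; have := npz (Ordinal km); rewrite edgeC => /negbTE.
have [euz|neuz] := boolP (e u z).
  exfalso; have [ewz|newz] := boolP (e w z); first exact: (tf cu euw ewz euz).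
  (* An affine D around the edge from [u] to [p i], with leaves [w] and [z] at one end, [p i.-1] and
     [p i.+1] at the other. *)
  pose c k := if k == 0 then u else p i.
  pose q (x : bool * bool) :=
    match x with (false, true) => w | (false, false) => z
               | (true, true) => p i.-1 | (true, false) => p i.+1 end.
  have CpE a b : a < m -> b < m -> C (p a) (p b) = (a == b) || path_adj a b.
    by move=> am bm; rewrite CedgeE pE //; congr orb; apply/eqP/eqP => [/pI->|->].
  have Cup a : a < m -> C u (p a) = (a == i).
    by move=> am; rewrite CedgeE eu //; case: eqP => // /nu; rewrite am => /(_ isT).
  have Cwp a : a < m -> C w (p a) = false.
    by move=> am; rewrite CedgeE ewp // orbF; apply/eqP => /nw; rewrite am => /(_ isT).
  have Czp a : a < m -> C z (p a) = false.
    by move=> am; rewrite CedgeE ezp // orbF; apply/eqP => /nz; rewrite am => /(_ isT).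
  have Cwz : C w z = false by rewrite CedgeE (negbTE newz) orbF; apply/eqP => /esym.
  have Cwu : C w u by rewrite CedgeE edgeC euw orbT.
  have Czu : C z u by rewrite CedgeE edgeC euz orbT.
  have Czw : C z w = false by rewrite Csym.
  have Cpw a : a < m -> C (p a) w = false by move=> am; rewrite Csym Cwp.
  have Cpz a : a < m -> C (p a) z = false by move=> am; rewrite Csym Czp.
  have g1 : C (p i.-1) (p i.+1) = false by rewrite CpE.
  have g2 : C (p i.+1) (p i.-1) = false by rewrite Csym.
  have f1 : C (p i.-1) u = false by rewrite Csym Cup // (negbTE ni1).
  have f2 : C (p i.+1) u = false by rewrite Csym Cup // (negbTE ni2).
  have f3 : C (p i.-1) (p i) by rewrite CpE // ni4 orbT.
  have f4 : C (p i.+1) (p i) by rewrite CpE // ni5 orbT.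
  apply: (@Dtilde_absurd _ _ Crefl _ reg 2 c q).
  - by [].
  - case=> [|[|//]] [|[|//]] _ _; rewrite /c /= ?Crefl ?Cup ?[C _ u]Csym ?Cup ?eqxx //.
  - case=> [|[|//]] [|[|//]] _ _ //; rewrite /c /= => h; first by case: (nu i_m h).
    by case: (nu i_m (esym h)).
  - by case=> [[] []] [[] []] // _; rewrite /q ?Cwz ?Czw ?Cwp ?Czp ?Cpw ?Cpz ?g1 ?g2.
  - by case=> [[] []] [|[|//]] _; rewrite /c /q /= ?f1 ?f2 ?f3 ?f4 ?Cwu ?Czu ?Cwp ?Czp.
  - case=> [[] []] [|[|//]] _; rewrite /c /q //=.
    + by move/esym; apply: nu.
    + by move/pI => h; move/eqP: ni1; apply; apply: h.
    + by move/esym; apply: nu.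
    + by move/pI => h; move/eqP: ni2; apply; apply: h.
    + exact: nw.
    + exact: nz.
have ewz : e w z.
  by case: ez => [[k [km]]|h|[//]]; [rewrite edgeC ezp|rewrite h in neuz].
(* Here [i] is 2 and [m] is 5, and the path [z], [w], [u], [p 2], [p 3], [p 4] has 6 vertices. *)
apply: (IH (m' := (m - i).+3)) (induced_path_cons cz ipw _ _); first order_lia.
- by case=> [|[|j]] jm //=; apply: nz; order_lia.
- case=> [|[|j]] jm //=; first by rewrite edgeC.
    by rewrite edgeC (negbTE neuz).
  by rewrite ezp; order_lia.
Qed.

End Branch.

End LongestPath.

(** Induction on #|P| - m replaces the choice of a longest path. Reversing the path, if necessary,
    puts the branch vertex where [branch_case] expects it. *)
Lemma triangle_free_case m p : 0 < m -> induced_path m p -> goal.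
Proof.
have [d] := ubnP (#|P| - m); elim: d m p => // d IHd m p dm m0 ip.
have IH m' p' : m < m' -> induced_path m' p' -> goal.
  by move=> mm' ip'; have le' := induced_path_le ip'; apply: (IHd m' p') => //; order_lia.
have [pc pI pE] := ip.
have hc (k : 'I_m) : comp (p k) by apply: pc.
case: (closed_or_crossing (h := fun k : 'I_m => p k) (Ordinal m0) hc) => [full|[k [u [cu ku nu]]]].
  right; left; exists m => //.
  apply: (iso_of_embedding (H := path_graph m) (h := fun k : 'I_m => p k) (Ordinal m0)) => //.
    by move=> x y /pI h; apply: val_inj; apply: h.
  by move=> x y; rewrite pE.
have {}nu j : j < m -> u <> p j by move=> jm; apply: (nu (Ordinal jm)).
case: (path_attach ip m0 IH nu (ltn_ord k) ku) => // -[i [i0 im eu]].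
have [h|h] := ltnP (i + i) m; first exact: (branch_case ip m0 IH nu eu i0 h).
apply: (branch_case (induced_path_rev ip) m0 IH (i := m.-1 - i) (u := u)); try order_lia.
  by move=> j jm; apply: nu; order_lia.
by move=> j jm; rewrite eu; order_lia.
Qed.

End Component.

Lemma regular_types (P : finType) (C : rel P) (Crefl : reflexive C) (Csym : symmetric C) :
  regular Csym -> forall v : concurrency_graph C, regular_type (component v).
Proof.
move=> reg v; pose e : rel P := fun x y => (x != y) && C x y.
have [/existsP[x /existsP[y /existsP[z /and4P[cx xy yz xz]]]]|no] :=
    boolP [exists x, exists y, exists z, [&& connect e v x, e x y, e y z & e x z]].
  exact: (complete_case (triangle_complete Crefl reg cx xy yz xz)).
have tf x y z : connect e v x -> e x y -> e y z -> e x z -> False.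
  move=> cx xy yz xz; move/negP: no; apply.
  apply/existsP; exists x; apply/existsP; exists y; apply/existsP; exists z.
  by rewrite cx xy yz xz.
apply: (triangle_free_case Crefl reg tf (m := 1) (p := fun=> v)) => //; split.
- by move=> *; apply: connect0.
- by case=> [|i] [|j].
- by case=> [|i] // [|j] // _ _; rewrite eqxx.
Qed.

Theorem theorem1p5p2 (P : finType) (C : rel P)
    (Crefl : reflexive C) (Csym : symmetric C) :
  regular Csym <->
  forall v : concurrency_graph C, regular_type (component v).
Proof.
split; first exact: regular_types.
exact: regular_of_types.
Qed.
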